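(* Let $M$ be any simple cuspidal $A\mathfrak L$-module. Then: (1) $M\cong F(V,\lambda)$ for some $\lambda\in\mathbb C$ and some finite dimensional $\mathbb Z_n$-graded-simple $\ddot{\mathfrak g}$-module $V$; (2) $M$ is isomorphic to a simple $\widetilde{\mathfrak L}$ sub-quotient of a loop module $\Gamma(V',\lambda)$ for some $\lambda\in\mathbb C$ and some finite dimensional simple $\ddot{\mathfrak g}$-module $V'$.
   Context: All vector spaces are over $\mathbb C$; all modules over Lie superalgebras are $\mathbb Z_2$-graded. Standing setting: $\dot{\mathfrak g}$ is a finite dimensional Lie superalgebra (possibly a Lie algebra), $d$ an even derivation of $\dot{\mathfrak g}$ such that $1$ is not an eigenvalue of $d$, $\sigma$ an automorphism of $\dot{\mathfrak g}$ of order $n$ commuting with $d$. Let $A=\mathbb C[t,t^{-1}]$ and let $W=\mathrm{Der}(A)$ have basis $\mathfrak l_i=t^{i+1}\frac{d}{dt}$ ($i\in\mathbb Z$), $[\mathfrak l_i,\mathfrak l_j]=(j-i)\mathfrak l_{i+j}$. Put $\omega_n=\exp(2\pi\sqrt{-1}/n)$, $\dot{\mathfrak g}_{[i]}=\{g:\sigma(g)=\omega_n^i g\}$ for $[i]\in\mathbb Z_n$, $\mathfrak g=\bigoplus_{i=0}^{n-1}\dot{\mathfrak g}_{[i]}\otimes t^{i/n}A$, $xt^a=x\otimes t^a$. Then $\mathfrak L=W\ltimes\mathfrak g$ with $[\mathfrak l_i,xt^a]=(ax+i\,d(x))t^{i+a}$, $[xt^a,yt^b]=[x,y]t^{a+b}$.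 $\widetilde{\mathfrak L}=\mathfrak L\ltimes A$ with $[A,A]=0$, $[\mathfrak g,A]=0$, $[\mathfrak l_i,t^j]=jt^{i+j}$. An $A\mathfrak L$-module is a $\widetilde{\mathfrak L}$-module $P$ on which $A$ acts associatively: $t^it^jv=t^{i+j}v$, $t^0v=v$. It is a weight module if $\mathfrak l_0$ acts diagonalizably, with weight spaces $M_\lambda=\{v:\mathfrak l_0v=\lambda v\}$, and a weight module is cuspidal if there is $N\in\mathbb N$ with $\dim M_\lambda\le N$ for all $\lambda$. $\ddot{\mathfrak g}=\mathbb C\partial\ltimes\dot{\mathfrak g}$ with $\partial$ even, $[\partial,x]=d(x)$; it is $\mathbb Z_n$-graded by $\ddot{\mathfrak g}_{[i]}=\dot{\mathfrak g}_{[i]}\oplus\delta_{[i],[0]}\mathbb C\partial$. A $\mathbb Z_n$-graded $\ddot{\mathfrak g}$-module is a module $V=\bigoplus_{i=0}^{n-1}V_{[i]}$ (decomposition into super subspaces) with $\ddot{\mathfrak g}_{[i]}V_{[j]}\subseteq V_{[i+j]}$; it is $\mathbb Z_n$-graded-simple if it has no nontrivial $\mathbb Z_n$-graded submodule. For a $\ddot{\mathfrak g}$-module $V$ and $\lambda\in\mathbb C$, the loop module $\Gamma(V,\lambda)=V\otimes\mathbb C[t^{1/n},t^{-1/n}]$ is the weight $A\mathfrak L$-module with actions $t^i(v\otimes t^b)=v\otimes t^{b+i}$, $\mathfrak l_i(v\otimes t^b)=(\lambda+b+i\partial)v\otimes t^{b+i}$, $xt^a(v\otimes t^b)=xv\otimes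 t^{a+b}$ for $xt^a\in\mathfrak g$, $i\in\mathbb Z$, $b\in\frac1n\mathbb Z$, $v\in V$. For a $\mathbb Z_n$-graded $\ddot{\mathfrak g}$-module $V$, $F(V,\lambda)=\bigoplus_{j\in\mathbb Z}V_{[j]}\otimes t^{j/n}\subseteq\Gamma(V,\lambda)$, an $A\mathfrak L$-submodule. *)

(* Defs.v *)
From HB Require Import structures.
From mathcomp Require Import all_boot all_order all_algebra.
From mathcomp Require Import ring zify.
From mathcomp Require Import complex.
From mathcomp Require Import all_classical all_reals.
From mathcomp Require Import sequences exp trigo.

Set Implicit Arguments.
Unset Strict Implicit.
Unset Printing Implicit Defensive.

Import Order.TTheory GRing.Theory Num.Theory.
Local Open Scope ring_scope.

Section LinearAlgebra.
Variables (K : fieldType) (V : lmodType K).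

Definition lin_closed (P : V -> Prop) :=
  P 0 /\ forall a u v, P u -> P v -> P (a *: u + v).

Definition asbool_pred (P : V -> Prop) : V -> bool := fun v => `[< P v >].

Lemma asbool_pred_closed (P : V -> Prop) :
  lin_closed P -> GRing.subsemimod_closed (asbool_pred P).
Proof.
move=> [P0 PD]; split; first split.
- exact/asboolP.
- move=> u v /asboolP Pu /asboolP Pv; apply/asboolP.
  by rewrite -[u]scale1r; apply: PD.
- move=> a v /asboolP Pv; apply/asboolP.
  by rewrite -[a *: v]addr0; apply: PD.
Qed.

Definition subspace_of (P : V -> Prop) (h : lin_closed P) : submodClosed V :=
  HB.pack (asbool_pred P)
    (GRing.isSubmodClosed.Build K V (asbool_pred P) (asbool_pred_closed h)).

Lemma subspace_ofP (P : V -> Prop) (h : lin_closed P) v :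
  reflect (P v) (v \in subspace_of h).
Proof. exact: asboolP. Qed.

Lemma lin_closed_mem (S : submodClosed V) : lin_closed (fun v => v \in S).
Proof. by split=> [|a u v Su Sv]; rewrite ?rpred0 // rpredD ?rpredZ. Qed.

Record subspace_type (S : submodClosed V) :=
  SubspaceElt { sub_val :> V; sub_valP : sub_val \in S }.

Variable S : submodClosed V.
HB.instance Definition _ := [isSub for @sub_val S].
HB.instance Definition _ := [Choice of subspace_type S by <:].
HB.instance Definition _ := [SubChoice_isSubLmodule of subspace_type S by <:].

Lemma sub_val_linear : linear (@sub_val S).
Proof. by []. Qed.

Lemma subspaceN : GRing.oppr_closed S.
Proof. by move=> v Sv; rewrite -scaleN1r rpredZ. Qed.

Definition subspace_zmod : zmodClosed V :=
  HB.pack (GRing.SubmodClosed.sort S)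
    (GRing.isOppClosed.Build V (GRing.SubmodClosed.sort S) subspaceN).

Definition quotient_type := Quotient.quot subspace_zmod.
HB.instance Definition _ := GRing.Zmodule.on quotient_type.
HB.instance Definition _ := EqQuotient.on quotient_type.

Definition proj (v : V) : quotient_type := (\pi_(Quotient.quot subspace_zmod) v)%qT.

Lemma proj_eq u v : (proj u = proj v) <-> (u - v \in S).
Proof. by rewrite -[u - v \in S]/(u - v \in subspace_zmod) Quotient.idealrBE; split=> [/eqP|/eqP]. Qed.

Lemma projB : {morph proj : u v / u - v}.
Proof. by move=> u v; rewrite /proj !piE. Qed.

Lemma projD : {morph proj : u v / u + v}.
Proof. by move=> u v; rewrite /proj !piE. Qed.

Lemma proj0 : proj 0 = 0.
Proof. by have := projB 0 0; rewrite !subrr. Qed.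

Lemma proj_repr q : proj (repr (q : Quotient.quot subspace_zmod)) = q.
Proof. exact: reprK. Qed.

Definition quot_scale (a : K) (q : quotient_type) : quotient_type :=
  proj (a *: repr (q : Quotient.quot subspace_zmod)).

Lemma quot_scaleE a v : quot_scale a (proj v) = proj (a *: v).
Proof.
apply/proj_eq; rewrite -scalerBr rpredZ //.
by apply/proj_eq; rewrite proj_repr.
Qed.

Lemma quot_scaleA a b q : quot_scale a (quot_scale b q) = quot_scale (a * b) q.
Proof. by rewrite -[q]proj_repr !quot_scaleE scalerA. Qed.
Lemma quot_scale1 : left_id 1 quot_scale.
Proof. by move=> q; rewrite -[q]proj_repr quot_scaleE scale1r. Qed.
Lemma quot_scaleDr : right_distributive quot_scale +%R.
Proof.
move=> a p q; rewrite -[p]proj_repr -[q]proj_repr.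
by rewrite -projD !quot_scaleE -projD scalerDr.
Qed.
Lemma quot_scaleDl q : {morph quot_scale^~ q : a b / a + b}.
Proof.
by move=> a b; rewrite -[q]proj_repr !quot_scaleE -projD scalerDl.
Qed.
HB.instance Definition _ := GRing.Zmodule_isLmodule.Build K quotient_type
  quot_scaleA quot_scale1 quot_scaleDr quot_scaleDl.

Lemma projZ a : {morph proj : v / a *: v}.
Proof. by move=> v; rewrite -quot_scaleE. Qed.

End LinearAlgebra.

Section Superspaces.
Variables (K : fieldType) (V : lmodType K).
Implicit Types (S : bool -> submodClosed V) (N : submodClosed V).

(* The two members of a Z_2-grading are indexed by bool, false being even. *)
Definition super_decomp S :=
  (forall v, exists v0 v1, [/\ v0 \in S false, v1 \in S true & v = v0 + v1]) /\
  (forall v, v \in S false -> v \in S true -> v = 0).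

Definition is_super_subspace S N := forall v, v \in N ->
  exists v0 v1, [/\ v0 \in N, v1 \in N, v0 \in S false, v1 \in S true
                  & v = v0 + v1].

Definition fin_dim := exists n, inhabited (Vector.axiom n V).

Definition dim_le (m : nat) :=
  exists2 n, (n <= m)%N & inhabited (Vector.axiom n V).

Lemma super_decomp_uniq S v0 v1 w0 w1 : super_decomp S ->
  v0 \in S false -> v1 \in S true -> w0 \in S false -> w1 \in S true ->
  v0 + v1 = w0 + w1 -> v0 = w0 /\ v1 = w1.
Proof.
move=> [_ Sd] v0S v1S w0S w1S e.
have BN T (x y : V) : x \in (T : submodClosed V) -> y \in T -> x - y \in T.
  by move=> Tx Ty; rewrite -scaleN1r rpredD ?rpredZ.
have e0 : v0 - w0 = w1 - v1.
  by apply/eqP; rewrite subr_eq addrAC eq_sym subr_eq e addrC.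
have d0 : v0 - w0 = 0 by apply: Sd; [exact: BN | rewrite e0; exact: BN].
by split; apply/eqP; rewrite -subr_eq0 ?d0 // -opprB oppr_eq0 -e0 d0.
Qed.

End Superspaces.

Arguments fin_dim {K} V.
Arguments dim_le {K} V m.

Record lieSuper (K : fieldType) := LieSuper {
  lie_space :> lmodType K;
  lie_par : bool -> submodClosed lie_space;
  lie_br : lie_space -> lie_space -> lie_space;
  lie_decomp : super_decomp lie_par;
  lie_linl : forall y, linear (lie_br^~ y);
  lie_linr : forall x, linear (lie_br x);
  lie_brP : forall p q x y, x \in lie_par p -> y \in lie_par q ->
    lie_br x y \in lie_par (p (+) q);
  lie_skew : forall p q x y, x \in lie_par p -> y \in lie_par q ->
    lie_br x y = - ((-1) ^+ (p && q) *: lie_br y x);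
  lie_jacobi : forall p q x y z, x \in lie_par p -> y \in lie_par q ->
    lie_br (lie_br x y) z =
      lie_br x (lie_br y z) - (-1) ^+ (p && q) *: lie_br y (lie_br x z) }.

Record supermod (K : fieldType) (L : lieSuper K) := Supermod {
  mod_space :> lmodType K;
  mod_par : bool -> submodClosed mod_space;
  act : L -> mod_space -> mod_space;
  mod_decomp : super_decomp mod_par;
  act_linl : forall v, linear (act^~ v);
  act_linr : forall x, linear (act x);
  actP : forall p q x v, x \in lie_par L p -> v \in mod_par q ->
    act x v \in mod_par (p (+) q);
  act_br : forall p q x y v, x \in lie_par L p -> y \in lie_par L q ->
    act (lie_br x y) v = act x (act y v) - (-1) ^+ (p && q) *: act y (act x v) }.

Section Supermodules.
Variables (K : fieldType) (L : lieSuper K).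
Implicit Types M : supermod L.

Record submodule M := Submodule {
  submod_space :> submodClosed M;
  submod_super : is_super_subspace (@mod_par _ _ M) submod_space;
  submod_act : forall x v, v \in submod_space -> act x v \in submod_space }.

Definition simple M := (exists v : M, v != 0) /\
  forall N : submodule M, (forall v, v \in N -> v = 0) \/ (forall v, v \in N).

Definition mod_iso M M' := exists phi : M -> M',
  [/\ linear phi, bijective phi,
      forall p v, v \in mod_par M p -> phi v \in mod_par M' p
    & forall x v, phi (act x v) = act x (phi v)].

Section SubQuotient.
Variables (M : supermod L) (N : submodule M).

Lemma sub_par_closed p :
  lin_closed (fun v : subspace_type N => sub_val v \in mod_par M p).
Proof.
split=> [|a u v Pu Pv]; first exact: rpred0.
by rewrite sub_val_linear rpredD ?rpredZ.
Qed.

Definition sub_par p := subspace_of (sub_par_closed p).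

Definition sub_act (x : L) (v : subspace_type N) : subspace_type N :=
  SubspaceElt (submod_act x (sub_valP v)).

Lemma sub_decomp : super_decomp sub_par.
Proof.
split=> [v|v /subspace_ofP v0 /subspace_ofP v1].
  have [v0 [v1 [N0 N1 P0 P1 e]]] := submod_super (sub_valP v).
  exists (SubspaceElt N0), (SubspaceElt N1).
  by split; [exact/subspace_ofP | exact/subspace_ofP | exact: val_inj].
by apply: val_inj; apply: (mod_decomp M).2.
Qed.

Lemma sub_act_linl v : linear (sub_act^~ v).
Proof. by move=> a x y; apply: val_inj; rewrite /= act_linl. Qed.
Lemma sub_act_linr x : linear (sub_act x).
Proof. by move=> a u v; apply: val_inj; rewrite /= act_linr. Qed.
Lemma sub_actP p q x v : x \in lie_par L p -> v \in sub_par q ->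
  sub_act x v \in sub_par (p (+) q).
Proof. by move=> px /subspace_ofP qv; apply/subspace_ofP; apply: actP. Qed.
Lemma sub_act_br p q x y v : x \in lie_par L p -> y \in lie_par L q ->
  sub_act (lie_br x y) v =
  sub_act x (sub_act y v) - (-1) ^+ (p && q) *: sub_act y (sub_act x v).
Proof.
by move=> px qy; apply: val_inj; rewrite /= (act_br _ px qy).
Qed.

Definition sub_mod : supermod L :=
  Supermod sub_decomp sub_act_linl sub_act_linr sub_actP sub_act_br.

Lemma quot_par_closed p : lin_closed (fun q : quotient_type N =>
  exists2 v, v \in mod_par M p & q = proj N v).
Proof.
split=> [|a _ _ [u Pu ->] [v Pv ->]].
  by exists 0; rewrite ?rpred0 // proj0.
by exists (a *: u + v); rewrite ?rpredD ?rpredZ // projD projZ.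
Qed.

Definition quot_par p := subspace_of (quot_par_closed p).

Definition quot_act (x : L) (q : quotient_type N) : quotient_type N :=
  proj N (act x (repr (q : Quotient.quot (subspace_zmod N)))).

Lemma quot_actE x v : quot_act x (proj N v) = proj N (act x v).
Proof.
apply/proj_eq; set w := repr _.
have -> : act x w - act x v = act x (w - v).
  by rewrite addrC -scaleN1r -act_linr scaleN1r addrC.
by apply: submod_act; apply/proj_eq; rewrite proj_repr.
Qed.

Lemma quot_decomp : super_decomp quot_par.
Proof.
split=> [q|q /subspace_ofP[v0 P0 ->] /subspace_ofP[v1 P1]].
  rewrite -[q]proj_repr; set v := repr _.
  have [v0 [v1 [P0 P1 ->]]] := (mod_decomp M).1 v.
  exists (proj N v0), (proj N v1); split; last exact: projD.
  - by apply/subspace_ofP; exists v0.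
  - by apply/subspace_ofP; exists v1.
move=> /proj_eq /submod_super[w0 [w1 [N0 N1 W0 W1 e]]].
have P1' : - v1 \in mod_par M true by rewrite -scaleN1r rpredZ.
have [-> _] := super_decomp_uniq (mod_decomp M) P0 P1' W0 W1 e.
by rewrite -(proj0 N); apply/proj_eq; rewrite subr0.
Qed.

Lemma quot_act_linl q : linear (quot_act^~ q).
Proof.
move=> a x y; rewrite -[q]proj_repr /= !quot_actE act_linl.
by rewrite projD projZ.
Qed.
Lemma quot_act_linr x : linear (quot_act x).
Proof.
move=> a u v; rewrite -[u]proj_repr -[v]proj_repr -projZ -projD !quot_actE.
by rewrite act_linr projD projZ.
Qed.
Lemma quot_actP p r x q : x \in lie_par L p -> q \in quot_par r ->
  quot_act x q \in quot_par (p (+) r).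
Proof.
move=> px /subspace_ofP[v rv ->]; apply/subspace_ofP; rewrite quot_actE.
by exists (act x v); rewrite ?actP.
Qed.
Lemma quot_act_br p r x y q : x \in lie_par L p -> y \in lie_par L r ->
  quot_act (lie_br x y) q =
  quot_act x (quot_act y q) - (-1) ^+ (p && r) *: quot_act y (quot_act x q).
Proof.
move=> px ry; rewrite -[q]proj_repr !quot_actE (act_br _ px ry).
by rewrite projB projZ.
Qed.

Definition quot_mod : supermod L :=
  Supermod quot_decomp quot_act_linl quot_act_linr quot_actP quot_act_br.

End SubQuotient.

(* Q is isomorphic to a simple quotient N / N' with N' <= N <= M. *)
Definition iso_simple_subquotient (Q M : supermod L) :=
  exists (N : submodule M) (N' : submodule (sub_mod N)),
    simple (quot_mod N') /\ mod_iso Q (quot_mod N').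

End Supermodules.

Section Laurent.
Variable K : fieldType.

(* A vector-valued Laurent polynomial in t^(1/n) is the function k |-> coefficient
   of t^(k/n) on int; its support has to be bounded. *)
Definition fin_supp (V : lmodType K) (f : int -> V) :=
  exists N : nat, forall k : int, (N < `|k|)%N -> f k = 0.

Definition mono (V : lmodType K) (r : int) (v : V) : int -> V :=
  fun k => if k == r then v else 0.

Definition conv (U V W : lmodType K) (B : int -> int -> U -> V -> W)
    (f : int -> U) (g : int -> V) : int -> W :=
  fun k => \sum_(r \in [set: int]) B r (k - r) (f r) (g (k - r)).

Lemma fin_supp_closed (V : lmodType K) : lin_closed (@fin_supp V).
Proof.
split=> [|a f g [N hN] [M hM]]; first by exists 0%N.
exists (N + M)%N => k hk; rewrite !fctE.
by rewrite hN ?hM ?scaler0 ?addr0 //; lia.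
Qed.

Lemma fin_supp_mono (V : lmodType K) r (v : V) : fin_supp (mono r v).
Proof.
by exists `|r|%N => k hk; rewrite /mono; case: eqP hk => // ->; rewrite ltnn.
Qed.

Definition irange (N : nat) : seq int :=
  [seq i%:Z - N%:Z | i <- iota 0 (N + N).+1].

Lemma irange_uniq N : uniq (irange N).
Proof. by rewrite map_inj_uniq ?iota_uniq // => i j; lia. Qed.

Lemma irange_out N (k : int) : k \notin irange N -> (N < `|k|)%N.
Proof.
move=> hk; rewrite ltnNge; apply/negP => kN; case/negP: hk.
apply/mapP; exists `|(k + N%:Z)%R|%N; last lia.
by rewrite mem_iota; lia.
Qed.

Lemma fsum_seq (V : lmodType K) (s : seq int) (F : int -> V) : uniq s ->
  (forall r, r \notin s -> F r = 0) ->
  \sum_(r \in [set: int]) F r = \sum_(r <- s) F r.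
Proof.
move=> us hF; rewrite (fsbigE s) // => [|r _ /hF //].
by apply: eq_bigl => r; rewrite in_setT.
Qed.

Section Bilinear.
Variables (U V W : lmodType K) (B : int -> int -> U -> V -> W).
Hypothesis Bl : forall r s v, linear (B r s ^~ v).
Hypothesis Br : forall r s u, linear (B r s u).

Lemma B0l r s v : B r s 0 v = 0.
Proof. by have := Bl r s v (-1) 0 0; rewrite scaler0 addr0 scaleN1r addNr. Qed.
Lemma B0r r s u : B r s u 0 = 0.
Proof. by have := Br r s u (-1) 0 0; rewrite scaler0 addr0 scaleN1r addNr. Qed.

Lemma conv_seq N f g k : (forall r, (N < `|r|)%N -> f r = 0) ->
  conv B f g k = \sum_(r <- irange N) B r (k - r) (f r) (g (k - r)).
Proof.
move=> hf; apply: fsum_seq (irange_uniq N) _ => r /irange_out /hf ->.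
exact: B0l.
Qed.

Lemma conv_linl a f f' g : fin_supp f -> fin_supp f' ->
  conv B (a *: f + f') g = a *: conv B f g + conv B f' g.
Proof.
move=> [N hN] [M hM]; apply/funext => k; rewrite !fctE.
have hN' r : (N + M < `|r|)%N -> f r = 0 by move=> h; apply: hN; lia.
have hM' r : (N + M < `|r|)%N -> f' r = 0 by move=> h; apply: hM; lia.
rewrite (conv_seq _ _ hN') (conv_seq _ _ hM') (@conv_seq (N + M)); last first.
  by move=> r h; rewrite -[LHS]/(a *: f r + f' r) hN' ?hM' // scaler0 addr0.
rewrite scaler_sumr -big_split; apply: eq_bigr => r _.
exact: Bl.
Qed.

Lemma conv_linr a f g g' : fin_supp f ->
  conv B f (a *: g + g') = a *: conv B f g + conv B f g'.
Proof.
move=> [N hN]; apply/funext => k; rewrite !fctE !(conv_seq _ _ hN).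
rewrite scaler_sumr -big_split; apply: eq_bigr => r _.
exact: Br.
Qed.

Lemma conv_monol r u g k : conv B (mono r u) g k = B r (k - r) u (g (k - r)).
Proof.
rewrite /conv (@fsum_seq _ [:: r]) //; first by rewrite big_seq1 /mono eqxx.
by move=> s; rewrite inE /mono => /negPf ->; rewrite B0l.
Qed.

Lemma conv_mono r s u v :
  conv B (mono r u) (mono s v) = mono (r + s) (B r s u v).
Proof.
apply/funext => k; rewrite conv_monol /mono subr_eq [s + r]addrC.
by case: eqP => [->|_]; rewrite ?B0r // addrAC subrr add0r.
Qed.

Lemma fin_supp_conv f g : fin_supp f -> fin_supp g -> fin_supp (conv B f g).
Proof.
move=> [N hN] [M hM]; exists (N + M)%N => k hk.
rewrite (conv_seq _ _ hN) big1 // => r _.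
have [rN|rN] := ltnP N `|r|; first by rewrite hN // B0l.
by rewrite hM ?B0r //; lia.
Qed.

Lemma conv_mem (P : int -> U -> Prop) (Q : int -> V -> Prop)
    (T : int -> submodClosed W) f g k :
  (forall r s u v, P r u -> Q s v -> B r s u v \in T (r + s)) ->
  (forall r, P r (f r)) -> (forall s, Q s (g s)) -> conv B f g k \in T k.
Proof.
move=> h hf hg; apply: rpred_sum => r _.
by rewrite -[X in T X](subrKC r); apply: h.
Qed.

End Bilinear.

Lemma mono_sum (V : lmodType K) (f : int -> V) N :
  (forall r, (N < `|r|)%N -> f r = 0) ->
  f = \sum_(r <- irange N) mono r (f r).
Proof.
move=> hf; apply/funext => k; rewrite fct_sumE.
have [kN|/irange_out kN] := boolP (k \in irange N); last first.
  by rewrite hf // big1 // => r _; rewrite /mono; case: eqP => // <-; exact: hf.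
rewrite /mono (bigD1_seq k) ?irange_uniq //= eqxx big1 ?addr0 // => r /negPf.
by rewrite eq_sym => ->.
Qed.

Lemma fin_supp_ind (V : lmodType K) (S : V -> Prop) (P : (int -> V) -> Prop) :
  P 0 ->
  (forall f g, fin_supp f -> fin_supp g -> P f -> P g -> P (f + g)) ->
  (forall r v, S v -> P (mono r v)) ->
  forall f, fin_supp f -> (forall r, S (f r)) -> P f.
Proof.
move=> P0 PD Pm f [N hN] Sf; rewrite (mono_sum hN).
have [] // : fin_supp (\sum_(r <- irange N) mono r (f r)) /\
             P (\sum_(r <- irange N) mono r (f r)).
elim/big_ind: _ => [|g h [fg Pg] [fh Ph]|r _].
- by split=> //; exact: (fin_supp_closed V).1.
- split; last exact: PD.
  by rewrite -[g]scale1r; exact: (fin_supp_closed V).2.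
- by split; [exact: fin_supp_mono | exact: Pm].
Qed.

Lemma conv_jacobi (U V : lmodType K) (B : int -> int -> U -> U -> U)
    (A : int -> int -> U -> V -> V) (e : K) (S T : U -> Prop) :
  (forall r s v, linear (B r s ^~ v)) -> (forall r s u, linear (B r s u)) ->
  (forall r s v, linear (A r s ^~ v)) -> (forall r s u, linear (A r s u)) ->
  (forall r s t u v w, S u -> T v ->
    A (r + s) t (B r s u v) w =
    A r (s + t) u (A s t v w) - e *: A s (r + t) v (A r t u w)) ->
  forall f g h, fin_supp f -> fin_supp g -> fin_supp h ->
  (forall r, S (f r)) -> (forall r, T (g r)) ->
  conv A (conv B f g) h = conv A f (conv A g h) - e *: conv A g (conv A f h).
Proof.
move=> Bl Br Al Ar HJ f g h ff fg fh Sf Tg.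
have cB f1 f2 : fin_supp f1 -> fin_supp f2 -> fin_supp (conv B f1 f2).
  exact: fin_supp_conv.
have cA f1 f2 : fin_supp f1 -> fin_supp f2 -> fin_supp (conv A f1 f2).
  exact: fin_supp_conv.
have AD1 f1 f2 g1 : fin_supp f1 -> fin_supp f2 ->
    conv A (f1 + f2) g1 = conv A f1 g1 + conv A f2 g1.
  by move=> h1 h2; rewrite -[f1 in LHS]scale1r conv_linl // scale1r.
have BD1 f1 f2 g1 : fin_supp f1 -> fin_supp f2 ->
    conv B (f1 + f2) g1 = conv B f1 g1 + conv B f2 g1.
  by move=> h1 h2; rewrite -[f1 in LHS]scale1r conv_linl // scale1r.
have AD2 f1 g1 g2 : fin_supp f1 ->
    conv A f1 (g1 + g2) = conv A f1 g1 + conv A f1 g2.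
  by move=> h1; rewrite -[g1 in LHS]scale1r conv_linr // scale1r.
have BD2 f1 g1 g2 : fin_supp f1 ->
    conv B f1 (g1 + g2) = conv B f1 g1 + conv B f1 g2.
  by move=> h1; rewrite -[g1 in LHS]scale1r conv_linr // scale1r.
have A01 g1 : conv A 0 g1 = 0.
  by apply/funext => k; rewrite /conv fsbig1 // => r _; rewrite (B0l Al).
have A02 f1 : conv A f1 0 = 0.
  by apply/funext => k; rewrite /conv fsbig1 // => r _; rewrite (B0r Ar).
have B01 g1 : conv B 0 g1 = 0.
  by apply/funext => k; rewrite /conv fsbig1 // => r _; rewrite (B0l Bl).
have B02 f1 : conv B f1 0 = 0.
  by apply/funext => k; rewrite /conv fsbig1 // => r _; rewrite (B0r Br).
have AC (x y z x' y' z' : int -> V) : x = y - e *: z -> x' = y' - e *: z' ->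
    x + x' = (y + y') - e *: (z + z').
  by move=> -> ->; rewrite scalerDr opprD addrACA.
pose PP f1 := conv A (conv B f1 g) h =
   conv A f1 (conv A g h) - e *: conv A g (conv A f1 h).
apply: (@fin_supp_ind _ S PP) f ff Sf; rewrite /PP.
- by rewrite B01 !A01 A02 scaler0 subrr.
- move=> f1 f2 h1 h2 e1 e2.
  have [c1 c2] := (cB _ _ h1 fg, cB _ _ h2 fg).
  by rewrite BD1 // !AD1 // AD2 //; exact: AC.
move=> r u Su {PP}; have fu := @fin_supp_mono U r u.
pose PP g1 := conv A (conv B (mono r u) g1) h =
   conv A (mono r u) (conv A g1 h) - e *: conv A g1 (conv A (mono r u) h).
apply: (@fin_supp_ind _ T PP) g fg Tg; rewrite /PP.
- by rewrite B02 !A01 A02 scaler0 subrr.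
- move=> g1 g2 h1 h2 e1 e2.
  have [c1 c2] := (cB _ _ fu h1, cB _ _ fu h2).
  by rewrite BD2 // !AD1 // AD2 //; exact: AC.
move=> s v Tv {PP}; have fv := @fin_supp_mono U s v.
pose PP h1 := conv A (conv B (mono r u) (mono s v)) h1 =
   conv A (mono r u) (conv A (mono s v) h1)
   - e *: conv A (mono s v) (conv A (mono r u) h1).
apply: (@fin_supp_ind _ (fun=> True) PP) h fh (fun=> I); rewrite /PP.
- by rewrite !A02 scaler0 subrr.
- move=> g1 g2 h1 h2 e1 e2; have c := cB _ _ fu fv.
  by rewrite !AD2 //; exact: AC.
move=> t w _; rewrite !conv_mono // HJ // addrA [s + (r + t)]addrCA addrA.
apply/funext => k; rewrite !fctE /mono.
by case: eqP => // _; rewrite scaler0 subrr.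
Qed.

Lemma conv_skew (U W : lmodType K) (B : int -> int -> U -> U -> W) e f g :
  (forall r s v, linear (B r s ^~ v)) -> fin_supp g ->
  (forall r s, B r s (f r) (g s) = - (e *: B s r (g s) (f r))) ->
  conv B f g = - (e *: conv B g f).
Proof.
move=> Bl [N hN] h; apply/funext => k.
rewrite -scaleNr -[RHS]/(- e *: conv B g f k) (conv_seq Bl _ _ hN) {1}/conv.
rewrite (reindex_fsbigT (fun r => k - r)) /=; last first.
  by exists (fun r => k - r) => r; rewrite subKr.
rewrite (fsum_seq (irange_uniq N)) => [|r /irange_out /hN gr0]; last first.
  by rewrite h subKr gr0 (B0l Bl) scaler0 oppr0.
by rewrite scaler_sumr; apply: eq_bigr => r _; rewrite h subKr scaleNr.
Qed.

Lemma laurent_split (V : lmodType K) (S : bool -> submodClosed V)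
    (Q : int -> V -> Prop) f :
  (forall k v, Q k v -> exists v0 v1,
     [/\ v0 \in S false, v1 \in S true, Q k v0, Q k v1 & v = v0 + v1]) ->
  (forall k, Q k 0) -> fin_supp f -> (forall k, Q k (f k)) ->
  exists f0 f1, [/\ fin_supp f0, fin_supp f1, f = f0 + f1
    & forall k, [/\ f0 k \in S false, f1 k \in S true, Q k (f0 k)
                  & Q k (f1 k)]].
Proof.
move=> hS Q0 [N hN] Qf.
have /choice[F hF] k : exists w : V * V, [/\ w.1 \in S false, w.2 \in S true,
    Q k w.1, Q k w.2 & f k = w.1 + w.2].
  by have [v0 [v1 h]] := hS k _ (Qf k); exists (v0, v1).
exists (fun k => if (`|k| <= N)%N then (F k).1 else 0).
exists (fun k => if (`|k| <= N)%N then (F k).2 else 0).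
split.
- by exists N => k; rewrite ltnNge => /negPf ->.
- by exists N => k; rewrite ltnNge => /negPf ->.
- apply/funext => k; rewrite !fctE; have [kN|kN] := leqP.
    by have [] := hF k.
  by rewrite addr0 hN.
- by move=> k; case: leqP => _; [have [] := hF k | rewrite !rpred0].
Qed.

End Laurent.

(* The ring K + V with V * V = 0, used to prove identities between vectors by
   means of the ring tactic. *)
Section SquareZero.
Variables (K : fieldType) (V : lmodType K).

Definition square_zero : Type := K^o * V.
HB.instance Definition _ := GRing.Zmodule.on square_zero.

Definition sqz_mul (x y : square_zero) : square_zero :=
  (x.1 * y.1, (x.1 : K) *: y.2 + (y.1 : K) *: x.2).

Definition sqz_one : square_zero := (1, 0).

Lemma sqz_mulA : associative sqz_mul.
Proof.
move=> [a x] [b y] [c z]; congr pair => /=; first exact: mulrA.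
rewrite !scalerDr !scalerA addrA; congr (_ + _ *: _ + _ *: _); exact: mulrC.
Qed.
Lemma sqz_mulC : commutative sqz_mul.
Proof.
by move=> [a x] [b y]; rewrite /sqz_mul /= addrC; congr pair; exact: mulrC.
Qed.
Lemma sqz_mul1 : left_id sqz_one sqz_mul.
Proof.
by move=> [a x]; rewrite /sqz_mul /= scale1r scaler0 addr0 mul1r.
Qed.
Lemma sqz_mulD : left_distributive sqz_mul +%R.
Proof.
move=> [a x] [b y] [c z]; congr pair => /=; first exact: mulrDl.
by rewrite scalerDl scalerDr addrACA.
Qed.
Lemma sqz_one_neq0 : sqz_one != 0 :> square_zero.
Proof. by apply/eqP => -[/eqP]; rewrite oner_eq0. Qed.
HB.instance Definition _ := GRing.Zmodule_isComNzRing.Build square_zero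
  sqz_mulA sqz_mulC sqz_mul1 sqz_mulD sqz_one_neq0.

Definition sqzK (a : K) : square_zero := (a, 0).
Definition sqzV (v : V) : square_zero := (0, v).

Lemma sqzV_inj : injective sqzV. Proof. by move=> u v []. Qed.
Lemma sqzVD u v : sqzV (u + v) = sqzV u + sqzV v.
Proof. by congr pair; rewrite addr0. Qed.
Lemma sqzVN v : sqzV (- v) = - sqzV v.
Proof. by congr pair; rewrite oppr0. Qed.
Lemma sqzV0 : sqzV 0 = 0. Proof. by []. Qed.
Lemma sqzVZ a v : sqzV (a *: v) = sqzK a * sqzV v.
Proof. by congr pair; rewrite /= ?mulr0 // scale0r addr0. Qed.
Lemma sqzKD a b : sqzK (a + b) = sqzK a + sqzK b.
Proof. by congr pair; rewrite addr0. Qed.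
Lemma sqzKN a : sqzK (- a) = - sqzK a.
Proof. by congr pair; rewrite oppr0. Qed.
Lemma sqzKM a b : sqzK (a * b) = sqzK a * sqzK b.
Proof. by congr pair; rewrite /= !scaler0 addr0. Qed.
Lemma sqzK1 : sqzK 1 = 1. Proof. by []. Qed.
Lemma sqzK0 : sqzK 0 = 0. Proof. by []. Qed.

Definition sqzE := (sqzVD, sqzVN, sqzV0, sqzVZ, sqzKD, sqzKN, sqzKM,
  sqzK1, sqzK0).
End SquareZero.

Ltac vector_ring := apply: sqzV_inj; rewrite !sqzE; ring.

Section LinearMaps.
Variables (K : fieldType) (U V : lmodType K) (f : U -> V).
Hypothesis fl : linear f.
Lemma linD u v : f (u + v) = f u + f v.
Proof. by rewrite -[u in LHS]scale1r fl scale1r. Qed.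
Lemma lin0 : f 0 = 0.
Proof. by apply: (addrI (f 0)); rewrite -linD !addr0. Qed.
Lemma linZ a u : f (a *: u) = a *: f u.
Proof. by rewrite -[a *: u]addr0 fl lin0 addr0. Qed.
Lemma linN u : f (- u) = - f u.
Proof. by rewrite -scaleN1r linZ scaleN1r. Qed.
End LinearMaps.

Definition linE (K : fieldType) (U V : lmodType K) (f : U -> V) (fl : linear f) :=
  (linD fl, linZ fl, linN fl, lin0 fl).

Record even_derivation (K : fieldType) (L : lieSuper K) := EvenDerivation {
  der :> L -> L;
  der_linear : linear der;
  der_even : forall p x, x \in lie_par L p -> der x \in lie_par L p;
  der_br : forall x y, der (lie_br x y) = lie_br (der x) y + lie_br x (der y) }.

Record lie_automorphism (K : fieldType) (L : lieSuper K) := LieAutomorphism {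
  aut :> L -> L;
  aut_linear : linear aut;
  aut_bij : bijective aut;
  aut_even : forall p x, x \in lie_par L p -> aut x \in lie_par L p;
  aut_br : forall x y, aut (lie_br x y) = lie_br (aut x) (aut y) }.

(* (a, x) stands for a \partial + x. *)
Section Extension.
Variables (K : fieldType) (L : lieSuper K) (d : even_derivation L).

Let brl y : (forall u v, lie_br (u + v) y = lie_br u y + lie_br v y) *
  (forall a u, lie_br (a *: u) y = a *: lie_br u y) *
  (forall u, lie_br (- u) y = - lie_br u y) * (lie_br 0 y = 0) :=
  linE (@lie_linl K L y).
Let brr x := linE (@lie_linr K L x).
Let dE := linE (der_linear d).

Definition ext_space : lmodType K := (K^o * L)%type.

Lemma ext_par_closed p : lin_closed (fun u : ext_space =>
  u.2 \in lie_par L p /\ (p -> u.1 = 0)).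
Proof.
split=> [|a u v [uP u0] [vP v0]]; first by split; rewrite ?rpred0.
split; first by rewrite /= rpredD ?rpredZ.
by move=> hp; rewrite /= u0 // v0 // scaler0 addr0.
Qed.

Definition ext_par p := subspace_of (ext_par_closed p).

Lemma ext_fst_lin a (u v : ext_space) :
  (a *: u + v).1 = a * (u.1 : K) + (v.1 : K) :> K.
Proof. by []. Qed.
Lemma ext_snd_lin a (u v : ext_space) : (a *: u + v).2 = a *: u.2 + v.2.
Proof. by []. Qed.

Definition ext_br (u v : ext_space) : ext_space :=
  (0, lie_br u.2 v.2 + (u.1 : K) *: d v.2 - (v.1 : K) *: d u.2).

Lemma ext_decomp : super_decomp ext_par.
Proof.
split=> [[a x]|u]; last first.
  move=> /subspace_ofP[x0 _] /subspace_ofP[x1 a0]; rewrite (surjective_pairing u).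
  by rewrite a0 // ((lie_decomp L).2 u.2).
have [x0 [x1 [P0 P1 ->]]] := (lie_decomp L).1 x.
exists ((a, x0) : ext_space), ((0, x1) : ext_space).
by split; [apply/subspace_ofP..|congr pair; rewrite addr0].
Qed.
Lemma ext_linl v : linear (ext_br^~ v).
Proof.
move=> a x y; congr pair => /=; first by rewrite scaler0 addr0.
by rewrite !brl !dE; vector_ring.
Qed.
Lemma ext_linr u : linear (ext_br u).
Proof.
move=> a x y; congr pair => /=; first by rewrite scaler0 addr0.
by rewrite !brr !dE; vector_ring.
Qed.
Lemma ext_brP p q u v : u \in ext_par p -> v \in ext_par q ->
  ext_br u v \in ext_par (p (+) q).
Proof.
move=> /subspace_ofP[uP u0] /subspace_ofP[vP v0]; apply/subspace_ofP; split=> //.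
have h1 := lie_brP uP vP.
have h2 := der_even d uP; have h3 := der_even d vP.
rewrite /= -scaleNr !rpredD //.
- case: p uP u0 h1 h2 => uP u0 h1 h2; last by rewrite rpredZ.
  by rewrite u0 // scale0r rpred0.
- case: q vP v0 h1 h3 => vP v0 h1 h3; last by rewrite addbF rpredZ.
  by rewrite v0 // oppr0 scale0r rpred0.
Qed.
Lemma ext_skew p q u v : u \in ext_par p -> v \in ext_par q ->
  ext_br u v = - ((-1) ^+ (p && q) *: ext_br v u).
Proof.
move=> /subspace_ofP[uP u0] /subspace_ofP[vP v0]; congr pair => /=.
  by rewrite scaler0 oppr0.
rewrite (lie_skew uP vP).
by case: p q uP u0 vP v0 => [] [] _ u0 _ v0;
  try rewrite (u0 isT); try rewrite (v0 isT); rewrite ?expr0 ?expr1;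
  vector_ring.
Qed.
Lemma ext_jacobi p q u v w : u \in ext_par p -> v \in ext_par q ->
  ext_br (ext_br u v) w =
  ext_br u (ext_br v w) - (-1) ^+ (p && q) *: ext_br v (ext_br u w).
Proof.
move=> /subspace_ofP[uP u0] /subspace_ofP[vP v0]; congr pair => /=.
  by rewrite scaler0 subr0.
rewrite !(brl, brr, dE, der_br) (lie_jacobi _ uP vP).
rewrite (lie_skew vP (der_even d uP)).
by case: p q uP u0 vP v0 => [] [] _ u0 _ v0;
  try rewrite (u0 isT); try rewrite (v0 isT); rewrite ?expr0 ?expr1;
  vector_ring.
Qed.

Definition extension : lieSuper K :=
  LieSuper ext_decomp ext_linl ext_linr ext_brP ext_skew ext_jacobi.

Definition cf_space : lmodType K := (K^o * L * K^o)%type.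
Definition cW (u : cf_space) : K := u.1.1.
Definition cG (u : cf_space) : L := u.1.2.
Definition cA (u : cf_space) : K := u.2.

Lemma cf_eta u : u = (cW u, cG u, cA u). Proof. by case: u => [[]]. Qed.
Lemma cW_lin a u v : cW (a *: u + v) = a * cW u + cW v. Proof. by []. Qed.
Lemma cG_lin a u v : cG (a *: u + v) = a *: cG u + cG v. Proof. by []. Qed.
Lemma cA_lin a u v : cA (a *: u + v) = a * cA u + cA v. Proof. by []. Qed.

(* cf_br r s u v is the coefficient of [u t^r, v t^s], where (a, x, b) t^r, with r
   a scalar, stands for a l_r + x t^r + b t^r. *)
Definition cf_br (r s : K) (u v : cf_space) : cf_space :=
  ((s - r) * (cW u * cW v),
   lie_br (cG u) (cG v) + cW u *: (s *: cG v + r *: d (cG v))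
                        - cW v *: (r *: cG u + s *: d (cG u)),
   s * (cW u * cA v) - r * (cW v * cA u)).

Lemma cW_br r s u v : cW (cf_br r s u v) = (s - r) * (cW u * cW v).
Proof. by []. Qed.
Lemma cG_br r s u v : cG (cf_br r s u v) =
  lie_br (cG u) (cG v) + cW u *: (s *: cG v + r *: d (cG v))
                       - cW v *: (r *: cG u + s *: d (cG u)).
Proof. by []. Qed.
Lemma cA_br r s u v :
  cA (cf_br r s u v) = s * (cW u * cA v) - r * (cW v * cA u).
Proof. by []. Qed.

Lemma cf_par_closed p : lin_closed (fun u : cf_space =>
  cG u \in lie_par L p /\ (p -> cW u = 0 /\ cA u = 0)).
Proof.
split=> [|a u v [uP u0] [vP v0]]; first by split; rewrite ?rpred0.
split; first by rewrite cG_lin rpredD ?rpredZ.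
move=> hp; rewrite cW_lin cA_lin.
by have [-> ->] := u0 hp; have [-> ->] := v0 hp; rewrite mulr0 addr0.
Qed.

Definition cf_par p := subspace_of (cf_par_closed p).

Lemma cf_linl r s v : linear (cf_br r s ^~ v).
Proof.
move=> a x y; rewrite /cf_br cW_lin cA_lin cG_lin.
congr (_, _, _); rewrite /= -?[_ *: (_ : K^o)]/(_ * _).
- by ring.
- by rewrite !brl !dE; vector_ring.
- by ring.
Qed.
Lemma cf_linr r s u : linear (cf_br r s u).
Proof.
move=> a x y; rewrite /cf_br cW_lin cA_lin cG_lin.
congr (_, _, _); rewrite /= -?[_ *: (_ : K^o)]/(_ * _).
- by ring.
- by rewrite !brr !dE; vector_ring.
- by ring.
Qed.
Lemma cf_brP p q r s u v : u \in cf_par p -> v \in cf_par q ->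
  cf_br r s u v \in cf_par (p (+) q).
Proof.
move=> /subspace_ofP[uP u0] /subspace_ofP[vP v0]; apply/subspace_ofP.
rewrite /cf_br /cW /cA /cG /= -/(cW u) -/(cW v) -/(cA u) -/(cA v).
rewrite -/(cG u) -/(cG v).
have h1 := lie_brP uP vP.
have h2 := der_even d uP; have h3 := der_even d vP.
case: p q uP u0 vP v0 h1 h2 h3 => [] [] uP u0 vP v0 h1 h2 h3.
- have [[-> ->] [-> ->]] := (u0 isT, v0 isT).
  by rewrite !scale0r subr0 addr0.
- have [-> ->] := u0 isT.
  rewrite !(mul0r, mulr0, subr0, scale0r, addr0); split=> //.
  by rewrite -scaleNr rpredD ?rpredZ ?rpredD ?rpredZ.
- have [-> ->] := v0 isT.
  rewrite !(mul0r, mulr0, subr0, scale0r, addr0); split=> //.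
  by rewrite rpredD ?rpredZ ?rpredD ?rpredZ.
- split=> //.
  by rewrite -scaleNr !rpredD ?rpredZ ?rpredD ?rpredZ.
Qed.
Lemma cf_skew p q r s u v : u \in cf_par p -> v \in cf_par q ->
  cf_br r s u v = - ((-1) ^+ (p && q) *: cf_br s r v u).
Proof.
move=> /subspace_ofP[uP u0] /subspace_ofP[vP v0].
have h := lie_skew uP vP; rewrite /cf_br.
case: p q uP u0 vP v0 h => [] [] _ u0 _ v0 ->;
  try (have [-> ->] := u0 isT); try (have [-> ->] := v0 isT);
  congr (_, _, _); rewrite /= -?[_ *: (_ : K^o)]/(_ * _) ?expr0 ?expr1.
all: by [ring | vector_ring].
Qed.
Lemma cf_jacobi p q r s t u v w : u \in cf_par p -> v \in cf_par q ->
  cf_br (r + s) t (cf_br r s u v) w =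
  cf_br r (s + t) u (cf_br s t v w)
  - (-1) ^+ (p && q) *: cf_br s (r + t) v (cf_br r t u w).
Proof.
move=> /subspace_ofP[uP u0] /subspace_ofP[vP v0].
have h := lie_jacobi (cG w) uP vP.
have h1 := lie_skew vP uP; have h2 := lie_skew vP (der_even d uP).
rewrite /cf_br /cW /cA /cG /= -/(cW u) -/(cW v) -/(cA u) -/(cA v).
rewrite -/(cG u) -/(cG v) -/(cG w) -/(cA w) -/(cW w).
rewrite !(brl, brr, dE, der_br) h h1 h2.
case: p q uP u0 vP v0 h h1 h2 => [] [] _ u0 _ v0 _ _ _;
  try (have [-> ->] := u0 isT); try (have [-> ->] := v0 isT);
  congr (_, _, _); rewrite /= -?[_ *: (_ : K^o)]/(_ * _) ?expr0 ?expr1.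
all: by [ring | vector_ring].
Qed.

Section Action.
Variable V : supermod extension.

Let ar x := linE (@act_linr K extension V x).

Definition ext_elt (a : K) (x : L) : extension := ((a, x) : ext_space).

(* cf_act lambda r s u v is the coefficient of (u t^r) (v \otimes t^s). *)
Definition cf_act (lambda r s : K) (u : cf_space) (v : V) : V :=
  (cW u * (lambda + s) + cA u) *: v + act (ext_elt (cW u * r) (cG u)) v.

Lemma act_ext a x (v : V) :
  act (ext_elt a x) v = a *: act (ext_elt 1 0) v + act (ext_elt 0 x) v.
Proof.
rewrite -act_linl; congr act; congr pair; rewrite /= ?scaler0 ?add0r //.
by rewrite addr0; exact/esym/mulr1.
Qed.
Lemma act_extl a x y (v : V) : act (ext_elt 0 (a *: x + y)) v =
  a *: act (ext_elt 0 x) v + act (ext_elt 0 y) v.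
Proof. by rewrite -act_linl; congr act; congr pair; rewrite /= scaler0 addr0. Qed.

Lemma act_d x (v : V) : act (ext_elt 0 (d x)) v =
  act (ext_elt 1 0) (act (ext_elt 0 x) v) - act (ext_elt 0 x) (act (ext_elt 1 0) v).
Proof.
have par_d : ext_elt 1 0 \in lie_par extension false.
  by apply/subspace_ofP; split; rewrite ?rpred0.
have key p y : y \in lie_par L p -> act (ext_elt 0 (d y)) v =
    act (ext_elt 1 0) (act (ext_elt 0 y) v)
    - act (ext_elt 0 y) (act (ext_elt 1 0) v).
  move=> py; have pe : ext_elt 0 y \in lie_par extension p.
    by apply/subspace_ofP.
  have := act_br v par_d pe; rewrite expr0 scale1r => <-; congr act.
  by congr pair; rewrite /= brl scale0r scale1r subr0 add0r.
have [x0 [x1 [P0 P1 ->]]] := (lie_decomp L).1 x.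
rewrite dE -[d x0]scale1r -[x0 in RHS]scale1r !act_extl !ar !scale1r.
by rewrite (key _ _ P0) (key _ _ P1) opprD addrACA.
Qed.

Lemma cf_act_linl lambda r s v : linear (cf_act lambda r s ^~ v).
Proof.
move=> a x y; rewrite /cf_act cW_lin cA_lin cG_lin.
rewrite !(act_ext (_ * _)) act_extl; vector_ring.
Qed.
Lemma cf_act_linr lambda r s u : linear (cf_act lambda r s u).
Proof. by move=> a x y; rewrite /cf_act !ar; vector_ring. Qed.
Lemma cf_actP lambda p q r s u v : u \in cf_par p -> v \in mod_par V q ->
  cf_act lambda r s u v \in mod_par V (p (+) q).
Proof.
move=> /subspace_ofP[uP u0] vP; rewrite rpredD //.
  case: p uP u0 => [_ /(_ isT)[-> ->]|_ _]; last by rewrite rpredZ.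
  by rewrite mul0r addr0 scale0r rpred0.
apply: actP => //; apply/subspace_ofP; split=> // /u0[-> _].
by rewrite /= mul0r.
Qed.
Lemma cf_act_br lambda p q r s t u v w : u \in cf_par p -> v \in cf_par q ->
  cf_act lambda (r + s) t (cf_br r s u v) w =
  cf_act lambda r (s + t) u (cf_act lambda s t v w)
  - (-1) ^+ (p && q) *: cf_act lambda s (r + t) v (cf_act lambda r t u w).
Proof.
move=> /subspace_ofP[uP u0] /subspace_ofP[vP v0].
have ue : ext_elt 0 (cG u) \in lie_par extension p by apply/subspace_ofP.
have ve : ext_elt 0 (cG v) \in lie_par extension q by apply/subspace_ofP.
have h := act_br w ue ve.
have e : lie_br (ext_elt 0 (cG u)) (ext_elt 0 (cG v))
         = ext_elt 0 (lie_br (cG u) (cG v)).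
  by congr pair; rewrite /= !scale0r addr0 subr0.
rewrite e in h.
rewrite /cf_act /cf_br /cW /cA /cG /= -/(cW u) -/(cW v) -/(cA u) -/(cA v).
rewrite -/(cG u) -/(cG v).
rewrite !(act_ext (_ * _)).
have actD x y : act (ext_elt 0 (x + y)) w =
    act (ext_elt 0 x) w + act (ext_elt 0 y) w.
  by rewrite -[x in LHS]scale1r act_extl scale1r.
have act0 : act (ext_elt 0 0) w = 0 by exact: lin0 (@act_linl _ _ V w).
have actZ a x : act (ext_elt 0 (a *: x)) w = a *: act (ext_elt 0 x) w.
  by rewrite -[a *: x]addr0 act_extl act0 addr0.
have actN x : act (ext_elt 0 (- x)) w = - act (ext_elt 0 x) w.
  by rewrite -scaleN1r actZ scaleN1r.
rewrite !(actD, actZ, actN) h !act_d !ar.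
case: p q {ue ve} uP u0 vP v0 h => [] [] _ u0 _ v0 _;
  try (have [-> ->] := u0 isT); try (have [-> ->] := v0 isT);
  rewrite ?expr0 ?expr1; vector_ring.
Qed.

End Action.
End Extension.

Section RootOfUnity.
Variable R : realType.

(* omega n = exp (2 pi i / n). *)
Definition omega (n : nat) : R[i] :=
  (cos (2 * pi / n%:R) +i* sin (2 * pi / n%:R))%C.

Lemma omega_neq0 n : omega n != 0.
Proof.
apply/eqP => -[c0 s0]; have := cos2Dsin2 (2 * pi / n%:R : R).
by rewrite c0 s0 expr0n addr0 => /eqP; rewrite eq_sym oner_eq0.
Qed.

Lemma de_moivre (a : R) m :
  (cos a +i* sin a)%C ^+ m = (cos (m%:R * a) +i* sin (m%:R * a))%C.
Proof.
elim: m => [|m IH]; first by rewrite expr0 mul0r cos0 sin0.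
rewrite exprS IH -natr1 mulrDl mul1r [_ * a + a]addrC cosD sinD.
by congr (_ +i* _)%C; rewrite addrC.
Qed.

Lemma omegaX n : (0 < n)%N -> omega n ^+ n = 1.
Proof.
move=> n0; rewrite de_moivre mulrC divfK ?pnatr_eq0 -?lt0n //.
by rewrite mulr_natl cos2pi sin2pi.
Qed.

Lemma omega_dvd n (k : int) : (0 < n)%N -> (n %| k)%Z -> omega n ^ k = 1.
Proof.
by move=> n0 /dvdzP[q ->]; rewrite mulrC -exprz_exp -exprnP omegaX // exp1rz.
Qed.
End RootOfUnity.

Record setting (R : realType) := Setting {
  dg : lieSuper R[i];
  dg_fin_dim : fin_dim dg;
  dder : even_derivation dg;
  dder_eig : forall x, dder x = 1 *: x -> x = 0;
  sg : lie_automorphism dg;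
  sg_dder : forall x, sg (dder x) = dder (sg x);
  ord : nat;
  ord_gt0 : (0 < ord)%N;
  ord_id : forall x, iter ord sg x = x;
  ord_min : forall m, (0 < m < ord)%N -> exists x, iter m sg x <> x }.

Section Algebra.
Variables (R : realType) (S : setting R).
Local Notation K := R[i].
Local Notation g := (dg S).
Local Notation d := (dder S).
Local Notation n := (ord S).
Local Notation w := (omega R n).

(* Indices modulo n are represented by integers. *)
Lemma eig_closed (i : int) : lin_closed (fun x : g => sg S x = w ^ i *: x).
Proof.
split=> [|a x y ex ey]; first by rewrite (lin0 (aut_linear _)) scaler0.
by rewrite aut_linear ex ey scalerDr !scalerA [w ^ i * a]mulrC.
Qed.
Definition eig i := subspace_of (eig_closed i).

Definition ddg : lieSuper K := extension d.

Lemma ddg_eig_closed (i : int) : lin_closed (fun u : ext_space g =>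
  u.2 \in eig i /\ (~~ (n %| i)%Z -> u.1 = 0)).
Proof.
split=> [|a u v [uP u0] [vP v0]]; first by split; rewrite ?rpred0.
split; first by rewrite ext_snd_lin rpredD ?rpredZ.
by move=> hi; rewrite ext_fst_lin u0 // v0 // mulr0 addr0.
Qed.
Definition ddg_eig i : submodClosed ddg := subspace_of (ddg_eig_closed i).

(* The exponent r / n of t attached to the index r. *)
Definition expo (r : int) : K := r%:~R / n%:R.

Lemma expoD r s : expo (r + s) = expo r + expo s.
Proof. by rewrite /expo intrD mulrDl. Qed.

Lemma cf_eig_closed (k : int) : lin_closed (fun u : cf_space g =>
  cG u \in eig k /\ (~~ (n %| k)%Z -> cW u = 0 /\ cA u = 0)).
Proof.
split=> [|a u v [uP u0] [vP v0]]; first by split; rewrite ?rpred0.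
split; first by rewrite cG_lin rpredD ?rpredZ.
move=> hk; rewrite cW_lin cA_lin.
by have [-> ->] := u0 hk; have [-> ->] := v0 hk; rewrite mulr0 addr0.
Qed.
Definition cf_eig k := subspace_of (cf_eig_closed k).

Lemma eig_shift i j x : (n %| i)%Z -> x \in eig j -> x \in eig (i + j).
Proof.
move=> hi /subspace_ofP xj; apply/subspace_ofP.
by rewrite expfzDr ?omega_neq0 // omega_dvd ?ord_gt0 // mul1r.
Qed.

Lemma eig_der i x : x \in eig i -> d x \in eig i.
Proof.
move=> /subspace_ofP xi; apply/subspace_ofP.
by rewrite sg_dder xi (linZ (der_linear d)).
Qed.

Lemma eig_br i j x y : x \in eig i -> y \in eig j -> lie_br x y \in eig (i + j).
Proof.
move=> /subspace_ofP xi /subspace_ofP yj; apply/subspace_ofP.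
rewrite aut_br xi yj (linZ (lie_linr _)) (linZ (lie_linl y)) scalerA.
by rewrite expfzDr ?omega_neq0 // mulrC.
Qed.

Lemma cf_br_eig r s u v : u \in cf_eig r -> v \in cf_eig s ->
  cf_br d (expo r) (expo s) u v \in cf_eig (r + s).
Proof.
move=> /subspace_ofP[ur u0] /subspace_ofP[vs v0]; apply/subspace_ofP; split.
  rewrite cG_br -scaleNr rpredD ?rpredD //; first exact: eig_br.
  - have [rn|/u0[-> _]] := boolP (n %| r)%Z; last by rewrite scale0r rpred0.
    by rewrite rpredZ // eig_shift // rpredD ?rpredZ ?eig_der.
  - have [sn|/v0[-> _]] := boolP (n %| s)%Z; last by rewrite oppr0 scale0r rpred0.
    by rewrite rpredZ // [r + s]addrC eig_shift // rpredD ?rpredZ ?eig_der.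
move=> rs; rewrite cW_br cA_br.
have [rn|/u0[-> ->]] := boolP (n %| r)%Z; last first.
  by split; ring.
have sn : ~~ (n %| s)%Z by rewrite -(rpredDl s rn).
by have [-> ->] := v0 sn; split; ring.
Qed.

Lemma Lt_closed : lin_closed (fun f : int -> cf_space g =>
  fin_supp f /\ forall k, f k \in cf_eig k).
Proof.
split=> [|a f h [ff fe] [fh he]].
  by split=> [|k]; [exact: (fin_supp_closed _).1 | rewrite rpred0].
by split=> [|k]; [exact: (fin_supp_closed _).2 | rewrite rpredD ?rpredZ].
Qed.

(* The carrier W + g + A: a family (a_k, x_k, b_k) stands for the finite sum over k
   of a_k l_(k/n) + x_k t^(k/n) + b_k t^(k/n); by cf_eig, x_k is in eig k, and a_k
   and b_k vanish unless n divides k. *)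
Definition Lt_space : lmodType K := subspace_type (subspace_of Lt_closed).

Implicit Types f h : Lt_space.

Lemma Lt_fin f : fin_supp (sub_val f).
Proof. by have /subspace_ofP[] := sub_valP f. Qed.
Lemma Lt_eig f k : sub_val f k \in cf_eig k.
Proof. by have /subspace_ofP[] := sub_valP f. Qed.

Lemma Lt_par_closed p :
  lin_closed (fun f : Lt_space => forall k, sub_val f k \in cf_par g p).
Proof.
split=> [k|a f h fP hP k]; first exact: rpred0.
by rewrite sub_val_linear rpredD ?rpredZ ?fP ?hP.
Qed.
Definition Lt_par p := subspace_of (Lt_par_closed p).

Local Notation B := (fun r s => cf_br d (expo r) (expo s)).

Lemma Lt_br_closed f h : conv B (sub_val f) (sub_val h) \in subspace_of Lt_closed.
Proof.
apply/subspace_ofP; split=> [|k].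
  apply: fin_supp_conv; [| |exact: Lt_fin|exact: Lt_fin].
    by move=> r s v; apply: cf_linl.
  by move=> r s u; apply: cf_linr.
apply: (@conv_mem _ _ _ _ _ (fun r u => u \in cf_eig r)
  (fun s v => v \in cf_eig s)); [exact: cf_br_eig | exact: Lt_eig | exact: Lt_eig].
Qed.

Definition Lt_br f h : Lt_space := SubspaceElt (Lt_br_closed f h).

Lemma cf_eig_split k u : u \in cf_eig k -> exists u0 u1,
  [/\ u0 \in cf_par g false, u1 \in cf_par g true, u0 \in cf_eig k,
      u1 \in cf_eig k & u = u0 + u1].
Proof.
case: u => [[a x] b] /subspace_ofP[/subspace_ofP xk u0].
have [x0 [x1 [P0 P1 e]]] := (lie_decomp g).1 x.
have [e0 e1] : sg S x0 = w ^ k *: x0 /\ sg S x1 = w ^ k *: x1.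
  apply: (super_decomp_uniq (lie_decomp g)); rewrite ?aut_even ?rpredZ //.
  by rewrite -(linD (aut_linear _)) -scalerDr -e.
exists ((a, x0, b) : cf_space g), ((0, x1, 0) : cf_space g); split.
- by apply/subspace_ofP.
- by apply/subspace_ofP.
- by apply/subspace_ofP; split=> //; apply/subspace_ofP.
- by apply/subspace_ofP; split=> //; apply/subspace_ofP.
- by rewrite e; congr (_, _, _); rewrite addr0.
Qed.

Lemma Lt_decomp : super_decomp Lt_par.
Proof.
split=> [f|f /subspace_ofP f0 /subspace_ofP f1].
  have [f0 [f1 [F0 F1 e fP]]] := laurent_split cf_eig_split
    (fun k => rpred0 _) (Lt_fin f) (Lt_eig f).
  have E0 : f0 \in subspace_of Lt_closed.
    by apply/subspace_ofP; split=> // k; have [] := fP k.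
  have E1 : f1 \in subspace_of Lt_closed.
    by apply/subspace_ofP; split=> // k; have [] := fP k.
  exists (SubspaceElt E0), (SubspaceElt E1); split; last exact: val_inj.
  - by apply/subspace_ofP => k; have [] := fP k.
  - by apply/subspace_ofP => k; have [] := fP k.
apply: val_inj; apply/funext => k /=.
have /subspace_ofP[x0 _] := f0 k; have /subspace_ofP[x1 h] := f1 k.
have [a0 b0] := h isT.
by rewrite [LHS]cf_eta a0 b0 ((lie_decomp g).2 _ x0 x1).
Qed.

Lemma Lt_linl h : linear (Lt_br^~ h).
Proof.
move=> a f f'; apply: val_inj => /=.
by apply: conv_linl; [move=> r s v; apply: cf_linl | exact: Lt_fin | exact: Lt_fin].
Qed.
Lemma Lt_linr f : linear (Lt_br f).
Proof.
move=> a h h'; apply: val_inj => /=.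
by apply: conv_linr; [move=> r s v; apply: cf_linl | move=> r s v; apply: cf_linr
  | exact: Lt_fin].
Qed.
Lemma Lt_brP p q f h : f \in Lt_par p -> h \in Lt_par q ->
  Lt_br f h \in Lt_par (p (+) q).
Proof.
move=> /subspace_ofP fp /subspace_ofP hq; apply/subspace_ofP => k.
apply: (@conv_mem _ _ _ _ _ (fun _ u => u \in cf_par g p)
  (fun _ v => v \in cf_par g q) (fun _ => cf_par g (p (+) q))) => //.
by move=> r s u v; apply: cf_brP.
Qed.
Lemma Lt_skew p q f h : f \in Lt_par p -> h \in Lt_par q ->
  Lt_br f h = - ((-1) ^+ (p && q) *: Lt_br h f).
Proof.
move=> /subspace_ofP fp /subspace_ofP hq; apply: val_inj => /=.
by apply: conv_skew; [move=> r s v; apply: cf_linl | exact: Lt_fin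
  | move=> r s; apply: cf_skew].
Qed.
Lemma Lt_jacobi p q f h x : f \in Lt_par p -> h \in Lt_par q ->
  Lt_br (Lt_br f h) x =
  Lt_br f (Lt_br h x) - (-1) ^+ (p && q) *: Lt_br h (Lt_br f x).
Proof.
move=> /subspace_ofP fp /subspace_ofP hq; apply: val_inj => /=.
apply: (conv_jacobi (S := fun u => u \in cf_par g p)
  (T := fun u => u \in cf_par g q)); rewrite ?Lt_fin //.
- by move=> r s v; apply: cf_linl.
- by move=> r s u; apply: cf_linr.
- by move=> r s v; apply: cf_linl.
- by move=> r s u; apply: cf_linr.
- by move=> r s t u v y up vq; rewrite !expoD; apply: cf_jacobi.
- exact: Lt_fin.
- exact: Lt_fin.
- exact: Lt_fin.
Qed.

(* The semidirect product of W, g and A; its brackets on the spanning elements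
   l_i, x t^(k/n) and t^i are computed in ell_ell, ell_xt, xt_xt, ell_tpow, xt_tpow
   and tpow_tpow. *)
Definition Ltilde : lieSuper K :=
  LieSuper Lt_decomp Lt_linl Lt_linr Lt_brP Lt_skew Lt_jacobi.

Lemma mono_Lt k u : u \in cf_eig k -> mono k u \in subspace_of Lt_closed.
Proof.
move=> uk; apply/subspace_ofP; split=> [|j]; first exact: fin_supp_mono.
by rewrite /mono; case: eqP => [->|_] //; rewrite rpred0.
Qed.

Lemma cf_eig_l i : ((1, 0, 0) : cf_space g) \in cf_eig (n%:Z * i).
Proof. by apply/subspace_ofP; split; rewrite ?rpred0 // dvdz_mulr. Qed.
Lemma cf_eig_x k x : x \in eig k -> ((0, x, 0) : cf_space g) \in cf_eig k.
Proof. by move=> xk; apply/subspace_ofP. Qed.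
Lemma cf_eig_t i : ((0, 0, 1) : cf_space g) \in cf_eig (n%:Z * i).
Proof. by apply/subspace_ofP; split; rewrite ?rpred0 // dvdz_mulr. Qed.

Definition ell (i : int) : Ltilde := SubspaceElt (mono_Lt (cf_eig_l i)).
Definition xt (k : int) x (xk : x \in eig k) : Ltilde :=
  SubspaceElt (mono_Lt (cf_eig_x xk)).
Definition tpow (i : int) : Ltilde := SubspaceElt (mono_Lt (cf_eig_t i)).

Lemma expoM i : expo (n%:Z * i) = i%:~R.
Proof. by rewrite /expo intrM mulrC mulKf // pnatr_eq0 -lt0n ord_gt0. Qed.

Lemma Lt_br_mono j k u v (uj : u \in cf_eig j) (vk : v \in cf_eig k) :
  sub_val (lie_br (SubspaceElt (mono_Lt uj) : Ltilde) (SubspaceElt (mono_Lt vk)))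
  = mono (j + k) (cf_br d (expo j) (expo k) u v).
Proof.
by apply: conv_mono => [r s ?|r s ?]; [apply: cf_linl | apply: cf_linr].
Qed.

Lemma ell_ell i j : lie_br (ell i) (ell j) = (j - i)%:~R *: ell (i + j).
Proof.
apply: val_inj; rewrite [LHS]Lt_br_mono -mulrDr.
apply/funext => k; rewrite -[RHS]/(_ *: mono _ _ k) /mono.
case: eqP => [_|_]; last by rewrite scaler0.
rewrite /cf_br /cW /cG /cA /= !expoM (lin0 (der_linear _)) (lin0 (lie_linr _)).
congr (_, _, _).
- by rewrite -[RHS]/(_ * _) !mulr1 intrB.
- by rewrite !(scaler0, addr0, subr0).
- by rewrite !mulr0 subr0 scaler0.
Qed.

Lemma ell_xt i k x (xk : x \in eig k)
    (yk : expo k *: x + i%:~R *: d x \in eig (n%:Z * i + k)) :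
  lie_br (ell i) (xt xk) = xt yk.
Proof.
apply: val_inj; rewrite [LHS]Lt_br_mono.
apply/funext => j; rewrite -[RHS]/(mono _ _ j) /mono.
case: eqP => // _.
rewrite /cf_br /cW /cG /cA /= !expoM (lin0 (lie_linl _)).
congr (_, _, _).
- by rewrite !mulr0.
- by rewrite scale1r scale0r subr0 add0r.
- by rewrite !(mulr0, mul0r) subr0.
Qed.

Lemma xt_xt j k x y (xj : x \in eig j) (yk : y \in eig k) :
  lie_br (xt xj) (xt yk) = xt (eig_br xj yk).
Proof.
apply: val_inj; rewrite [LHS]Lt_br_mono.
apply/funext => i; rewrite -[RHS]/(mono _ _ i) /mono.
case: eqP => // _; rewrite /cf_br /cW /cG /cA /=; congr (_, _, _).
- by rewrite !mulr0.
- by rewrite !scale0r subr0 addr0.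
- by rewrite !(mulr0, mul0r) subr0.
Qed.

Lemma ell_tpow i j : lie_br (ell i) (tpow j) = j%:~R *: tpow (i + j).
Proof.
apply: val_inj; rewrite [LHS]Lt_br_mono -mulrDr.
apply/funext => k; rewrite -[RHS]/(_ *: mono _ _ k) /mono.
case: eqP => [_|_]; last by rewrite scaler0.
rewrite /cf_br /cW /cG /cA /= !expoM (lin0 (der_linear _)) (lin0 (lie_linr _)).
congr (_, _, _).
- by rewrite -[RHS]/(_ * _) !mulr0.
- by rewrite !(scaler0, addr0, subr0).
- by rewrite -[RHS]/(_ * _) !(mul0r, mulr0, mulr1) subr0.
Qed.

Lemma xt_tpow k i x (xk : x \in eig k) : lie_br (xt xk) (tpow i) = 0.
Proof.
apply: val_inj; rewrite [LHS]Lt_br_mono.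
apply/funext => j; rewrite -[RHS]/(0 : cf_space g) /mono; case: eqP => // _.
rewrite /cf_br /cW /cG /cA /= (lin0 (lie_linr _)); congr (_, _, _).
- by rewrite !mulr0.
- by rewrite !scale0r subr0 addr0.
- by rewrite !(mulr0, mul0r) subr0.
Qed.

Lemma tpow_tpow i j : lie_br (tpow i) (tpow j) = 0.
Proof.
apply: val_inj; rewrite [LHS]Lt_br_mono.
apply/funext => k; rewrite -[RHS]/(0 : cf_space g) /mono; case: eqP => // _.
rewrite /cf_br /cW /cG /cA /= (lin0 (lie_linr _)); congr (_, _, _).
- by rewrite !mulr0.
- by rewrite !scale0r subr0 addr0.
- by rewrite !(mulr0, mul0r) subr0.
Qed.

Section Modules.
Variable M : supermod Ltilde.

Definition is_AL_module :=
  (forall i j (v : M), act (tpow i) (act (tpow j) v) = act (tpow (i + j)) v) /\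
  (forall v : M, act (tpow 0) v = v).

Lemma weight_closed (lambda : K) :
  lin_closed (fun v : M => act (ell 0) v = lambda *: v).
Proof.
split=> [|a u v eu ev]; first by rewrite (lin0 (act_linr _)) scaler0.
by rewrite act_linr eu ev scalerDr !scalerA mulrC.
Qed.
Definition weight_space lambda := subspace_of (weight_closed lambda).

Definition is_weight_module := forall v : M,
  exists m (lambda : 'I_m -> K) (u : 'I_m -> M),
    (forall i, u i \in weight_space (lambda i)) /\ v = \sum_i u i.

Definition cuspidal := is_weight_module /\
  exists N : nat, forall lambda, dim_le (subspace_type (weight_space lambda)) N.
End Modules.

Section LoopModule.
Variables (V : supermod ddg) (lambda : K).
Local Notation A := (fun r s => cf_act (V := V) lambda (expo r) (expo s)).

Definition Gamma_space : lmodType K := subspace_type (subspace_of (fin_supp_closed V)).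
Implicit Types w : Gamma_space.

Lemma Gamma_fin w : fin_supp (sub_val w).
Proof. exact: (elimT (subspace_ofP _ _) (sub_valP w)). Qed.

Lemma Gamma_par_closed p :
  lin_closed (fun w : Gamma_space => forall k, sub_val w k \in mod_par V p).
Proof.
split=> [k|a w w' wP wP' k]; first exact: rpred0.
by rewrite sub_val_linear rpredD ?rpredZ ?wP ?wP'.
Qed.
Definition Gamma_par p := subspace_of (Gamma_par_closed p).

Lemma Gamma_act_closed f w :
  conv A (sub_val f) (sub_val w) \in subspace_of (fin_supp_closed V).
Proof.
apply/subspace_ofP; apply: fin_supp_conv; [| |exact: Lt_fin|exact: Gamma_fin].
  by move=> r s v; apply: cf_act_linl.
by move=> r s v; apply: cf_act_linr.
Qed.
Definition Gamma_act (f : Ltilde) w : Gamma_space :=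
  SubspaceElt (Gamma_act_closed f w).

Lemma Gamma_decomp : super_decomp Gamma_par.
Proof.
split=> [w|w /subspace_ofP w0 /subspace_ofP w1]; last first.
  by apply: val_inj; apply/funext => k; exact: ((mod_decomp V).2 _ (w0 k) (w1 k)).
have split_V (k : int) (v : V) : True -> exists v0 v1,
    [/\ v0 \in mod_par V false, v1 \in mod_par V true, True, True & v = v0 + v1].
  by have [v0 [v1 [? ? ->]]] := (mod_decomp V).1 v; exists v0, v1.
have [w0 [w1 [F0 F1 e wP]]] := laurent_split split_V (fun=> I) (Gamma_fin w)
  (fun=> I).
exists (SubspaceElt (introT (subspace_ofP _ _) F0)).
exists (SubspaceElt (introT (subspace_ofP _ _) F1)); split; last exact: val_inj.
- by apply/subspace_ofP => k; have [] := wP k.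
- by apply/subspace_ofP => k; have [] := wP k.
Qed.
Lemma Gamma_linl w : linear (Gamma_act^~ w).
Proof.
move=> a f f'; apply: val_inj => /=.
by apply: conv_linl; [move=> r s v; apply: cf_act_linl | exact: Lt_fin
  | exact: Lt_fin].
Qed.
Lemma Gamma_linr f : linear (Gamma_act f).
Proof.
move=> a w w'; apply: val_inj => /=.
by apply: conv_linr; [move=> r s v; apply: cf_act_linl
  | move=> r s v; apply: cf_act_linr | exact: Lt_fin].
Qed.
Lemma Gamma_actP p q f w : f \in lie_par Ltilde p -> w \in Gamma_par q ->
  Gamma_act f w \in Gamma_par (p (+) q).
Proof.
move=> /subspace_ofP fp /subspace_ofP wq; apply/subspace_ofP => k.
apply: (@conv_mem _ _ _ _ _ (fun _ u => u \in cf_par g p)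
  (fun _ v => v \in mod_par V q) (fun _ => mod_par V (p (+) q))) => //.
by move=> r s u v; apply: cf_actP.
Qed.
Lemma Gamma_act_br p q (f h : Ltilde) w :
  f \in lie_par Ltilde p -> h \in lie_par Ltilde q ->
  Gamma_act (lie_br f h) w =
  Gamma_act f (Gamma_act h w) - (-1) ^+ (p && q) *: Gamma_act h (Gamma_act f w).
Proof.
move=> /subspace_ofP fp /subspace_ofP hq; apply: val_inj => /=.
apply: (conv_jacobi (S := fun u => u \in cf_par g p)
  (T := fun u => u \in cf_par g q)) => //.
- by move=> r s v; apply: cf_linl.
- by move=> r s u; apply: cf_linr.
- by move=> r s v; apply: cf_act_linl.
- by move=> r s u; apply: cf_act_linr.
- by move=> r s t u v y up vq; rewrite !expoD; apply: cf_act_br.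
- exact: Lt_fin.
- exact: Lt_fin.
- exact: Gamma_fin.
Qed.

(* The element w of Gamma V lambda stands for the sum of the w_k \otimes t^(k/n). *)
Definition Gamma : supermod Ltilde :=
  Supermod Gamma_decomp Gamma_linl Gamma_linr Gamma_actP Gamma_act_br.

Definition tensor_t (k : int) (v : V) : Gamma :=
  SubspaceElt (introT (subspace_ofP (fin_supp_closed V) _) (fin_supp_mono k v)).

Lemma Gamma_act_mono j k u v (uj : u \in cf_eig j) :
  act (SubspaceElt (mono_Lt uj) : Ltilde) (tensor_t k v) =
  tensor_t (j + k) (cf_act lambda (expo j) (expo k) u v).
Proof.
apply: val_inj.
by apply: conv_mono => [r s ?|r s ?]; [apply: cf_act_linl | apply: cf_act_linr].
Qed.

Lemma Gamma_ell i k v : act (ell i) (tensor_t k v) =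
  tensor_t (n%:Z * i + k)
    ((lambda + expo k) *: v + i%:~R *: act (ext_elt d 1 0) v).
Proof.
rewrite [LHS]Gamma_act_mono; congr tensor_t.
have act00 : act (ext_elt d 0 0) v = 0 by exact: (lin0 (@act_linl _ _ V v)).
rewrite /cf_act /cW /cA /cG /= !mul1r addr0 act_ext expoM.
by rewrite act00 addr0.
Qed.

Lemma Gamma_xt j x (xj : x \in eig j) k v :
  act (xt xj) (tensor_t k v) = tensor_t (j + k) (act (ext_elt d 0 x) v).
Proof.
rewrite [LHS]Gamma_act_mono; congr tensor_t.
by rewrite /cf_act /cW /cA /cG /= !mul0r addr0 scale0r add0r.
Qed.

Lemma Gamma_tpow i k v :
  act (tpow i) (tensor_t k v) = tensor_t (n%:Z * i + k) v.
Proof.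
rewrite [LHS]Gamma_act_mono; congr tensor_t.
have act00 : act (ext_elt d 0 0) v = 0 by exact: (lin0 (@act_linl _ _ V v)).
by rewrite /cf_act /cW /cA /cG /= !mul0r add0r scale1r act00 addr0.
Qed.
End LoopModule.

Record zn_grading (V : supermod ddg) := ZnGrading {
  gr : int -> submodClosed V;
  gr_mod : forall i j v, (i = j %[mod n])%Z -> v \in gr i -> v \in gr j;
  gr_super : forall i, is_super_subspace (@mod_par _ _ V) (gr i);
  gr_span : forall v, exists2 u : 'I_n -> V,
    (forall i : 'I_n, u i \in gr i) & v = \sum_i u i;
  gr_free : forall u : 'I_n -> V, (forall i : 'I_n, u i \in gr i) ->
    \sum_i u i = 0 -> forall i, u i = 0;
  gr_act : forall i j x v, x \in ddg_eig i -> v \in gr j ->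
    act x v \in gr (i + j) }.

Definition is_graded_subspace V (G : zn_grading V) (N : submodClosed V) :=
  forall v, v \in N -> exists2 u : 'I_n -> V,
    (forall i : 'I_n, u i \in N /\ u i \in gr G i) & v = \sum_i u i.

Definition zn_graded_simple V (G : zn_grading V) := (exists v : V, v != 0) /\
  forall N : submodule V, is_graded_subspace G N ->
    (forall v, v \in N -> v = 0) \/ (forall v, v \in N).

Section GradedLoop.
Variables (V : supermod ddg) (G : zn_grading V) (lambda : K).
Local Notation Gm := (Gamma V lambda).

Lemma F_closed :
  lin_closed (fun w : Gm => forall k, sub_val (w : Gamma_space V) k \in gr G k).
Proof.
split=> [k|a w w' wP wP' k]; first exact: rpred0.
by rewrite sub_val_linear rpredD ?rpredZ ?wP ?wP'.
Qed.
Definition F_space := subspace_of F_closed.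

Lemma F_super : is_super_subspace (@mod_par _ _ Gm) F_space.
Proof.
move=> w /subspace_ofP wF.
have split_V k v : v \in gr G k -> exists v0 v1,
    [/\ v0 \in mod_par V false, v1 \in mod_par V true, v0 \in gr G k,
        v1 \in gr G k & v = v0 + v1].
  by move=> /gr_super[v0 [v1 [? ? ? ? ->]]]; exists v0, v1.
have [w0 [w1 [F0 F1 e wP]]] := laurent_split split_V (fun k => rpred0 _)
  (Gamma_fin w) wF.
exists (SubspaceElt (introT (subspace_ofP _ _) F0)).
exists (SubspaceElt (introT (subspace_ofP _ _) F1)).
by split; [| | | |exact: val_inj]; apply/subspace_ofP => k; have [] := wP k.
Qed.

Lemma F_act (f : Ltilde) w : w \in F_space -> act f w \in F_space.
Proof.
move=> /subspace_ofP wF; apply/subspace_ofP => k.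
apply: (@conv_mem _ _ _ _ _ (fun r u => u \in cf_eig r)
  (fun s v => v \in gr G s) (gr G)) => //; last exact: Lt_eig.
move=> r s u v /subspace_ofP[ur u0] vs; rewrite rpredD //.
  have [rn|/u0[-> ->]] := boolP (n %| r)%Z; last first.
    by rewrite mul0r addr0 scale0r rpred0.
  rewrite rpredZ //; apply: gr_mod vs.
  by apply/eqP; rewrite eqz_mod_dvd opprD addrCA subrr addr0 rpredN.
apply: gr_act vs; apply/subspace_ofP; split=> // /u0[-> _].
by rewrite /= mul0r.
Qed.

Definition F_submodule : submodule Gm := Submodule F_super F_act.
Definition F : supermod Ltilde := sub_mod F_submodule.
End GradedLoop.
End Algebra.

(* Main.v *)
Require Import Defs.
From HB Require Import structures.
From mathcomp Require Import all_boot all_order all_algebra.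
From mathcomp Require Import ring zify.
From mathcomp Require Import complex.
From mathcomp Require Import all_classical all_reals.
From mathcomp Require Import trigo.

Set Implicit Arguments.
Unset Strict Implicit.
Unset Printing Implicit Defensive.

Import Order.TTheory GRing.Theory Num.Theory.
Local Open Scope ring_scope.

(** Let V = M / (t - 1) M be the fibre of M at t = 1.  It is finite dimensional,
    and the Lie subalgebra of Ltilde preserving (t - 1) M, which contains g and the
    vector fields vanishing at 1, acts on it.  Put s = t - 1.  On the vector fields
    s^k d/dt the operator ad (s d/dt) has the distinct eigenvalues k - 1, so all but
    finitely many of them act by 0 on V.  The identity
      [s^k d/dt, x s t^a] - [s^(k+1) d/dt, x t^a] = (x - d x) s^k t^a
    and the invertibility of 1 - d then make x s^k t^a act by 0 for large k.
    By descending induction on r >= 1, the operators x s^r t^a, and after them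
    s^(r+1) t^a d/dt, vanish: each is a combination of commutators forcing the
    traces of all its powers to be 0, hence is nilpotent, and the common kernel is
    a nonzero graded submodule of V, which is all of V by the simplicity of M.
    So x t^a acts on V independently of the representative of a modulo 1, and
    l_i - l_0 acts as i times l_1 - l_0; this makes V a graded-simple module over
    the extension of g by d, and M its graded loop module.  Composing M -> V with
    a simple quotient V -> V' embeds M into the loop module of V'. *)

(** * Linear algebra in finite dimension *)

(** A subspace of V gives back a submodule of M only through weight components, so it has to be
    stable under the operator [twist], which records weights modulo 1. This is why V comes out
    graded-simple, and why each common kernel is tested against parity and [twist] besides the Lie
    action. The field l_i does not preserve (t - 1) M, but l_i - l_0 does, and this suffices because
    l_0 is a scalar on a weight vector. Powers of s are lowered for g before they are lowered for W:
    the bracket of s^(r+2) d/dt with x t^a contains d(x) s^(r+1), which must already act by 0. The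
    descent stops where the commutators degenerate: for x t^a there is no x s^(-1) t^a to start
    from, and s d/dt commutes with itself, its eigenvalue k - 1 being 0 at k = 1. What survives is
    thus g, up to integral powers of t, and the operator of the derivation. Odd operators commute
    only up to sign, so the common kernel argument has to allow commutation up to a scalar. *)

Lemma mxtrace_idem (K : fieldType) m (P : 'M[K]_m) :
  P *m P = P -> \tr P = (\rank P)%:R.
Proof.
move=> PP; rewrite -[P in LHS]mulmx_base mxtrace_mulC.
suff -> : row_base P *m col_base P = 1%:M by rewrite mxtrace1.
apply: (row_free_inj (row_base_free P)); apply: (row_full_inj (col_base_full P)).
rewrite /= mul1mx mulmx_base -[RHS]PP -[P in RHS]mulmx_base.
by rewrite !mulmxA.
Qed.

(* By Bezout, the projection onto the part where C is invertible is a polynomial in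
   C without constant term; its trace, which is its rank, is therefore 0. *)
Lemma mxtrace_nilpotent (K : numFieldType) m (C : 'M[K]_m.+1) :
  (forall e, \tr (C ^+ e.+1) = 0) -> exists e, C ^+ e = 0.
Proof.
move=> trC; pose p := char_poly C.
have p0 : p != 0 by rewrite monic_neq0 // char_poly_monic.
have [e [q /implyP/(_ p0) q0 pE]] := multiplicity_XsubC p 0.
rewrite subr0 in pE.
have /Bezout_eq1_coprimepP[[u v] /= uvE] : coprimep q 'X^(e.+1).
  by rewrite coprimep_expr // -['X]subr0 -polyC0 coprimep_XsubC.
have fp : horner_mx C p = 0 by exact: Cayley_Hamilton.
pose P := horner_mx C (v * 'X^(e.+1)).
have fX k : horner_mx C 'X^k = C ^+ k by rewrite rmorphXn /= horner_mx_X.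
have trP : \tr P = 0.
  rewrite /P -[v]coefK poly_def mulr_suml raddf_sum raddf_sum big1 //= => i _.
  by rewrite -scalerAl -exprD addnS linearZ /= fX linearZ /= trC mulr0.
have PP : P *m P = P.
  rewrite -[RHS]mulr1 -[1](rmorph1 (horner_mx C)) -uvE rmorphD mulrDr -/P -[LHS]add0r.
  congr (_ + _); rewrite -rmorphM /=.
  have -> : v * 'X^(e.+1) * (u * q) = v * 'X * u * p.
    by rewrite pE exprS; ring.
  by rewrite rmorphM /= fp mulr0.
have := mxtrace_idem PP; rewrite trP => /eqP.
rewrite eq_sym pnatr_eq0 mxrank_eq0 => /eqP P0.
have uq1 : horner_mx C (u * q) = 1.
  by rewrite -[RHS](rmorph1 (horner_mx C)) -uvE rmorphD [X in _ + X]P0 addr0.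
exists e; rewrite -[LHS]mulr1 -uq1 -fX.
have XuqE : 'X^e * (u * q) = u * p by rewrite pE; ring.
by rewrite -rmorphM XuqE rmorphM /= fp mulr0.
Qed.

Section FiniteDimension.
Variable K : fieldType.

Lemma lin_sum (U V : lmodType K) (f : U -> V) : linear f ->
  forall (I : Type) (r : seq I) (P : pred I) (F : I -> U),
  f (\sum_(i <- r | P i) F i) = \sum_(i <- r | P i) f (F i).
Proof.
move=> fl I r P F; apply: (big_morph f (linD fl) (lin0 fl)).
Qed.

Lemma linear_mx m p (f : 'rV[K]_m -> 'rV[K]_p) : linear f ->
  exists A, forall u, f u = u *m A.
Proof.
move=> fl; exists (\matrix_i f (delta_mx 0 i)) => u.
rewrite [u in LHS]row_sum_delta (lin_sum fl) mulmx_sum_row.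
by apply: eq_bigr => i _; rewrite (linZ fl) rowK.
Qed.

(** Among the matrices with all rows in [P] take one of maximal rank: adjoining a further vector of
    [P] cannot raise the rank, so that vector is already in the row space. *)
Lemma subspace_mx m (P : 'rV[K]_m -> Prop) : lin_closed P ->
  exists A : 'M[K]_m, forall u, P u <-> (u <= A)%MS.
Proof.
move=> [P0 PD].
have PZ a u : P u -> P (a *: u) by move=> Pu; rewrite -[_ *: _]addr0; exact: PD.
have Psum (I : finType) (F : I -> 'rV[K]_m) : (forall i, P (F i)) -> P (\sum_i F i).
  move=> PF; elim/big_ind: _ => // u v Pu Pv.
  by rewrite -[u]scale1r; exact: PD.
pose Q r := `[< exists A : 'M[K]_m, (forall i, P (row i A)) /\ \rank A = r >].
have exQ : exists r, Q r.
  by exists 0%N; apply/asboolP; exists 0; rewrite mxrank0; split=> // i; rewrite row0.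
have Qm r : Q r -> (r <= m)%N by move=> /asboolP[A [_ <-]]; exact: rank_leq_row.
case: (ex_maxnP exQ Qm) => r /asboolP[A [PA rA]] rmax.
have AP u : (u <= A)%MS -> P u.
  by move=> /submxP[D ->]; rewrite mulmx_sum_row; apply: Psum => i; exact: PZ.
exists A => u; split=> [Pu|/AP //].
have : Q (\rank (A + u)%MS).
  apply/asboolP; exists (A + u)%MS; split=> // i.
  have /sub_addsmxP[[a b] /= ->] : (row i (A + u)%MS <= A + u)%MS by exact: row_sub.
  rewrite -[a *m A]scale1r; apply: PD; first by apply/AP; exact: submxMl.
  by rewrite [b]mx11_scalar mul_scalar_mx; exact: PZ.
move=> /rmax; rewrite -rA => rk.
apply: submx_trans (addsmxSr A u) _.
by rewrite -(geq_leqif (mxrank_leqif_sup (addsmxSl A u))).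
Qed.

Lemma fin_dim_coord (V : lmodType K) : fin_dim V ->
  exists m (f : V -> 'rV[K]_m) (g : 'rV[K]_m -> V),
    [/\ linear f, linear g, cancel f g & cancel g f].
Proof.
move=> [m [[f fl [g fK gK]]]]; exists m, f, g; split=> // a u v.
by apply: (can_inj fK); rewrite fl !gK.
Qed.

(** On a complement of its kernel [f] stays surjective and becomes injective, so a basis of the
    complement gives coordinates on [V]. *)
Lemma fin_dim_surj (V : lmodType K) m (f : 'rV[K]_m -> V) :
  linear f -> (forall v, exists u, v = f u) -> fin_dim V.
Proof.
move=> fl fs.
have kl : lin_closed (fun u => f u = 0).
  split=> [|a u v fu fv]; first exact: lin0 fl.
  by rewrite fl fu fv scaler0 addr0.
have [A AP] := subspace_mx kl.
pose B := row_base (A^C)%MS; pose g u := f (u *m B).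
have gl : linear g by move=> a u v; rewrite /g mulmxDl -scalemxAl fl.
have /choice[h hg] v : exists u, v = g u.
  have [u ->] := fs v.
  have /sub_addsmxP[[a b] /= ->] : (u <= A + A^C)%MS.
    exact: submx_full (addsmx_compl_full A).
  rewrite (linD fl) (proj2 (AP _) (submxMl a A)) add0r.
  have /submxP[c ->] : (b *m A^C <= B)%MS by rewrite eq_row_base submxMl.
  by exists c.
have gi : injective g.
  move=> u v guv; apply: (row_free_inj (row_base_free (A^C)%MS)); apply/eqP.
  rewrite -subr_eq0 /= -mulmxBl -submx0 -(capmx_compl A) sub_capmx.
  apply/andP; split; last first.
    by apply: submx_trans (submxMl _ _) _; rewrite eq_row_base.
  apply/AP.
  by rewrite -/(g _) -scaleN1r addrC gl guv scaleN1r addNr.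
have hK : cancel g h by move=> u; apply: gi; rewrite -hg.
exists (\rank (A^C)%MS); constructor; exists h; last first.
  by exists g => // v; rewrite -hg.
by move=> a u v; apply: gi; rewrite gl -!hg.
Qed.

Lemma linear_inj_surj (V : lmodType K) (f : V -> V) : fin_dim V -> linear f ->
  (forall v, f v = 0 -> v = 0) -> forall v, exists u, v = f u.
Proof.
move=> /fin_dim_coord[m [c [e [cl el cK eK]]]] fl f0 v.
have [|A AE] := @linear_mx _ _ (fun u => c (f (e u))).
  by move=> a x y; rewrite el fl cl.
have : row_free A.
  rewrite -kermx_eq0; apply/rowV0P => u /sub_kermxP; rewrite -AE => cfu.
  rewrite -[u]eK (f0 (e u)) ?(lin0 cl) //.
  by rewrite -[f _]cK cfu (lin0 el).
rewrite row_free_unit -row_full_unit => /row_fullP[B BA].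
exists (e (c v *m B)); apply: (can_inj cK).
by rewrite AE -mulmxA BA mulmx1.
Qed.

(** In coordinates each member of [F] is a row space, and a member of maximal rank is maximal for
    inclusion. It provides maximal proper submodules. *)
Lemma max_subspace (V : lmodType K) (F : (V -> Prop) -> Prop) : fin_dim V ->
  (forall P, F P -> lin_closed P) -> (exists P, F P) ->
  exists2 P, F P & forall Q, F Q -> (forall v, P v -> Q v) ->
    forall v, Q v -> P v.
Proof.
move=> /fin_dim_coord[m [c [e [cl el cK eK]]]] Fl [P0 FP0].
have mxF P : F P -> exists A : 'M[K]_m, forall v, P v <-> (c v <= A)%MS.
  move=> /Fl[h0 hD]; have [|A AP] := @subspace_mx m (fun u => P (e u)).
    by split=> [|a u v Pu Pv]; rewrite ?(lin0 el) ?el //; exact: hD.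
  by exists A => v; rewrite -AP cK.
pose Q r := `[< exists P, F P /\ exists A : 'M[K]_m,
  (forall v, P v <-> (c v <= A)%MS) /\ \rank A = r >].
have exQ : exists r, Q r.
  have [A hA] := mxF _ FP0; exists (\rank A); apply/asboolP.
  by exists P0; split=> //; exists A.
have Qm r : Q r -> (r <= m)%N.
  by move=> /asboolP[P [_ [A [_ <-]]]]; exact: rank_leq_row.
case: (ex_maxnP exQ Qm) => r /asboolP[P [FP [A [PA rA]]]] rmax.
exists P => // P' FP' PP' v P'v; have [B PB] := mxF _ FP'.
have AB : (A <= B)%MS.
  apply/rV_subP => u uA; rewrite -[u]eK; apply/PB/PP'/PA; by rewrite eK.
apply/PA; apply: submx_trans (proj1 (PB v) P'v) _.
rewrite -(geq_leqif (mxrank_leqif_sup AB)) rA; apply: rmax; apply/asboolP.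
by exists P'; split=> //; exists B.
Qed.

(** Take a nonzero [F]-stable subspace of least rank. The kernel of any [X] in it is nonzero by
    nilpotency and [F]-stable by commutation up to a scalar, so it is the whole subspace. The scalar
    covers the signs between odd operators, and [F] may be infinite. *)
Lemma common_kernel (V : lmodType K) (F : (V -> V) -> Prop) : fin_dim V ->
  (exists v : V, v != 0) -> (forall X, F X -> linear X) ->
  (forall X, F X -> exists e, forall v, iter e X v = 0) ->
  (forall X Y, F X -> F Y -> exists a : K, forall v, X (Y v) = a *: Y (X v)) ->
  exists2 v, v != 0 & forall X, F X -> X v = 0.
Proof.
move=> /fin_dim_coord[m [c [e [cl el cK eK]]]] [v1 v10] Fl Fn Fc.
pose Q r := `[< exists A : 'M[K]_m, [/\ A != 0, \rank A = r &
  forall X v, F X -> (c v <= A)%MS -> (c (X v) <= A)%MS] >].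
have exQ : exists r, Q r.
  exists m; apply/asboolP; exists 1%:M; split=> [||X v _ _].
  - apply: contraNneq v10 => z1; rewrite -[v1]cK -[c v1]mulmx1 z1 mulmx0.
    by rewrite (lin0 el).
  - exact: mxrank1.
  - exact: submx1.
case: (ex_minnP exQ) => r /asboolP[A [A0 rA As]] rmin.
have [u uA u0] : exists2 u, (c u <= A)%MS & u != 0.
  have /rowV0Pn[w wA w0] := A0; exists (e w); rewrite ?eK //.
  by apply: contraNneq w0 => ew0; rewrite -[w]eK ew0 (lin0 cl).
exists u => // X FX.
have Pl : lin_closed (fun w => (w <= A)%MS /\ X (e w) = 0).
  split=> [|a w w' [wA Xw] [w'A Xw']].
    by rewrite sub0mx (lin0 el) (lin0 (Fl _ FX)).
  split; first by rewrite addmx_sub ?scalemx_sub.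
  by rewrite el Fl // Xw Xw' scaler0 addr0.
have [B BP] := subspace_mx Pl.
suff AB : (A <= B)%MS by have [_] := proj2 (BP _) (submx_trans uA AB); rewrite cK.
have BA : (B <= A)%MS by apply/rV_subP => w /BP[].
rewrite -(geq_leqif (mxrank_leqif_sup BA)) rA; apply: rmin; apply/asboolP.
exists B; split=> //.
(* The last nonzero iterate of [u] under [X] stays in the subspace and lies in the kernel of [X]. *)
- have [k Xk] := Fn _ FX.
  have exk : exists k, iter k X u == 0 by exists k; rewrite Xk.
  case: (ex_minnP exk) => -[|j] /eqP /= Xj jmin; first by rewrite Xj eqxx in u0.
  have jA i : (c (iter i X u) <= A)%MS by elim: i => //= i; exact: As.
  apply/eqP => B0; suff /jmin : iter j X u == 0 by rewrite ltnn.
  have /BP : (c (iter j X u) <= A)%MS /\ X (e (c (iter j X u))) = 0.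
    by rewrite cK.
  by rewrite B0 submx0 => /eqP cj; rewrite -[iter _ _ _]cK cj (lin0 el).
- move=> Y v FY /BP[vA]; rewrite cK => Xv; apply/BP; split; first exact: As.
  by rewrite cK; have [a ->] := Fc _ _ FX FY; rewrite Xv (lin0 (Fl _ FY)) scaler0.
Qed.

End FiniteDimension.

(** * Eigenvalue and trace arguments in characteristic 0 *)

Section CharacteristicZero.
Variables (K : numFieldType) (V : lmodType K).
Hypothesis Vfin : fin_dim V.

(** Otherwise [p] would have arbitrarily large natural roots, hence [size p] distinct ones, one more
    than its degree. *)
Lemma natr_not_root (p : {poly K}) : p != 0 ->
  exists k0, forall k, (k0 <= k)%N -> ~~ root p k%:R.
Proof.
move=> p0; apply: contrapT => h.
have next k0 : exists2 k, (k0 <= k)%N & root p k%:R.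
  apply: contrapT => hk; apply: h; exists k0 => k kk.
  by apply/negP => rk; apply: hk; exists k.
have [rs [rsu rsr rss]] : exists rs : seq nat,
    [/\ uniq rs, all (fun k => root p k%:R) rs & size rs = size p].
  elim: (size p) => [|j [rs [u a s]]]; first by exists [::].
  have [k kk rk] := next (\max_(i <- rs) i).+1.
  exists (k :: rs); split; rewrite /= ?rk ?s ?u ?andbT //.
  apply/negP => krs; have := @leq_bigmax_seq _ rs xpredT id k krs isT.
  by move=> /(leq_trans kk); rewrite ltnn.
have := @max_poly_roots _ p [seq k%:R | k <- rs] p0.
rewrite all_map size_map rss ltnn map_inj_uniq => [/(_ rsr rsu) //|i j /eqP].
by rewrite eqr_nat => /eqP.
Qed.

(** A nonzero [W k] is an eigenvector of ad [E] for the eigenvalue k, and an endomorphism of a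
    finite dimensional matrix space has finitely many eigenvalues. *)
Lemma ad_eigenvector_eventually_0 (E : V -> V) (W : nat -> V -> V) :
  linear E -> (forall k, linear (W k)) ->
  (forall k v, E (W k v) - W k (E v) = k%:R *: W k v) ->
  exists k0, forall k v, (k0 <= k)%N -> W k v = 0.
Proof.
have [m [c [e [cl el cK eK]]]] := fin_dim_coord Vfin => El Wl EW.
have [|Em EmE] := @linear_mx _ _ _ (fun u => c (E (e u))).
  by move=> a x y; rewrite el El cl.
have /choice[Wm WmE] k : exists A, forall u, c (W k (e u)) = u *m A.
  by apply: linear_mx => a x y; rewrite el Wl cl.
(* Coordinates are row vectors, so composition reverses matrix products and [T] represents ad
   [E]. *)
pose T (X : 'M[K]_m) := X *m Em - Em *m X.
have Tl : linear T.
  move=> a x y; rewrite /T mulmxDl mulmxDr -scalemxAl.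
  have -> : Em *m (a *: (x : 'M[K]_m)) = a *: (Em *m x) by rewrite linearZ.
  vector_ring.
pose TL : {linear 'M[K]_m -> 'M[K]_m} := HB.pack T (GRing.isLinear.Build _ _ _ _ T Tl).
have TW k : T (Wm k) = k%:R *: Wm k.
  apply/row_matrixP => i; rewrite !rowE linearZ /=.
  rewrite /T mulmxBr !mulmxA -WmE -!EmE -[c (W k _)]eK !cK.
  have cB x y : c (x - y) = c x - c y by rewrite (linD cl) (linN cl).
  rewrite -[RHS](linZ cl) -EW cB; congr (_ - _).
  by rewrite -WmE cK.
have [k0 hk] := natr_not_root (monic_neq0 (char_poly_monic (lin_mx TL))).
exists k0 => k v /hk; apply: contraNeq => Wv.
rewrite -eigenvalue_root_char; apply/eigenvalueP; exists (mxvec (Wm k)).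
  by rewrite mul_vec_lin /= TW linearZ.
rewrite mxvec_eq0; apply: contraNneq Wv => W0.
by rewrite -[W k v]cK -[v in W k v]cK WmE W0 mulmx0 (lin0 el).
Qed.

(* All powers of C have trace 0: C^(i+1) is the sum of the commutators
   [E, a C^(i+1)] and [A, C^i B]. *)
Lemma commutator_nilpotent (a : K) (C E A B : V -> V) :
  linear C -> linear E -> linear A -> linear B ->
  (forall v, C v = a *: (E (C v) - C (E v)) + (A (B v) - B (A v))) ->
  (forall v, A (C v) = C (A v)) -> exists i, forall v, iter i C v = 0.
Proof.
have [[|m] [c [e [cl el cK eK]]]] := fin_dim_coord Vfin.
  move=> *; exists 0%N => v /=; rewrite -[v]cK (_ : c v = 0) ?(lin0 el) //.
  exact: thinmx0.
move=> Cl El Al Bl CE AC.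
have mxE (X : V -> V) : linear X -> exists Y, forall v, c (X v) = c v *m Y.
  move=> Xl; have [|Y YE] := @linear_mx _ _ _ (fun u => c (X (e u))).
    by move=> b x y; rewrite el Xl cl.
  by exists Y => v; rewrite -YE cK.
have [Cm Cmx] := mxE _ Cl; have [Em Emx] := mxE _ El.
have [Am Amx] := mxE _ Al; have [Bm Bmx] := mxE _ Bl.
have cB x y : c (x - y) = c x - c y by rewrite (linD cl) (linN cl).
have CmE : Cm = a *: (Cm * Em - Em * Cm) + (Bm * Am - Am * Bm).
  apply/row_matrixP => i; rewrite !rowE -[delta_mx 0 i]eK -Cmx CE.
  rewrite mulmxDr -scalemxAr !mulmxBr !mulmxA -!(Cmx, Emx, Amx, Bmx).
  by rewrite (linD cl) (linZ cl) !cB.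
have AmC : GRing.comm Am Cm.
  apply/row_matrixP => i; rewrite !rowE -[delta_mx 0 i]eK.
  by rewrite !mulmxA -!(Cmx, Amx) AC.
have [i Ci] : exists i, Cm ^+ i = 0.
  apply: mxtrace_nilpotent => i.
  have trC (X Y : 'M[K]_m.+1) : \tr (X * Y) = \tr (Y * X) by exact: mxtrace_mulC.
  have tE : \tr (Cm ^+ i * (Em * Cm)) = \tr (Cm ^+ i * (Cm * Em)).
    by rewrite mulrA trC !mulrA -exprS -exprSr.
  have tA : \tr (Cm ^+ i * (Am * Bm)) = \tr (Cm ^+ i * (Bm * Am)).
    by rewrite [in RHS]mulrA [in RHS]trC !mulrA (commrX i AmC).
  rewrite exprSr {2}CmE mulrDr -scalerAr !mulrBr linearD linearZ /= !linearB /=.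
  by rewrite tE tA !subrr mulr0 addr0.
exists i => v; apply: (can_inj cK); rewrite (lin0 cl).
have -> : c (iter i C v) = c v *m Cm ^+ i.
  elim: i {Ci} => [|i IH]; first by rewrite mulmx1.
  by rewrite /= Cmx IH -mulmxA exprSr.
by rewrite Ci mulmx0.
Qed.
End CharacteristicZero.

(** * Eigenprojections of an operator of finite order *)

Section Eigenprojection.
Variables (R : realType) (n : nat) (V : lmodType R[i]) (theta : V -> V).
Hypotheses (n_gt0 : (0 < n)%N) (theta_lin : linear theta).
Hypothesis theta_id : forall v, iter n theta v = v.
Local Notation w := (omega R n).

(** For a remainder 0 < m < n, cos (2 pi m / n) = 1 would force sin (pi m / n) = 0 by the double
    angle formula, while sin is positive on the open interval from 0 to pi. *)
Lemma omega_eq1 (k : int) : (w ^ k == 1) = (n %| k)%Z.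
Proof.
apply/eqP/idP => [wk1|]; last exact: omega_dvd.
rewrite (divz_eq k n) dvdzE; apply/negPn/negP => nk.
pose m := `|(k %% n)%Z|%N.
have mE : (k %% n)%Z = m%:Z by rewrite gez0_abs // modz_ge0 //; lia.
have m0 : (0 < m)%N.
  rewrite lt0n; apply: contra nk => /eqP m0.
  by rewrite -dvdzE mE m0 addr0 dvdz_mull.
have mn : (m < n)%N by have := @ltz_pmod k n; lia.
have : w ^+ m = 1.
  move: wk1; rewrite {1}(divz_eq k n) expfzDr ?omega_neq0 //.
  by rewrite omega_dvd ?dvdz_mull // mul1r mE.
rewrite de_moivre => -[cos1 _].
pose x : R := m%:R * (pi / n%:R).
have xE : m%:R * (2 * pi / n%:R) = x *+ 2 by rewrite /x -mulr_natl; ring.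
have s0 : 0 < sin x.
  apply: sin_gt0_pi; rewrite mulr_gt0 ?ltr0n ?divr_gt0 ?pi_gt0 ?ltr0n //=.
  rewrite /x mulrCA gtr_pMr ?pi_gt0 //.
  by rewrite ltr_pdivrMr ?ltr0n // mul1r ltr_nat.
have : sin x ^+ 2 = 0.
  move: cos1; rewrite xE cos_mulr2n sin2cos2 => /eqP; rewrite subr_eq -mulr2n.
  by rewrite eqrMn2r // => /eqP ->; rewrite subrr.
by apply/eqP; rewrite expf_eq0 /= gt_eqF.
Qed.

(** The averaging projection of the cyclic group generated by [theta] onto the character w^k, a
    discrete Fourier coefficient. *)
Definition eproj (k : int) (v : V) : V :=
  n%:R^-1 *: \sum_(j < n) w ^ (- (k * j%:Z)) *: iter j theta v.

Lemma iter_linear j : linear (iter j theta).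
Proof. elim: j => [|j IH] a u v //; rewrite !iterS. by rewrite IH theta_lin. Qed.

Lemma eproj_linear k : linear (eproj k).
Proof.
move=> a u v; rewrite /eproj scalerA mulrC -scalerA -scalerDr; congr (_ *: _).
rewrite scaler_sumr -big_split; apply: eq_bigr => j _ /=.
by rewrite iter_linear; vector_ring.
Qed.

Lemma n_neq0 : n%:R != 0 :> R[i].
Proof. by rewrite pnatr_eq0 -lt0n. Qed.

Lemma sum_omegaX (m : int) :
  \sum_(j < n) w ^ (m * j%:Z) = if (n %| m)%Z then n%:R else 0.
Proof.
under eq_bigr do rewrite -exprz_exp -exprnP.
case: ifPn => nm.
  rewrite omega_dvd // (eq_bigr (fun=> 1)) => [|j _]; last exact: expr1n.
  by rewrite sumr_const card_ord.
have : (w ^ m - 1) * \sum_(j < n) (w ^ m) ^+ j = 0.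
  by rewrite -subrX1 exprnP exprz_exp omega_dvd ?dvdz_mull // subrr.
move/eqP; rewrite mulf_eq0 subr_eq0 omega_eq1 (negPf nm) => /eqP //.
Qed.

Lemma eproj_eig k v : theta (eproj k v) = w ^ k *: eproj k v.
Proof.
pose f (j : nat) := w ^ (- (k * j%:Z)) *: iter j theta v.
have fS j : theta (f j) = w ^ k *: f j.+1.
  rewrite /f (linZ theta_lin) iterS scalerA -expfzDr ?omega_neq0 //.
  by congr (w ^ _ *: _); lia.
have fn : f n = f 0%N.
  by rewrite /f theta_id mulr0 oppr0 omega_dvd // -mulNr dvdz_mull.
rewrite /eproj (linZ theta_lin) (lin_sum theta_lin) scalerA mulrC -scalerA.
congr (_ *: _); rewrite (eq_bigr (fun j : 'I_n => w ^ k *: f j.+1)) => [|j _]; last first.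
  exact: fS.
(* Applying [theta] shifts the summation index by one; with [f 0] added, both sides become sums over
   n + 1 indices, and [f n = f 0]. *)
rewrite -scaler_sumr; congr (_ *: _); apply: (addrI (f 0%N)).
by rewrite -[LHS](big_ord_recl _ f) big_ord_recr /= fn addrC.
Qed.

Lemma sum_eproj v : \sum_(k < n) eproj k v = v.
Proof.
rewrite /eproj -scaler_sumr exchange_big /=.
under eq_bigr => j _.
  rewrite -scaler_suml (eq_bigr (fun i : 'I_n => w ^ (- j%:Z * i%:Z))) => [|i _].
    rewrite sum_omegaX; over.
  by congr (w ^ _); lia.
rewrite (bigD1 (Ordinal n_gt0)) //= oppr0 dvdz0 big1 => [|i i0].
  by rewrite addr0 scalerA mulVf ?n_neq0 // scale1r.
rewrite ifF ?scale0r //; apply/negP; rewrite dvdzE abszN /= => /dvdn_leq.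
by rewrite lt0n leqNgt ltn_ord => /(_ i0).
Qed.

Lemma eproj_of_eig i k v : theta v = w ^ i *: v ->
  eproj k v = if (n %| i - k)%Z then v else 0.
Proof.
move=> vi; have it j : iter j theta v = w ^ (i * j%:Z) *: v.
  elim: j => [|j IH]; first by rewrite mulr0 expr0z scale1r.
  rewrite iterS IH (linZ theta_lin) vi scalerA -expfzDr ?omega_neq0 //.
  by congr (w ^ _ *: _); lia.
rewrite /eproj (eq_bigr (fun j : 'I_n => w ^ ((i - k) * j%:Z) *: v)) => [|j _].
  rewrite -scaler_suml sum_omegaX scalerA; case: ifP => _.
    by rewrite mulVf ?n_neq0 // scale1r.
  by rewrite mulr0 scale0r.
rewrite it scalerA -expfzDr ?omega_neq0 //.
by congr (w ^ _ *: _); lia.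
Qed.

Lemma eproj_mem (P : V -> Prop) k v : lin_closed P ->
  (forall u, P u -> P (theta u)) -> P v -> P (eproj k v).
Proof.
move=> [P0 PD] Pt Pv.
have PZ a u : P u -> P (a *: u) by move=> Pu; rewrite -[_ *: _]addr0; exact: PD.
apply: (PZ); elim/big_ind: _ => // [u u' Pu Pu'|j _].
  by rewrite -[u]scale1r; exact: PD.
by apply: PZ; elim: (j : nat) => //= i; exact: Pt.
Qed.

End Eigenprojection.

(** * Brackets of Laurent polynomial families *)

Section LinearSums.
Variables (K : fieldType).

(** Bracket identities with polynomial coefficients are reduced to monomials by it, one argument at
    a time. *)
Lemma poly_lin_ext (V : lmodType K) (f h : {poly K} -> V) : linear f -> linear h ->
  (forall i, f 'X^i = h 'X^i) -> forall p, f p = h p.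
Proof.
move=> fl hl fh p; rewrite -[p]coefK poly_def (lin_sum fl) (lin_sum hl).
by apply: eq_bigr => i _; rewrite (linZ fl) (linZ hl) fh.
Qed.

Variable V : lmodType K.

Definition lsum (F : nat -> V) (p : {poly K}) : V := \sum_(j < size p) p`_j *: F j.

Lemma lsum_widen F (p : {poly K}) m : (size p <= m)%N ->
  lsum F p = \sum_(j < m) p`_j *: F j.
Proof.
move=> pm; rewrite /lsum (big_ord_widen m (fun j => p`_j *: F j)) //.
rewrite [RHS](bigID (fun j : 'I_m => (j < size p)%N)) /= [X in _ + X]big1 ?addr0 //.
by move=> j; rewrite -leqNgt => pj; rewrite nth_default ?scale0r.
Qed.

Lemma lsum_linear F : linear (lsum F).
Proof.
move=> a p q; pose m := maxn (size (a *: p + q)) (maxn (size p) (size q)).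
rewrite !(@lsum_widen _ _ m) ?leq_maxl // ?leq_max ?leqnn ?orbT //.
rewrite scaler_sumr -big_split; apply: eq_bigr => j _ /=.
by rewrite coefD coefZ scalerDl scalerA.
Qed.

Lemma lsum_Xn F i : lsum F 'X^i = F i.
Proof.
rewrite /lsum size_polyXn big_ord_recr big1 /= => [|j _].
  by rewrite coefXn eqxx scale1r add0r.
by rewrite coefXn ltn_eqF ?scale0r.
Qed.

Lemma eq_lsum F G p : (forall j, F j = G j) -> lsum F p = lsum G p.
Proof. by move=> FG; apply: eq_bigr => j _; rewrite FG. Qed.

Lemma lsum_XM F p : lsum F ('X * p) = lsum (fun j => F j.+1) p.
Proof.
have l1 : linear (fun p => lsum F ('X * p)).
  by move=> a q q'; rewrite mulrDr -scalerAr lsum_linear.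
apply: (poly_lin_ext l1 (lsum_linear _)) => i.
by rewrite -exprS !lsum_Xn.
Qed.
End LinearSums.

Lemma XderivXn (K : fieldType) i : 'X * ('X^i)^`() = i%:R *: 'X^i :> {poly K}.
Proof.
rewrite derivXn mulrnAr scaler_nat; case: i => [|i]; first by rewrite !mulr0n.
by rewrite -exprS.
Qed.

Section Brackets.
Variables (R : realType) (S : setting R).
Local Notation K := R[i].
Local Notation g := (dg S).
Local Notation d := (dder S).
Local Notation n := (ord S).
Local Notation eg := (@eproj R n g (sg S)).

Lemma eg_eig k x : eg k x \in eig S k.
Proof.
apply/subspace_ofP; apply: eproj_eig; [exact: ord_gt0 | exact: aut_linear |].
exact: ord_id.
Qed.

Lemma eg_id k x : x \in eig S k -> eg k x = x.
Proof.
move=> /subspace_ofP xk.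
by rewrite (eproj_of_eig (ord_gt0 S) (aut_linear (sg S)) _ xk) subrr dvdz0.
Qed.

Lemma eg_linear k : linear (eg k).
Proof. exact: eproj_linear (aut_linear (sg S)) _. Qed.

Lemma eg_par p k x : x \in lie_par g p -> eg k x \in lie_par g p.
Proof.
apply: eproj_mem (lin_closed_mem _) _ => u; exact: aut_even.
Qed.

(* x t^(k/n), where x is first projected to eig k. *)
Definition XT k x : Ltilde S := xt (eg_eig k x).

Lemma XT_xt k x (xk : x \in eig S k) : XT k x = xt xk.
Proof.
by apply: val_inj; rewrite /= eg_id.
Qed.

Lemma XT_linear k : linear (XT k).
Proof.
move=> a x y; apply: val_inj; apply/funext => j; rewrite /= !fctE /mono.
rewrite eg_linear; case: eqP => [_|_]; last by rewrite scaler0 addr0.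
by congr (_, _, _); rewrite /= ?scaler0 ?addr0.
Qed.

Lemma XT_par p k x : x \in lie_par g p -> XT k x \in lie_par (Ltilde S) p.
Proof.
move=> xp; apply/subspace_ofP => j; rewrite -[sub_val _ _]/(mono _ _ _) /mono.
case: eqP => _; last exact: rpred0.
by apply/subspace_ofP; split=> //; exact: eg_par.
Qed.

Lemma ell_par i : ell S i \in lie_par (Ltilde S) false.
Proof.
apply/subspace_ofP => j; rewrite -[sub_val _ _]/(mono _ _ _) /mono.
case: eqP => _; last exact: rpred0.
by apply/subspace_ofP; split=> //; exact: rpred0.
Qed.

Lemma tpow_par i : tpow S i \in lie_par (Ltilde S) false.
Proof.
apply/subspace_ofP => j; rewrite -[sub_val _ _]/(mono _ _ _) /mono.
case: eqP => _; last exact: rpred0.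
by apply/subspace_ofP; split=> //; exact: rpred0.
Qed.

(** The support is finite, and at an index not divisible by n only the component in g can be
    nonzero, so the listed elements span. *)
Lemma Lt_ind (P : Ltilde S -> Prop) : lin_closed P ->
  (forall i, P (ell S i)) -> (forall k x, x \in eig S k -> P (XT k x)) ->
  (forall i, P (tpow S i)) -> forall f, P f.
Proof.
move=> [P0 PD] Pl Px Pt f.
have PZ a u : P u -> P (a *: u) by move=> Pu; rewrite -[_ *: _]addr0; exact: PD.
have PA u v : P u -> P v -> P (u + v).
  by move=> Pu Pv; rewrite -[u]scale1r; exact: PD.
have [N fN] := Lt_fin f.
have -> : f = \sum_(r <- irange N) SubspaceElt (mono_Lt (Lt_eig f r)) :> Lt_space S.
  apply: val_inj; rewrite [RHS](lin_sum (@sub_val_linear _ _ _)).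
  exact: mono_sum fN.
suff key r u (h : u \in cf_eig S r) : P (SubspaceElt (mono_Lt h)).
  by elim/big_ind: _ => // r _; exact: key.
case: u h => [[a x] b] h; have /subspace_ofP[xr] := h.
rewrite /cW /cG /cA /= in xr * => ab.
have [/dvdzP[q rE]|/ab[a0 b0]] := boolP (n %| r)%Z; last first.
  rewrite (_ : SubspaceElt _ = XT r x); first exact: Px.
  apply: val_inj; apply/funext => k; rewrite /= eg_id //; congr (mono _ _ _).
  by congr (_, _, _).
have rE' : r = n%:Z * q by rewrite mulrC.
rewrite (_ : SubspaceElt _ = a *: ell S q + (XT r x + b *: tpow S q)).
  by apply: (PA); [exact: PZ | apply: (PA); [exact: Px | exact: PZ]].
apply: val_inj; apply/funext => k; rewrite /= !fctE eg_id // /mono -rE'.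
case: eqP => _; last by rewrite !scaler0 !addr0.
congr (_, _, _); rewrite /= ?scaler0 ?addr0 ?add0r //; exact/esym/mulr1.
Qed.

Lemma ell_XT i k x : x \in eig S k ->
  lie_br (ell S i) (XT k x) = XT (n%:Z * i + k) (expo S k *: x + i%:~R *: d x).
Proof.
move=> xk; have yk : expo S k *: x + i%:~R *: d x \in eig S (n%:Z * i + k).
  by rewrite eig_shift ?dvdz_mulr // rpredD ?rpredZ ?eig_der.
by rewrite (XT_xt xk) (ell_xt xk yk) (XT_xt yk).
Qed.

Lemma XT_XT j k x y : x \in eig S j -> y \in eig S k ->
  lie_br (XT j x) (XT k y) = XT (j + k) (lie_br x y).
Proof.
by move=> xj yk; rewrite (XT_xt xj) (XT_xt yk) xt_xt (XT_xt (eig_br xj yk)).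
Qed.

(* Wl m p stands for t^(m+1) p(t) d/dt and Xl k x p for x t^(k/n) p(t); the shift
   in Wl makes Wl m 1 = l_m. *)
Definition Wl (m : int) : {poly K} -> Ltilde S := lsum (fun j => ell S (m + j%:Z)).
Definition Xl (k : int) (x : g) : {poly K} -> Ltilde S :=
  lsum (fun j => XT (k + n%:Z * j%:Z) x).

Lemma Wl_linear m : linear (Wl m). Proof. exact: lsum_linear. Qed.
Lemma Xl_linear k x : linear (Xl k x). Proof. exact: lsum_linear. Qed.
Lemma Xl_linearx k p : linear (Xl k ^~ p).
Proof.
move=> a x y; rewrite /Xl /lsum scaler_sumr -big_split; apply: eq_bigr => j _ /=.
by rewrite XT_linear; vector_ring.
Qed.

Lemma Wl_XM m p : Wl m ('X * p) = Wl (m + 1) p.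
Proof. by rewrite /Wl lsum_XM; apply: eq_lsum => j; congr (ell S _); lia. Qed.
Lemma Xl_XM k x p : Xl k x ('X * p) = Xl (k + n%:Z) x p.
Proof. by rewrite /Xl lsum_XM; apply: eq_lsum => j; congr (XT _ _); lia. Qed.
Lemma Wl_1 m : Wl m 1 = ell S m.
Proof. by rewrite /Wl -(expr0 'X) lsum_Xn addr0. Qed.
Lemma Xl_1 k x : Xl k x 1 = XT k x.
Proof. by rewrite /Xl -(expr0 'X) lsum_Xn mulr0 addr0. Qed.

Lemma Wl_par m p : Wl m p \in lie_par (Ltilde S) false.
Proof. by apply: rpred_sum => j _; rewrite rpredZ // ell_par. Qed.
Lemma Xl_par p k x q : x \in lie_par g p -> Xl k x q \in lie_par (Ltilde S) p.
Proof. by move=> xp; apply: rpred_sum => j _; rewrite rpredZ // XT_par. Qed.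

(** This is [f d/dt, h d/dt] = (f h' - h f') d/dt with f = t^(m+1) p and h = t^(m'+1) q. *)
Lemma Wl_Wl m m' p q : lie_br (Wl m p) (Wl m' q) =
  Wl (m + m') ((m' - m)%:~R *: (p * q) + 'X * (p * q^`() - q * p^`())).
Proof.
move: p; apply: poly_lin_ext => [a p p'|a p p'|i].
- by rewrite Wl_linear lie_linl.
- rewrite -Wl_linear; congr Wl; rewrite derivD derivZ -!mul_polyC; ring.
move: q; apply: poly_lin_ext => [a p p'|a p p'|j].
- by rewrite Wl_linear lie_linr.
- rewrite -Wl_linear; congr Wl; rewrite derivD derivZ -!mul_polyC; ring.
have -> : 'X * ('X^i * ('X^j)^`() - 'X^j * ('X^i)^`()) =
    (j%:R - i%:R) *: 'X^(i + j) :> {poly K}.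
  rewrite mulrBr mulrCA XderivXn [X in _ - X]mulrCA XderivXn -!scalerAr -!exprD.
  by rewrite [(j + i)%N]addnC scalerBl.
rewrite -exprD -scalerDl (linZ (Wl_linear _)) /Wl !lsum_Xn ell_ell.
congr (_ *: ell S _); last lia.
by rewrite !intrD !intrN !intrD -!pmulrn; ring.
Qed.

(** With f = t^(m+1) p and h = t^(k/n) q this is [f d/dt, x h] = x f h' + d(x) t (f/t)' h; the
    quotient f/t appears because l_i is t^i times t d/dt. *)
Lemma Wl_Xl m k x p q : x \in eig S k -> lie_br (Wl m p) (Xl k x q) =
  Xl (n%:Z * m + k) x (expo S k *: (p * q) + 'X * (p * q^`())) +
  Xl (n%:Z * m + k) (d x) (m%:~R *: (p * q) + 'X * (p^`() * q)).
Proof.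
move=> xk; move: p; apply: poly_lin_ext => [a p p'|a p p'|i].
- by rewrite Wl_linear lie_linl.
- rewrite scalerDr addrACA -!Xl_linear derivD derivZ; congr (Xl _ _ _ + Xl _ _ _);
  by rewrite -!mul_polyC; ring.
move: q; apply: poly_lin_ext => [a p p'|a p p'|j].
- by rewrite Xl_linear lie_linr.
- rewrite scalerDr addrACA -!Xl_linear derivD derivZ; congr (Xl _ _ _ + Xl _ _ _);
  by rewrite -!mul_polyC; ring.
rewrite mulrCA XderivXn mulrA XderivXn -scalerAr -scalerAl -exprD -!scalerDl.
rewrite !(linZ (Xl_linear _ _)) /Wl /Xl !lsum_Xn.
have xj : x \in eig S (k + n%:Z * j%:Z) by rewrite addrC eig_shift // dvdz_mulr.
rewrite ell_XT // -(linZ (XT_linear _)) -(linZ (XT_linear _)) -(linD (XT_linear _)).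
have -> : n%:Z * m + k + n%:Z * (i + j)%N%:Z = n%:Z * (m + i%:Z) + (k + n%:Z * j%:Z).
  lia.
by congr (XT _ (_ *: _ + _ *: _)); rewrite ?expoD ?expoM ?intrD // -!pmulrn.
Qed.

Lemma Xl_Xl j k x y p q : x \in eig S j -> y \in eig S k ->
  lie_br (Xl j x p) (Xl k y q) = Xl (j + k) (lie_br x y) (p * q).
Proof.
move=> xj yk; move: p; apply: poly_lin_ext => [a p p'|a p p'|i].
- by rewrite Xl_linear lie_linl.
- by rewrite mulrDl -scalerAl Xl_linear.
move: q; apply: poly_lin_ext => [a p p'|a p p'|l].
- by rewrite Xl_linear lie_linr.
- by rewrite mulrDr -scalerAr Xl_linear.
rewrite -exprD /Xl !lsum_Xn XT_XT.
- by congr (XT _ _); lia.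
- by rewrite addrC eig_shift // dvdz_mulr.
- by rewrite addrC eig_shift // dvdz_mulr.
Qed.
End Brackets.

(** * Decomposition into weight spaces *)

Section IntegerSums.
Variables (K : fieldType) (V : lmodType K).
Implicit Types f h : int -> V.

Definition fsum f : V := \sum_(r \in [set: int]) f r.

Lemma fsum_linear a f h : fin_supp f -> fin_supp h ->
  fsum (a *: f + h) = a *: fsum f + fsum h.
Proof.
move=> [N fN] [N' hN'].
have sub F : (forall r, (N + N' < `|r|)%N -> F r = 0) ->
    fsum F = \sum_(r <- irange (N + N')) F r :> V.
  by move=> F0; apply: fsum_seq (irange_uniq _) _ => r /irange_out /F0.
rewrite !sub ?scaler_sumr -?big_split // => r rN; rewrite ?fctE.
- by apply: hN'; lia.
- by apply: fN; lia.
- by rewrite fN ?hN' ?scaler0 ?addr0 //; lia.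
Qed.

Lemma fsum_mono k v : fsum (mono k v) = v.
Proof.
rewrite /fsum (@fsum_seq _ _ [:: k]) //; first by rewrite big_seq1 /mono eqxx.
by move=> r; rewrite inE /mono => /negPf ->.
Qed.

Lemma fin_suppZD a f h : fin_supp f -> fin_supp h -> fin_supp (a *: f + h).
Proof. exact: (fin_supp_closed V).2. Qed.

End IntegerSums.

Section EvenAction.
Variables (K : fieldType) (L : lieSuper K) (M : supermod L).

(** An even [f] produces no sign, so [h] may be inhomogeneous. *)
Lemma act_br_even f h (v : M) : f \in lie_par L false ->
  act (lie_br f h) v = act f (act h v) - act h (act f v).
Proof.
move=> fe; have [h0 [h1 [P0 P1 ->]]] := (lie_decomp L).1 h.
have brD : lie_br f (h0 + h1) = lie_br f h0 + lie_br f h1 := linD (lie_linr f) _ _.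
have actD x y u : act (x + y) u = act x u + act y u := linD (act_linl (u : M)) _ _.
rewrite brD !actD (linD (act_linr _)) (act_br _ fe P0) (act_br _ fe P1) /=.
by rewrite !expr0 !scale1r opprD addrACA.
Qed.

Lemma eigenspace_super (A : M -> M) mu :
  linear A -> (forall p v, v \in mod_par M p -> A v \in mod_par M p) ->
  forall v, A v = mu *: v -> exists v0 v1,
    [/\ v0 \in mod_par M false, v1 \in mod_par M true, A v0 = mu *: v0,
        A v1 = mu *: v1 & v = v0 + v1].
Proof.
move=> Al Ap v Av; have [v0 [v1 [P0 P1 e]]] := (mod_decomp M).1 v.
have [e0 e1] : A v0 = mu *: v0 /\ A v1 = mu *: v1.
  apply: (super_decomp_uniq (mod_decomp M)); rewrite ?Ap ?rpredZ //.
  by rewrite -(linD Al) -scalerDr -e.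
by exists v0, v1.
Qed.
End EvenAction.

Section WeightDecomposition.
Variables (R : realType) (S : setting R) (M : supermod (Ltilde S)).
Variable lam : R[i].
Local Notation K := R[i].
Local Notation g := (dg S).
Local Notation d := (dder S).
Local Notation n := (ord S).
Local Notation w := (omega R n).
Local Notation T i := (act (tpow S i)).

Lemma n0 : n%:R != 0 :> K.
Proof. by rewrite pnatr_eq0 -lt0n ord_gt0. Qed.

Definition weight_at k := weight_space M (lam + expo S k).

Lemma weight_atP k v : v \in weight_at k <-> act (ell S 0) v = (lam + expo S k) *: v.
Proof. by split=> [/subspace_ofP|?] //; apply/subspace_ofP. Qed.

Lemma ell_tpow_act i j (v : M) :
  act (ell S i) (T j v) = T j (act (ell S i) v) + j%:~R *: T (i + j) v.
Proof.
have := act_br_even (tpow S j) v (ell_par S i).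
rewrite ell_tpow (linZ (act_linl v)) => ->; rewrite addrC subrK //.
Qed.

Lemma XT_tpow_act k x j (v : M) : act (XT k x) (T j v) = T j (act (XT k x) v).
Proof.
have := act_br_even (XT k x) v (tpow_par S j).
have [x0 [x1 [P0 P1 ->]]] := (lie_decomp g).1 x.
have key p y : y \in lie_par g p -> lie_br (tpow S j) (XT k y) = 0.
  move=> py; rewrite (lie_skew (tpow_par S j) (XT_par k py)) /XT xt_tpow.
  by rewrite scaler0 oppr0.
rewrite (linD (XT_linear k)) (linD (lie_linr _)) (key _ _ P0) (key _ _ P1) addr0.
by rewrite (lin0 (act_linl v)) => /esym/eqP; rewrite subr_eq0 => /eqP.
Qed.

Lemma weight_at_ell i k v : v \in weight_at k ->
  act (ell S i) v \in weight_at (n%:Z * i + k).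
Proof.
move=> /weight_atP vk; apply/weight_atP.
have := act_br_even (ell S i) v (ell_par S 0).
rewrite ell_ell subr0 add0r (linZ (act_linl v)) vk (linZ (act_linr _)) => /eqP.
by rewrite eq_sym subr_eq => /eqP ->; rewrite -scalerDl expoD expoM addrCA.
Qed.

Lemma weight_at_tpow i k v : v \in weight_at k -> T i v \in weight_at (n%:Z * i + k).
Proof.
move=> /weight_atP vk; apply/weight_atP; 
rewrite ell_tpow_act vk (linZ (act_linr _)) add0r.
by rewrite -scalerDl expoD expoM -addrA [X in lam + X]addrC.
Qed.

Lemma XT_eg k x : XT k (eproj n (sg S) k x) = XT k x.
Proof. by apply: val_inj; rewrite /= eg_id ?eg_eig. Qed.

Lemma weight_at_XT j x k v : v \in weight_at k -> act (XT j x) v \in weight_at (j + k).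
Proof.
move=> /weight_atP vk; apply/weight_atP; rewrite -XT_eg.
have := act_br_even (XT j (eproj n (sg S) j x)) v (ell_par S 0).
rewrite ell_XT ?eg_eig // mulr0 add0r scale0r addr0 (linZ (XT_linear j)).
rewrite (linZ (act_linl v)) vk (linZ (act_linr _)) => /eqP.
by rewrite eq_sym subr_eq => /eqP ->; rewrite -scalerDl expoD addrCA.
Qed.

Lemma weight_at_super k : is_super_subspace (@mod_par _ _ M) (weight_at k).
Proof.
move=> v /weight_atP vk; 
have lp p u : u \in mod_par M p -> act (ell S 0) u \in mod_par M p.
  exact: actP (ell_par S 0).
have [v0 [v1 [P0 P1 e0 e1 e]]] := eigenspace_super (act_linr _) lp vk.
by exists v0, v1; split=> //; apply/weight_atP.
Qed.

(** Induction on [s]: l_0 minus the weight of the head kills the head and multiplies every other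
    term by a nonzero difference of weights. *)
Lemma weight_at_free (s : seq int) (f : int -> M) : uniq s ->
  (forall k, f k \in weight_at k) ->
  \sum_(k <- s) f k = 0 -> forall k, k \in s -> f k = 0.
Proof.
elim: s f => // k0 s IH f /= /andP[k0s us] fk; rewrite big_cons => e0.
have key k : k \in s -> f k = 0.
  move=> ks; have /eqP : (expo S k - expo S k0) *: f k = 0.
    apply: (IH (fun k => (expo S k - expo S k0) *: f k) us _ _ k ks) => [j|].
      exact: rpredZ.
    have : act (ell S 0) (f k0 + \sum_(k <- s) f k) -
        (lam + expo S k0) *: (f k0 + \sum_(k <- s) f k) = 0.
      by rewrite e0 (lin0 (act_linr _)) scaler0 subrr.
    rewrite (linD (act_linr _)) (lin_sum (act_linr _)) (proj1 (weight_atP _ _) (fk k0)).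
    rewrite scalerDr opprD addrACA subrr add0r scaler_sumr -sumrB => e1.
    rewrite -[RHS]e1; apply: eq_bigr => j _.
    rewrite (proj1 (weight_atP _ _) (fk j)) -[RHS]scalerBl /=.
    by rewrite opprD addrACA subrr add0r.
  rewrite scaler_eq0 subr_eq0 => /orP[|/eqP //]; rewrite /expo.
  move=> /eqP /(mulIf (invr_neq0 n0)) /eqP; rewrite eqr_int => /eqP kk0.
  by rewrite -kk0 ks in k0s.
move=> k; rewrite inE => /predU1P[->|/key //].
by move: e0; rewrite big_seq big1 ?addr0 // => j /key.
Qed.

Lemma fsum_inj (f h : int -> M) : fin_supp f -> fin_supp h ->
  (forall k, f k \in weight_at k) -> (forall k, h k \in weight_at k) ->
  fsum f = fsum h -> f = h.
Proof.
move=> ff fh fk hk e; have e0 : fsum (- 1 *: h + f) = 0.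
  by rewrite fsum_linear // e scaleN1r addNr.
have fhf := fin_suppZD (-1) fh ff; have [N hN] := fhf.
have z k : (- 1 *: h + f) k = 0.
  have [kN|/irange_out/hN //] := boolP (k \in irange N).
  apply: weight_at_free (irange_uniq N) _ _ k kN => [j|].
    by rewrite !fctE rpredD ?rpredZ.
  by rewrite -[RHS]e0 /fsum (fsum_seq (irange_uniq N)) // => r /irange_out/hN.
apply/funext => k; have := z k; rewrite !fctE scaleN1r addrC => /eqP.
by rewrite subr_eq0 => /eqP.
Qed.

Definition is_comp (v : M) (f : int -> M) :=
  [/\ fin_supp f, forall k, f k \in weight_at k & fsum f = v].

(** A total function, with the default 0 where no decomposition exists; [compP] shows that the
    default never occurs for a module as in [cuspidal_at]. *)
Definition wcomp (v : M) : int -> M :=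
  if pselect (exists f, is_comp v f) is left h then projT1 (cid h) else 0.

(* lam is a weight of M, so that the weights of M lie in lam + (1/n) Z. *)
Record cuspidal_at := CuspidalAt {
  gen_AL : is_AL_module M;
  gen_simple : simple M;
  gen_cuspidal : cuspidal M;
  gen_weight : exists2 v, v \in weight_at 0 & v != 0 }.
Hypothesis H : cuspidal_at.

(** The weight spaces in lam + (1/n) Z span a graded submodule, which is nonzero because lam is a
    weight, hence is M by simplicity. *)
Lemma M_ind (P : M -> Prop) : lin_closed P ->
  (forall k v, v \in weight_at k -> P v) -> forall v, P v.
Proof.
(* The span of the weight spaces, as the intersection of all subspaces containing them. *)
pose N v := forall P : M -> Prop, lin_closed P ->
  (forall k v, v \in weight_at k -> P v) -> P v.
have Nk k v : v \in weight_at k -> N v by move=> vk Q _ Qk; exact: Qk vk.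
have Nl : lin_closed N.
  split=> [Q [] //|a u v Nu Nv Q Ql Qk].
  by apply: (Ql.2); [exact: Nu | exact: Nv].
have Ns : is_super_subspace (@mod_par _ _ M) (subspace_of Nl).
  move=> v /subspace_ofP/(_ (fun v => exists v0 v1, [/\ v0 \in subspace_of Nl,
    v1 \in subspace_of Nl, v0 \in mod_par M false, v1 \in mod_par M true
    & v = v0 + v1])); apply.
    split=> [|a _ _ [u0 [u1 [? ? ? ? ->]]] [v0 [v1 [? ? ? ? ->]]]].
      by exists 0, 0; rewrite !rpred0 addr0.
    exists (a *: u0 + v0), (a *: u1 + v1); rewrite !rpredD ?rpredZ //.
    by split=> //; rewrite scalerDr addrACA.
  move=> k u /weight_at_super[u0 [u1 [/Nk U0 /Nk U1 P0 P1 e]]].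
  by exists u0, u1; split=> //; apply/subspace_ofP.
have Na x v : v \in subspace_of Nl -> act x v \in subspace_of Nl.
  move=> /subspace_ofP Nv; apply/subspace_ofP.
  have cl y : lin_closed (fun u => N (act y u)).
    split=> [|a u u' Nu Nu']; first by rewrite (lin0 (act_linr _)); exact: Nl.1.
    by rewrite act_linr; exact: Nl.2.
  move: x; apply: Lt_ind => [|i|k x xk|i].
  - split=> [|a x y Nx Ny]; first by rewrite (lin0 (act_linl _)); exact: Nl.1.
    by rewrite act_linl; exact: Nl.2.
  - by apply: Nv (cl _) _ => k u /(weight_at_ell i)/Nk.
  - by apply: Nv (cl _) _ => j u /(weight_at_XT k x)/Nk.
  - by apply: Nv (cl _) _ => k u /(weight_at_tpow i)/Nk.
move=> Pl Pk v; have [_ /(_ (Submodule Ns Na))[N0|NT]] := gen_simple H.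
  have [v0 v0k v0n] := gen_weight H.
  have v0z := N0 v0 (introT (subspace_ofP Nl _) (Nk _ _ v0k)).
  by rewrite v0z eqxx in v0n.
by have /subspace_ofP/(_ P Pl Pk) := NT v.
Qed.

Lemma compP v : is_comp v (wcomp v).
Proof.
rewrite /wcomp; case: pselect => [h|[]]; first exact: projT2 (cid h).
move: v; apply: M_ind => [|k v vk].
  split=> [|a u v [f [ff fk fu]] [h [fh hk hv]]].
    exists 0; split=> [|k|]; first exact: (fin_supp_closed _).1.
      exact: rpred0.
    by rewrite /fsum fsbig1.
  exists (a *: f + h); split=> [|k|]; first exact: fin_suppZD.
    by rewrite !fctE rpredD ?rpredZ.
  by rewrite fsum_linear // fu hv.
exists (mono k v); split=> [|j|]; first exact: fin_supp_mono.
  by rewrite /mono; case: eqP => [->|_] //; exact: rpred0.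
exact: fsum_mono.
Qed.

Lemma comp_fin v : fin_supp (wcomp v). Proof. by case: (compP v). Qed.
Lemma comp_weight_at v k : wcomp v k \in weight_at k. Proof. by case: (compP v). Qed.
Lemma fsum_comp v : fsum (wcomp v) = v. Proof. by case: (compP v). Qed.

Lemma comp_eq v f : is_comp v f -> wcomp v = f.
Proof.
move=> [ff fk fv]; apply: fsum_inj => //; [exact: comp_fin | exact: comp_weight_at |].
by rewrite fsum_comp.
Qed.

Lemma comp_linear : linear wcomp.
Proof.
move=> a u v; apply: comp_eq; have [fu ku eu] := compP u; have [fv kv ev] := compP v.
split=> [|k|]; first exact: fin_suppZD.
  by rewrite !fctE rpredD ?rpredZ.
by rewrite fsum_linear // eu ev.
Qed.

Lemma comp_mono k v : v \in weight_at k -> wcomp v = mono k v.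
Proof.
move=> vk; apply: comp_eq; split=> [|j|]; first exact: fin_supp_mono.
  by rewrite /mono; case: eqP => [->|_] //; exact: rpred0.
exact: fsum_mono.
Qed.

Lemma comp_shift (A : M -> M) s v k : linear A ->
  (forall j u, u \in weight_at j -> A u \in weight_at (s + j)) ->
  wcomp (A v) (s + k) = A (wcomp v k).
Proof.
move=> Al As; move: v; apply: M_ind => [|j v vj].
  split=> [|a u v eu ev].
    by rewrite (lin0 Al) (lin0 comp_linear) (lin0 Al).
  by rewrite Al !comp_linear !fctE Al eu ev.
rewrite (comp_mono vj) (comp_mono (As _ _ vj)) /mono (inj_eq (addrI s)).
by case: eqP => _ //; rewrite (lin0 Al).
Qed.

(** Every vector is a sum of two homogeneous ones with homogeneous components: this is linear in the
    vector and clear on weight vectors. Uniqueness of parity components then applies to [v]. *)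
Lemma comp_par p v k : v \in mod_par M p -> wcomp v k \in mod_par M p.
Proof.
have key u : exists v0 v1, [/\ v0 \in mod_par M false, v1 \in mod_par M true,
    wcomp v0 k \in mod_par M false, wcomp v1 k \in mod_par M true & u = v0 + v1].
  move: u; apply: M_ind => [|j u /[dup] uj /weight_at_super].
    split=> [|a _ _ [u0 [u1 [? ? ? ? ->]]] [v0 [v1 [? ? ? ? ->]]]].
      by exists 0, 0; rewrite (lin0 comp_linear) !rpred0 addr0.
    exists (a *: u0 + v0), (a *: u1 + v1).
    rewrite !comp_linear !fctE !rpredD ?rpredZ //.
    by split=> //; rewrite scalerDr addrACA.
  move=> [u0 [u1 [U0 U1 P0 P1 e]]]; exists u0, u1; split=> //.
    by rewrite (comp_mono U0) /mono; case: eqP => _ //; exact: rpred0.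
  by rewrite (comp_mono U1) /mono; case: eqP => _ //; exact: rpred0.
have [v0 [v1 [P0 P1 C0 C1 e]]] := key v; case: p => vp.
  have [|_ ->] := super_decomp_uniq (mod_decomp M) (rpred0 _) vp P0 P1.
    by rewrite add0r.
  exact: C1.
have [|-> _] := super_decomp_uniq (mod_decomp M) vp (rpred0 _) P0 P1.
  by rewrite addr0.
exact: C0.
Qed.
End WeightDecomposition.

(** * The fibre at t = 1 *)

Lemma proj_linear (K : fieldType) (V : lmodType K) (N : submodClosed V) :
  linear (@Defs.proj K V N).
Proof. by move=> a u v; rewrite projD projZ. Qed.

Section FiniteGeneration.
Variables (K : fieldType) (V : lmodType K).

Definition fin_gen (P : V -> Prop) := exists m (f : 'rV[K]_m -> V),
  linear f /\ forall v, P v -> exists u, v = f u.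

Lemma fin_gen_sum (P : nat -> V -> Prop) m : (forall i, fin_gen (P i)) ->
  fin_gen (fun v => exists2 u : nat -> V, (forall i, P i (u i)) & v = \sum_(i < m) u i).
Proof.
move=> Pf; elim: m => [|m [a [f [fl fP]]]].
  exists 0%N, (fun=> 0); split=> [b u v|_ [u _ ->]]; first by rewrite scaler0 addr0.
  by exists 0; rewrite big_ord0.
have [b [h [hl hP]]] := Pf m.
exists (a + b)%N, (fun u => f (lsubmx u) + h (rsubmx u)); split=> [c u v|_ [u Pu ->]].
  by rewrite !linearD !linearZ fl hl; vector_ring.
have [x xE] := fP _ (ex_intro2 _ _ u Pu (erefl _)); have [y yE] := hP _ (Pu m).
by exists (row_mx x y); rewrite row_mxKl row_mxKr -xE -yE big_ord_recr.
Qed.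
End FiniteGeneration.

Section Fibre.
Variables (R : realType) (S : setting R) (M : supermod (Ltilde S)).
Variable lam : R[i].
Local Notation K := R[i].
Local Notation g := (dg S).
Local Notation d := (dder S).
Local Notation n := (ord S).
Local Notation w := (omega R n).
Local Notation T i := (act (tpow S i)).
Local Notation weight_at := (weight_at M lam).

Lemma tm1_closed : lin_closed (fun v : M => exists u, v = T 1 u - u).
Proof.
split=> [|a _ _ [u ->] [v ->]]; first by exists 0; rewrite (lin0 (act_linr _)) subr0.
by exists (a *: u + v); rewrite act_linr; vector_ring.
Qed.
Definition tm1 := subspace_of tm1_closed.

Definition fibre : lmodType K := quotient_type tm1.
Definition pr : M -> fibre := Defs.proj tm1.

Lemma pr_linear : linear pr. Proof. exact: proj_linear. Qed.

Lemma prB u v : pr (u - v) = pr u - pr v.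
Proof. exact: projB. Qed.

Lemma tm1P u v : pr u = pr v <-> exists x, u - v = T 1 x - x.
Proof.
rewrite /pr proj_eq; split=> [/subspace_ofP //|h]; exact/subspace_ofP.
Qed.

Lemma pr_surj q : exists v, q = pr v.
Proof.
by exists (repr (q : Quotient.quot (subspace_zmod tm1))); rewrite /pr proj_repr.
Qed.

(** A representative is always chosen, so this is total; it is the induced map when [f] preserves (t
    - 1) M, as assumed in [liftE]. *)
Definition lift (f : M -> M) (q : fibre) : fibre :=
  pr (f (repr (q : Quotient.quot (subspace_zmod tm1)))).

Lemma liftE (f : M -> M) v : linear f -> (forall u, pr (f (T 1 u)) = pr (f u)) ->
  lift f (pr v) = pr (f v).
Proof.
move=> fl fT.
have /tm1P[x e] : pr (repr (pr v : Quotient.quot (subspace_zmod tm1))) = pr v.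
  by rewrite /pr proj_repr.
apply/eqP; rewrite -subr_eq0; apply/eqP; rewrite /lift.
have fB a b : f (a - b) = f a - f b by rewrite (linD fl) (linN fl).
by rewrite -prB -fB e fB prB fT subrr.
Qed.

Lemma lift_linear (f : M -> M) : linear f -> (forall u, pr (f (T 1 u)) = pr (f u)) ->
  linear (lift f).
Proof.
move=> fl fT a q q'; have [v ->] := pr_surj q; have [v' ->] := pr_surj q'.
by rewrite -pr_linear !liftE // fl pr_linear.
Qed.

(* The elements of Ltilde whose action descends to the fibre at t = 1. *)
Definition stab (f : Ltilde S) := forall u, pr (act f (T 1 u)) = pr (act f u).
Definition qact (f : Ltilde S) : fibre -> fibre := lift (act f).

Lemma qactE f v : stab f -> qact f (pr v) = pr (act f v).
Proof. by move=> fs; apply: liftE fs; exact: act_linr. Qed.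

Lemma qact_linear f : stab f -> linear (qact f).
Proof. by move=> fs; apply: lift_linear fs; exact: act_linr. Qed.

Lemma stab_closed : lin_closed stab.
Proof.
split=> [u|a f h fs hs u]; first by rewrite !(lin0 (act_linl _)).
by rewrite !act_linl !pr_linear fs hs.
Qed.

Lemma qact_linl q : linear (qact^~ q).
Proof. by move=> a f h; rewrite /qact /lift act_linl pr_linear. Qed.

Lemma qact_br_even f h q : f \in lie_par (Ltilde S) false -> stab f -> stab h ->
  qact f (qact h q) - qact h (qact f q) = qact (lie_br f h) q.
Proof.
move=> fe fs hs; have [v ->] := pr_surj q.
have bs : stab (lie_br f h).
  move=> u; rewrite !act_br_even // !prB.
  rewrite -!(qactE (act _ _)) //.
  by rewrite !(qactE (T 1 u)) // fs hs -!qactE.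
by rewrite !qactE // act_br_even // prB.
Qed.

Lemma qact_br p r f h q : f \in lie_par (Ltilde S) p -> h \in lie_par (Ltilde S) r ->
  stab f -> stab h ->
  qact f (qact h q) - (-1) ^+ (p && r) *: qact h (qact f q) = qact (lie_br f h) q.
Proof.
move=> fp hr fs hs; have [v ->] := pr_surj q.
have prBZ a x y : pr (x - a *: y) = pr x - a *: pr y.
  by rewrite prB (linZ pr_linear).
have bs : stab (lie_br f h).
  move=> u; rewrite !(act_br _ fp hr) !prBZ -!(qactE (act _ _)) //.
  by rewrite !(qactE (T 1 u)) // fs hs -!qactE.
by rewrite !qactE // (act_br _ fp hr) prBZ.
Qed.

Lemma stab_XT k x : stab (XT k x).
Proof.
by move=> u; rewrite XT_tpow_act; apply/tm1P; exists (act (XT k x) u).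
Qed.

Lemma stab_Xl k x p : stab (Xl k x p).
Proof.
rewrite /Xl /lsum; have [s0 sD] := stab_closed.
elim/big_ind: _ => // [f h fs hs|j _]; first by rewrite -[f]scale1r; exact: sD.
by rewrite -[_ *: _]addr0; apply: sD => //; exact: stab_XT.
Qed.

Section Associative.
Hypothesis AL : is_AL_module M.

Lemma pr_tpow i v : pr (T i v) = pr v.
Proof.
have [TT T0] := AL; have T1 u : pr (T 1 u) = pr u by apply/tm1P; exists u.
elim/int_rec: i v => [v|i IH v|i IH v]; first by rewrite T0.
  by rewrite -[RHS]IH -[RHS]T1 TT -addn1 PoszD addrC.
by rewrite -[LHS]T1 TT -[RHS]IH; congr (pr (act (tpow S _) _)); lia.
Qed.

(** The bracket of t^(m+1) p d/dt with t is t^(m+1) p, which acts on the fibre by its value p(1). So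
    the fields vanishing at 1 descend. *)
Lemma pr_Wl m p v : pr (act (Wl S m p) (T 1 v)) = pr (act (Wl S m p) v) + p.[1] *: pr v.
Proof.
move: p; apply: poly_lin_ext => [a p q|a p q|i].
- by rewrite Wl_linear act_linl pr_linear.
- rewrite Wl_linear act_linl pr_linear !hornerE; vector_ring.
rewrite hornerXn expr1n scale1r /Wl lsum_Xn ell_tpow_act (linD pr_linear).
by rewrite (linZ pr_linear) !pr_tpow scale1r.
Qed.

Lemma stab_Wl m p : root p 1 -> stab (Wl S m p).
Proof. by move=> /rootP p1 u; rewrite pr_Wl p1 scale0r addr0. Qed.

Lemma stab_ellB i j : stab (ell S i - ell S j).
Proof.
move=> u; have actB x y v : act (x - y) v = act x v - act y v :> M.
  by rewrite (linD (act_linl v)) (linN (act_linl v)).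
rewrite !actB !ell_tpow_act opprD addrACA -scalerBr.
by rewrite !(linD pr_linear, linN pr_linear, linZ pr_linear) !pr_tpow subrr scaler0 addr0.
Qed.
End Associative.

Lemma fibre_par_closed p :
  lin_closed (fun q : fibre => exists2 v, v \in mod_par M p & q = pr v).
Proof.
split=> [|a _ _ [u Pu ->] [v Pv ->]].
  by exists 0; rewrite ?rpred0 // (lin0 pr_linear).
by exists (a *: u + v); rewrite ?rpredD ?rpredZ // pr_linear.
Qed.
Definition fibre_par p := subspace_of (fibre_par_closed p).

Lemma pr_par p v : v \in mod_par M p -> pr v \in fibre_par p.
Proof. by move=> vp; apply/subspace_ofP; exists v. Qed.

Lemma fibre_decomp : super_decomp fibre_par.
Proof.
split=> [q|q /subspace_ofP[v0 P0 ->] /subspace_ofP[v1 P1]].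
  have [v ->] := pr_surj q; have [v0 [v1 [P0 P1 ->]]] := (mod_decomp M).1 v.
  by exists (pr v0), (pr v1); rewrite -(linD pr_linear) !pr_par.
move=> /tm1P[x]; have [x0 [x1 [X0 X1 ->]]] := (mod_decomp M).1 x.
have TP p u : u \in mod_par M p -> T 1 u - u \in mod_par M p.
  by move=> up; rewrite -scaleN1r rpredD ?rpredZ // (actP (tpow_par S 1) up).
rewrite (linD (act_linr _)) opprD addrACA => e.
have P1' : - v1 \in mod_par M true by rewrite -scaleN1r rpredZ.
have [-> _] := super_decomp_uniq (mod_decomp M) P0 P1' (TP _ _ X0) (TP _ _ X1) e.
by rewrite -(lin0 pr_linear); apply/tm1P; exists x0; rewrite subr0.
Qed.

Lemma qact_par p r f q : f \in lie_par (Ltilde S) p -> stab f ->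
  q \in fibre_par r -> qact f q \in fibre_par (p (+) r).
Proof.
move=> fp fs /subspace_ofP[v vr ->]; rewrite qactE //.
by apply: pr_par; exact: actP.
Qed.

Hypothesis H : cuspidal_at M lam.

Lemma fibre_ind (P : fibre -> Prop) : lin_closed P ->
  (forall k v, v \in weight_at k -> P (pr v)) -> forall q, P q.
Proof.
move=> [P0 PD] Pk q; have [v ->] := pr_surj q; move: v.
apply: (M_ind H) => [|k v /Pk //]; split=> [|a u v Pu Pv].
  by rewrite (lin0 pr_linear).
by rewrite pr_linear; exact: PD.
Qed.

(** Powers of t move the index by multiples of n without changing the class in the fibre, so the
    image of [weight_at k] depends only on k modulo n. *)
Lemma weight_at_mod j k v : (n %| j - k)%Z -> v \in weight_at j ->
  exists2 u, u \in weight_at k & pr u = pr v.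
Proof.
move=> /dvdzP[i e] vj; exists (T (- i) v); last by rewrite pr_tpow //; case: H.
by have := weight_at_tpow (- i) vj; rewrite (_ : _ + j = k) //; lia.
Qed.

(** This is exp (2 pi i (l_0 - lam)); it descends to the fibre because t shifts the index by n and
    w^n = 1. *)
Definition twistM (v : M) : M := fsum (fun k => w ^ k *: wcomp lam v k).

Lemma twistM_linear : linear twistM.
Proof.
have fs (v : M) : fin_supp (fun k => w ^ k *: wcomp lam v k).
  by have [N hN] := comp_fin H v; exists N => k /hN ->; rewrite scaler0.
move=> a u v; rewrite -fsum_linear //; congr fsum; apply/funext => k.
by rewrite (comp_linear H) !fctE; vector_ring.
Qed.

Lemma twistM_weight_at k v : v \in weight_at k -> twistM v = w ^ k *: v.
Proof.
move=> vk; rewrite -[RHS](fsum_mono k) /twistM (comp_mono H vk); congr fsum.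
by apply/funext => j; rewrite /mono; case: eqP => [->|_] //; rewrite scaler0.
Qed.

Lemma twistM_tpow v : pr (twistM (T 1 v)) = pr (twistM v).
Proof.
move: v; apply: (M_ind H) => [|k v vk].
  split=> [|a u v eu ev]; first by rewrite !(lin0 (act_linr _)).
  by rewrite act_linr !twistM_linear !pr_linear eu ev.
rewrite (twistM_weight_at vk) (twistM_weight_at (weight_at_tpow 1 vk)) !(linZ pr_linear).
rewrite pr_tpow; last by case: H.
by rewrite expfzDr ?omega_neq0 // [w ^ (_ * 1)]omega_dvd ?ord_gt0 ?dvdz_mulr // mul1r.
Qed.

(* The grading automorphism: the image of weight_at k in the fibre is the eigenspace of
   twist for w ^ k. *)
Definition twist : fibre -> fibre := lift twistM.

Lemma twist_linear : linear twist.
Proof. exact: lift_linear twistM_linear twistM_tpow. Qed.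

Lemma twist_pr k v : v \in weight_at k -> twist (pr v) = w ^ k *: pr v.
Proof.
by move=> vk; rewrite /twist liftE ?(twistM_weight_at vk) ?(linZ pr_linear) //;
  [exact: twistM_linear | exact: twistM_tpow].
Qed.

Lemma twist_id q : iter n twist q = q.
Proof.
move: q; apply: fibre_ind => [|k v vk].
  have il := iter_linear twist_linear n.
  split=> [|a u v eu ev]; first exact: lin0 il.
  by rewrite il eu ev.
have it j : iter j twist (pr v) = w ^ (k * j%:Z) *: pr v.
  elim: j => [|j IH]; first by rewrite mulr0 expr0z scale1r.
  rewrite iterS IH (linZ twist_linear) (twist_pr vk) scalerA -expfzDr ?omega_neq0 //.
  by congr (w ^ _ *: _); lia.
by rewrite it omega_dvd ?ord_gt0 ?dvdz_mull // scale1r.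
Qed.

Lemma twist_qact k f q : stab f ->
  (forall j v, v \in weight_at j -> twist (pr (act f v)) = w ^ (k + j) *: pr (act f v)) ->
  twist (qact f q) = w ^ k *: qact f (twist q).
Proof.
move=> fs fk; have ql := qact_linear fs; move: q; apply: fibre_ind => [|j v vj].
  split=> [|a u v eu ev]; first by rewrite !(lin0 ql, lin0 twist_linear) scaler0.
  by rewrite !(twist_linear, ql) eu ev; vector_ring.
rewrite (twist_pr vj) qactE // (linZ ql) qactE // (fk _ _ vj).
by rewrite scalerA -expfzDr ?omega_neq0.
Qed.

Lemma twist_Wl m p q : root p 1 -> twist (qact (Wl S m p) q) = qact (Wl S m p) (twist q).
Proof.
move=> p1; rewrite (@twist_qact 0) ?expr0z ?scale1r // => [|j v vj].
  by apply: stab_Wl p1; case: H.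
rewrite add0r; move: p {p1}; apply: poly_lin_ext => [a p q'|a p q'|i].
- by rewrite Wl_linear act_linl pr_linear twist_linear.
- by rewrite Wl_linear act_linl pr_linear; vector_ring.
rewrite /Wl lsum_Xn (twist_pr (weight_at_ell _ vj)) expfzDr ?omega_neq0 //.
by rewrite [w ^ (_ * _)]omega_dvd ?ord_gt0 ?dvdz_mulr // mul1r.
Qed.

Lemma twist_Xl k x p q : twist (qact (Xl k x p) q) = w ^ k *: qact (Xl k x p) (twist q).
Proof.
rewrite (@twist_qact k) // => [|j v vj]; first exact: stab_Xl.
move: p; apply: poly_lin_ext => [a p q'|a p q'|i].
- by rewrite Xl_linear act_linl pr_linear twist_linear.
- by rewrite Xl_linear act_linl pr_linear; vector_ring.
rewrite /Xl lsum_Xn (twist_pr (weight_at_XT _ _ vj)) addrAC.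
rewrite [in LHS]expfzDr ?omega_neq0 //.
by rewrite mulrC [w ^ (_ * _)]omega_dvd ?ord_gt0 ?dvdz_mulr // mul1r.
Qed.

(** The eigenprojection fixes [q] and keeps only the weight components with index congruent to k,
    which powers of t move into [weight_at k]. *)
Lemma twist_eig k q : twist q = w ^ k *: q -> exists2 v, v \in weight_at k & q = pr v.
Proof.
move=> qk; have <- : eproj n twist k q = q.
  by rewrite (eproj_of_eig (ord_gt0 S) twist_linear _ qk) subrr dvdz0.
move: {qk} q; apply: fibre_ind => [|j v vj].
  have el := eproj_linear n twist_linear k.
  split=> [|a u v [u' u'k eu] [v' v'k ev]].
    by exists 0; rewrite ?rpred0 // (lin0 el) (lin0 pr_linear).
  by exists (a *: u' + v'); rewrite ?rpredD ?rpredZ // el eu ev pr_linear.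
rewrite (eproj_of_eig (ord_gt0 S) twist_linear _ (twist_pr vj)).
case: ifP => [jk|_]; last by exists 0; rewrite ?rpred0 // (lin0 pr_linear).
by have [u uk e] := weight_at_mod jk vj; exists u.
Qed.

Lemma twist_par p q : q \in fibre_par p -> twist q \in fibre_par p.
Proof.
move=> /subspace_ofP[v vp ->]; rewrite /twist liftE; [|exact: twistM_linear
  | exact: twistM_tpow].
apply: pr_par; rewrite /twistM /fsum.
have [N hN] := comp_fin H v.
rewrite (fsum_seq (irange_uniq N)) => [|r /irange_out /hN ->]; last by rewrite scaler0.
by rewrite rpred_sum // => k _; rewrite rpredZ // comp_par.
Qed.

(** The fibre is the sum of the n eigenspaces of [twist], each the image of one weight space, and
    cuspidality bounds these. *)
Lemma fibre_fin_dim : fin_dim fibre.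
Proof.
have [_ [N dN]] := gen_cuspidal H.
have gen k : fin_gen (fun q => exists2 v, v \in weight_at k & q = pr v).
  have [m _ [[f fl [h fK hK]]]] := dN (lam + expo S k).
  exists m, (fun u => pr (sub_val (h u))); split=> [a u v|_ [v vk ->]].
    rewrite -pr_linear -sub_val_linear; congr (pr (sub_val _)).
    by apply: (can_inj fK); rewrite fl !hK.
  by exists (f (SubspaceElt vk)); rewrite fK.
have [m [f [fl fP]]] := fin_gen_sum n (fun i : nat => gen i).
apply: (fin_dim_surj fl) => q; apply: fP.
exists (fun i : nat => eproj n twist i q) => [i|].
  apply: twist_eig; apply: eproj_eig; [exact: ord_gt0 | exact: twist_linear |].
  exact: twist_id.
rewrite sum_eproj //; exact: ord_gt0.
Qed.

(** Suppose v = (t - 1) x with v nonzero of index 0. Along the multiples of n, the components of x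
    vanish below 0, equal -v at 0, and from there each is t times the previous one, hence nonzero.
    This contradicts finite support. *)
Lemma fibre_neq0 : exists q : fibre, q != 0.
Proof.
have [v vk v0] := gen_weight H; exists (pr v); apply/eqP.
rewrite -(lin0 pr_linear) => /tm1P[x]; rewrite subr0 => e.
have Tc k : wcomp lam v (n%:Z + k) = T 1 (wcomp lam x k) - wcomp lam x (n%:Z + k).
  rewrite e (linD (comp_linear H)) (linN (comp_linear H)) !fctE; congr (_ - _).
  apply: (comp_shift H) => [|j u uj]; first exact: act_linr.
  by have := weight_at_tpow 1 uj; rewrite mulr1.
have vc k : k != 0 -> wcomp lam v k = 0.
  by move=> k0; rewrite (comp_mono H vk) /mono (negPf k0).
have [N hN] := comp_fin H x; have n_gt0 := ord_gt0 S.
have T_inj (u : M) : T 1 u = 0 -> u = 0.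
  have [[TT T0] _ _ _] := H.
  by move=> Tu; have := TT (- 1) 1 u; rewrite Tu (lin0 (act_linr _)) addNr T0.
have down (j : nat) : wcomp lam x (- (n%:Z * j.+1%:Z)) = 0.
  suff h (i : nat) : wcomp lam x (- (n%:Z * (j.+1%:Z + i%:Z))) = 0 ->
      wcomp lam x (- (n%:Z * j.+1%:Z)) = 0.
    by apply: (h N); apply: hN; nia.
  elim: i => [|i IH] hi; first by rewrite addr0 in hi.
  apply: IH; have := Tc (- (n%:Z * (j.+1%:Z + i.+1%:Z))).
  rewrite hi (lin0 (act_linr _)) sub0r.
  have -> : n%:Z - n%:Z * (j.+1%:Z + i.+1%:Z) = - (n%:Z * (j.+1%:Z + i%:Z)) by lia.
  by rewrite vc ?oppr_eq0; [move/esym/eqP; rewrite oppr_eq0 => /eqP | nia].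
have x0 : wcomp lam x 0 != 0.
  have := Tc (- n%:Z); have := down 0%N; rewrite mulr1 => ->.
  rewrite (lin0 (act_linr _)) subrr sub0r (comp_mono H vk) /mono eqxx => e0.
  by apply: contraNneq v0 => x0; rewrite e0 x0 oppr0.
have up (j : nat) : wcomp lam x (n%:Z * j%:Z) != 0.
  elim: j => [|j IH]; first by rewrite mulr0.
  have := Tc (n%:Z * j%:Z); rewrite vc; last by nia.
  move=> /esym/eqP; rewrite subr_eq0 => /eqP e1.
  have -> : n%:Z * j.+1%:Z = n%:Z + n%:Z * j%:Z by lia.
  by rewrite -e1; apply: contraNneq IH => /T_inj ->.
by move: (up N.+1); rewrite hN ?eqxx //; nia.
Qed.

(** The vectors of M whose weight components all project into [N] form a submodule. It is nonzero:
    by stability under [twist], [N] contains a nonzero eigenvector, which lifts to a weight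
    vector. *)
Lemma fibre_graded_simple (N : fibre -> Prop) : lin_closed N ->
  (forall q, N q -> exists q0 q1, [/\ N q0, N q1, q0 \in fibre_par false,
     q1 \in fibre_par true & q = q0 + q1]) ->
  (forall q, N q -> N (twist q)) ->
  (forall i q, N q -> N (qact (ell S i - ell S 0) q)) ->
  (forall k x q, x \in eig S k -> N q -> N (qact (XT k x) q)) ->
  (exists2 q, N q & q != 0) -> forall q, N q.
Proof.
move=> Nl Nsup Ntw NL NX [q Nq q0]; have [AL Ms _ _] := H.
have [N0 ND] := Nl.
have NA u v : N u -> N v -> N (u + v) by move=> Nu Nv; rewrite -[u]scale1r; exact: ND.
have NZ a u : N u -> N (a *: u) by move=> Nu; rewrite -[_ *: _]addr0; exact: ND.
pose N' v := forall k, N (pr (wcomp lam v k)).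
have N'l : lin_closed N'.
  split=> [k|a u v Nu Nv k]; first by rewrite (lin0 (comp_linear H)) (lin0 pr_linear).
  by rewrite (comp_linear H) !fctE pr_linear; exact: ND.
have N's : is_super_subspace (@mod_par _ _ M) (subspace_of N'l).
  move=> v /subspace_ofP Nv; have [v0 [v1 [P0 P1 e]]] := (mod_decomp M).1 v.
  have h k : N (pr (wcomp lam v0 k)) /\ N (pr (wcomp lam v1 k)).
    have [q0' [q1' [Nq0 Nq1 Q0 Q1]]] := Nsup _ (Nv k).
    rewrite e (linD (comp_linear H)) !fctE (linD pr_linear) => e'.
    have [] := super_decomp_uniq fibre_decomp _ _ Q0 Q1 e'.
    - by apply: pr_par; exact: comp_par.
    - by apply: pr_par; exact: comp_par.
    by move=> -> ->.
  exists v0, v1; split=> //; apply/subspace_ofP => k; by have [] := h k.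
have N'a x v : v \in subspace_of N'l -> act x v \in subspace_of N'l.
  move=> /subspace_ofP Nv; apply/subspace_ofP; move: x; apply: Lt_ind => [|i|j x xj|i].
  - split=> [|a x y Nx Ny]; first by rewrite (lin0 (act_linl _)); exact: N'l.1.
    by rewrite act_linl; exact: N'l.2.
  - move=> k; have -> : k = n%:Z * i + (k - n%:Z * i) by rewrite addrC subrK.
    rewrite (comp_shift H) => [||j u uj]; [|exact: act_linr|exact: weight_at_ell].
    set u := wcomp _ _ _.
    (* l_i itself does not act on the fibre, but l_0 is a scalar on the weight vector [u]. *)
    have -> : pr (act (ell S i) u) =
        qact (ell S i - ell S 0) (pr u) + (lam + expo S (k - n%:Z * i)) *: pr u.
      rewrite qactE; last exact: stab_ellB.
      rewrite (linD (act_linl u)) (linN (act_linl u)) (linD pr_linear) (linN pr_linear).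
      rewrite (proj1 (weight_atP _ _ _) (comp_weight_at H v (k - n%:Z * i))).
      rewrite (linZ pr_linear).
      by rewrite addrNK.
    by apply: NA; [apply: NL; exact: Nv | apply: NZ; exact: Nv].
  - move=> k; have -> : k = j + (k - j) by rewrite addrC subrK.
    rewrite (comp_shift H) => [||l u ul]; [|exact: act_linr|exact: weight_at_XT].
    by rewrite -qactE; [apply: NX xj _; exact: Nv | exact: stab_XT].
  - move=> k; have -> : k = n%:Z * i + (k - n%:Z * i) by rewrite addrC subrK.
    rewrite (comp_shift H) => [||l u ul]; [|exact: act_linr|exact: weight_at_tpow].
    by rewrite pr_tpow //; exact: Nv.
have [_ /(_ (Submodule N's N'a))[N'0|N'T]] := Ms; last first.
  apply: fibre_ind => // k v vk; have /subspace_ofP/(_ k) := N'T v.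
  by rewrite (comp_mono H vk) /mono eqxx.
have [k ek] : exists k, eproj n twist k q != 0.
  apply: contrapT => h; move/eqP: q0; apply.
  rewrite -(sum_eproj twist (ord_gt0 S) q) big1 // => k _; apply/eqP.
  by apply/negPn/negP => ek; apply: h; exists k.
have [|v vk e] := @twist_eig k (eproj n twist k q).
  by apply: eproj_eig; [exact: ord_gt0 | exact: twist_linear | exact: twist_id].
have Nv : N (pr v) by rewrite -e; exact: eproj_mem.
case/eqP: ek; rewrite e (N'0 v) ?(lin0 pr_linear) //; apply/subspace_ofP => j.
by rewrite (comp_mono H vk) /mono; case: eqP => _ //; rewrite (lin0 pr_linear).
Qed.
End Fibre.

(** * The positive part acts by zero on the fibre *)

Section Reduction.
Variables (R : realType) (S : setting R) (M : supermod (Ltilde S)).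
Variable lam : R[i].
Local Notation K := R[i].
Local Notation g := (dg S).
Local Notation d := (dder S).
Local Notation n := (ord S).
Local Notation w := (omega R n).
Local Notation V := (fibre M).
Local Notation Wl := (Wl S).
Implicit Types (q : fibre M).

Let s : {poly K} := 'X - 1.

Lemma Xs : 'X = s + 1 :> {poly K}. Proof. by rewrite subrK. Qed.

Lemma sderiv k : s * (s ^+ k)^`() = k%:R *: s ^+ k.
Proof.
rewrite deriv_exp derivB derivX derivC subr0 mulrnAr mul1r scaler_nat.
by case: k => [|k]; rewrite ?mulr0n // -exprS.
Qed.

Lemma derivsS k : (s ^+ k.+1)^`() = k.+1%:R *: s ^+ k.
Proof. by rewrite deriv_exp derivB derivX derivC subr0 mul1r scaler_nat. Qed.

Lemma root_s p : root (s * p) 1.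
Proof. by rewrite rootM rootE !hornerE subrr eqxx. Qed.

Lemma root_sX k : root (s ^+ k.+1) 1.
Proof. by rewrite exprS root_s. Qed.

Hypothesis H : cuspidal_at M lam.
Let AL : is_AL_module M := gen_AL H.

Lemma stab_Ws m k : stab M (Wl m (s ^+ k.+1)).
Proof. exact/(stab_Wl AL)/root_sX. Qed.

(** * High powers of s act by zero *)

Lemma qact_br0 f h : f \in lie_par (Ltilde S) false -> stab M f -> stab M h ->
  (forall q, qact f q = 0) -> forall q, qact (lie_br f h) q = 0.
Proof.
move=> fe fs hs f0 q; rewrite -(qact_br_even q fe fs hs) !f0.
by rewrite (lin0 (qact_linear hs)) subrr.
Qed.

Lemma qactZ a f q : qact (a *: f) q = a *: qact f q.
Proof. exact: linZ (qact_linl q) _ _. Qed.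
Lemma qactD f h q : qact (f + h) q = qact f q + qact h q.
Proof. exact: linD (qact_linl q) _ _. Qed.
Lemma qactB f h q : qact (f - h) q = qact f q - qact h q.
Proof. by rewrite qactD -scaleN1r qactZ scaleN1r. Qed.
Lemma qact0 q : qact 0 q = 0.
Proof. exact: lin0 (qact_linl q). Qed.

(** The index -1 is chosen because [Wl (- 1) p] is the field p d/dt. *)
Lemma Wl_Ws_m1 k : lie_br (Wl (- 1) s) (Wl (- 1) (s ^+ k)) =
  (k%:R - 1) *: Wl (- 1) (s ^+ k).
Proof.
rewrite Wl_Wl subrr scale0r add0r Wl_XM -(linZ (Wl_linear _ _)) sderiv.
congr (Wl _ _); rewrite derivB derivX derivC subr0 mulr1.
by rewrite scalerBl scale1r.
Qed.

Lemma Ws_eventually_m1 : exists k0, forall k q, (k0 <= k)%N ->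
  qact (Wl (- 1) (s ^+ k)) q = 0.
Proof.
have s1 : stab M (Wl (- 1) s) by have := @stab_Ws (- 1) 0; rewrite expr1.
(* The power is shifted by one: s^(k+1) d/dt vanishes at 1 and has eigenvalue exactly k. *)
have [|k|k q|k0 hk] := @ad_eigenvector_eventually_0 _ _ (fibre_fin_dim H)
  (qact (Wl (- 1) s)) (fun k => qact (Wl (- 1) (s ^+ k.+1))).
- exact: qact_linear s1.
- exact/qact_linear/stab_Ws.
- rewrite (qact_br_even q (Wl_par _ _ _) s1 (@stab_Ws (- 1) k)).
  by rewrite Wl_Ws_m1 qactZ -natr1 addrK.
by exists k0.+1 => -[|k] q // kk; apply: hk.
Qed.

(* Bracketing with Wl m2 s for m1 = -1 and m1 = 0, where m1 + m2 = m, and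
   subtracting gives 2 Wl m s^(k+1); this reaches the negative m. *)
Lemma Ws_eventually : exists k0, forall k m q, (k0 <= k)%N ->
  qact (Wl m (s ^+ k)) q = 0.
Proof.
have [k0 hk] := Ws_eventually_m1; exists k0.+2 => -[|[|k]] m q // kk.
have k0k : (k0 <= k.+1)%N by lia.
have br m1 m2 : (forall q, qact (Wl m1 (s ^+ k.+1)) q = 0) ->
    qact (Wl (m1 + m2) ((m2 - m1)%:~R *: s ^+ k.+2 - k%:R *: ('X * s ^+ k.+1))) q = 0.
  move=> m10; have s1 : stab M (Wl m2 s) by have := @stab_Ws m2 0; rewrite expr1.
  rewrite -(qact_br0 (Wl_par _ _ _) (@stab_Ws m1 k) s1 m10 q) Wl_Wl -exprSr.
  congr (qact (Wl _ _) q); rewrite derivB derivX derivC subr0 mulr1 sderiv.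
  by rewrite -!mul_polyC -natr1; ring.
have h1 := br (- 1) (m + 1) (hk k.+1 ^~ k0k).
have h2 : qact (Wl (0 + m) ((m - 0)%:~R *: s ^+ k.+2 - k%:R *: ('X * s ^+ k.+1))) q = 0.
  apply: br => q'; rewrite -[Wl 0]/(Wl (- 1 + 1)) -Wl_XM Xs mulrDl mul1r -exprS.
  by rewrite (linD (Wl_linear _ _)) qactD !hk ?addr0 // leqW.
have : qact (Wl m (2%:R *: s ^+ k.+2)) q = 0.
  have -> : Wl m (2%:R *: s ^+ k.+2) =
      - 1 *: Wl (0 + m) ((m - 0)%:~R *: s ^+ k.+2 - k%:R *: ('X * s ^+ k.+1)) +
      Wl (- 1 + (m + 1)) ((m + 1 - -1)%:~R *: s ^+ k.+2 - k%:R *: ('X * s ^+ k.+1)).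
    rewrite (_ : - 1 + (m + 1) = 0 + m); last by lia.
    rewrite -(Wl_linear S) add0r; congr (Wl _ _).
    by rewrite subr0 opprK !intrD; rewrite -!mul_polyC; ring.
  by rewrite (qact_linl q) h1 h2 scaler0 addr0.
rewrite (linZ (Wl_linear _ _)) qactZ => /eqP; rewrite scaler_eq0 pnatr_eq0 /=.
by move/eqP.
Qed.

(** As 1 is not an eigenvalue of d, the map 1 - d is injective, hence bijective; it commutes with
    sigma, so the preimage lies in the same eigenspace. *)
Lemma der1_surj k y : y \in eig S k -> exists2 x, x \in eig S k & y = x - d x.
Proof.
have fl : linear (fun x : g => x - d x).
  by move=> a u v; rewrite der_linear; vector_ring.
have f0 x : x - d x = 0 -> x = 0.
  by move=> /eqP; rewrite subr_eq0 => /eqP e; apply: dder_eig; rewrite scale1r.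
move=> /subspace_ofP yk; have [x e] := linear_inj_surj (dg_fin_dim S) fl f0 y.
exists x => //; apply/subspace_ofP; apply/eqP; rewrite -subr_eq0; apply/eqP/f0.
rewrite (linD (der_linear d)) (linN (der_linear d)) (linZ (der_linear d)) -sg_dder.
move: yk; rewrite e (linD (aut_linear _)) (linN (aut_linear _)) => /eqP.
rewrite -subr_eq0 => /eqP yk; rewrite -[RHS]yk; vector_ring.
Qed.

Lemma eig_nk k x i : x \in eig S k -> x \in eig S (n%:Z * i + k).
Proof. by apply: eig_shift; rewrite dvdz_mulr. Qed.

Lemma Xs_eventually : exists k0, forall j k x q, (k0 <= j)%N -> x \in eig S k ->
  qact (Xl k x (s ^+ j)) q = 0.
Proof.
have [k0 hk] := Ws_eventually; exists k0.+1 => -[|j] // k y q kj /der1_surj[x xk ->].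
have kj' : (k0 <= j.+1)%N by exact: leqW.
have h1 := qact_br0 (Wl_par _ _ _) (@stab_Ws (- 1) j)
  (@stab_Xl _ _ M k x s) (hk _ _ ^~ kj') q.
have h2 := qact_br0 (Wl_par _ _ _) (@stab_Ws (- 1) j.+1)
  (@stab_Xl _ _ M k x 1) (hk _ _ ^~ (leqW kj')) q.
rewrite (Wl_Xl _ _ _ xk) in h1; rewrite (Wl_Xl _ _ _ xk) in h2.
(* Brackets with [Wl (- 1)] lower the index by n, which a factor t compensates. *)
have e : Xl k (x - d x) (s ^+ j.+1) = Xl (n%:Z * - 1 + k) (x - d x) ('X * s ^+ j.+1).
  by rewrite Xl_XM; congr (Xl _ _ _); lia.
rewrite {}e -[RHS](scaler0 _ (- 1)) -[RHS]addr0 -{1}h2 -h1 -(qact_linl q).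
congr (qact _ q); rewrite scalerDr addrACA -!Xl_linear.
rewrite (linD (Xl_linearx _ _)) (linN (Xl_linearx _ _)) -(linN (Xl_linear _ _)).
rewrite !derivsS derivB derivX derivC subr0.
congr (Xl _ _ _ + Xl _ _ _); last rewrite -[j.+2%:R]natr1.
  by rewrite -!mul_polyC !exprS; ring.
by rewrite -!mul_polyC !exprS; ring.
Qed.

Lemma eig_parity k x : x \in eig S k -> exists x0 x1,
  [/\ x0 \in eig S k, x1 \in eig S k, x0 \in lie_par g false,
      x1 \in lie_par g true & x = x0 + x1].
Proof.
move=> /subspace_ofP xk; have [x0 [x1 [P0 P1 e]]] := (lie_decomp g).1 x.
have [e0 e1] : sg S x0 = w ^ k *: x0 /\ sg S x1 = w ^ k *: x1.
  apply: (super_decomp_uniq (lie_decomp g)); rewrite ?aut_even ?rpredZ //.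
  by rewrite -(linD (aut_linear _)) -scalerDr -e.
by exists x0, x1; split=> //; apply/subspace_ofP.
Qed.

Lemma Xl_s k x h q :
  qact (Xl (k + n%:Z) x h) q = qact (Xl k x h) q + qact (Xl k x (s * h)) q.
Proof. by rewrite -qactD -(linD (Xl_linear _ _)) -Xl_XM Xs mulrDl mul1r addrC. Qed.

Lemma Wl_s m h q : qact (Wl (m + 1) h) q = qact (Wl m h) q + qact (Wl m (s * h)) q.
Proof. by rewrite -qactD -(linD (Wl_linear _ _)) -Wl_XM Xs mulrDl mul1r addrC. Qed.

(** Since t = s + 1, multiplication by t changes the operator only by a multiple of s, which
    vanishes on [q]. *)
Lemma Xl_periodic k x h q : (forall i, qact (Xl (k + n%:Z * i) x (s * h)) q = 0) ->
  forall i, qact (Xl (n%:Z * i + k) x h) q = qact (Xl k x h) q.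
Proof.
move=> h0; elim/int_rec => [|i IH|i IH]; first by rewrite mulr0 add0r.
  rewrite (_ : _ + k = k + n%:Z * i%:Z + n%:Z); last lia.
  by rewrite Xl_s h0 addr0 addrC.
rewrite -IH (_ : n%:Z * - i%:Z + k = k + n%:Z * - i.+1%:Z + n%:Z); last lia.
by rewrite Xl_s h0 addr0 addrC.
Qed.

Lemma Wl_periodic m h q : (forall i, qact (Wl i (s * h)) q = 0) ->
  forall i, qact (Wl (i + m) h) q = qact (Wl m h) q.
Proof.
move=> h0; elim/int_rec => [|i IH|i IH]; first by rewrite add0r.
  by rewrite (_ : _ + m = i%:Z + m + 1) ?Wl_s ?h0 ?addr0 //; lia.
by rewrite -IH (_ : - i%:Z + m = - i.+1%:Z + m + 1) ?Wl_s ?h0 ?addr0 //; lia.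
Qed.

(** * Descending induction on the power of s *)

Definition killX r := forall j k x q, (r <= j)%N -> x \in eig S k ->
  qact (Xl k x (s ^+ j)) q = 0.
Definition killW r := forall j m q, (r <= j)%N -> qact (Wl m (s ^+ j)) q = 0.

Lemma Wl_Xl_s m j k x l : x \in eig S k ->
  lie_br (Wl m (s ^+ j)) (Xl k x (s ^+ l)) =
  Xl (n%:Z * m + k) x (expo S k *: s ^+ (j + l) + 'X * (s ^+ j * (s ^+ l)^`())) +
  Xl (n%:Z * m + k) (d x) (m%:~R *: s ^+ (j + l) + 'X * ((s ^+ j)^`() * s ^+ l)).
Proof. by move=> xk; rewrite Wl_Xl // -exprD. Qed.

(** Brackets with s^j d/dt have this shape: the term in s^i is killed, and the factor t brings the
    other one back to index k. *)
Lemma killX_reduce r i k y a b l q : killX r -> (r <= i)%N -> y \in eig S k ->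
  qact (Xl (n%:Z * - 1 + k) y (a *: s ^+ i + b *: ('X * s ^+ l))) q =
  b *: qact (Xl k y (s ^+ l)) q.
Proof.
move=> Z ri yk; rewrite Xl_linear (linZ (Xl_linear _ _)) qactD !qactZ.
rewrite Z ?eig_nk // scaler0 add0r Xl_XM; congr (_ *: qact (Xl _ _ _) _); lia.
Qed.

(* With E = s d/dt, A = s^2 d/dt, B = x s^r and C = x s^(r+1), the relations
   [E, C] = ((r+1) x + d x) s^(r+1) and [A, B] = (r x + 2 d x) s^(r+1) give
   (r+2) C = 2 [E, C] - [A, B]. *)
Lemma nilpotent_Xs r k x : killX r.+2 -> x \in eig S k ->
  exists e, forall q, iter e (qact (Xl k x (s ^+ r.+1))) q = 0.
Proof.
move=> Z xk; have dxk := eig_der xk.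
pose c : K := r.+2%:R^-1.
pose E : V -> V := qact (Wl (- 1) (s ^+ 1)); pose A : V -> V := qact (Wl (- 1) (s ^+ 2)).
pose B : V -> V := qact (Xl k x (s ^+ r)); pose C : V -> V := qact (Xl k x (s ^+ r.+1)).
have El : linear E by exact/qact_linear/stab_Ws.
have Al : linear A by exact/qact_linear/stab_Ws.
have Bl : linear B by exact/qact_linear/stab_Xl.
have Cl : linear C by exact/qact_linear/stab_Xl.
have EC q : E (C q) - C (E q) = r.+1%:R *: C q + qact (Xl k (d x) (s ^+ r.+1)) q.
  rewrite qact_br_even ?Wl_par //; [|exact: stab_Ws|exact: stab_Xl].
  have e1 : 'X * (s ^+ 1 * (s ^+ r.+1)^`()) = r.+1%:R *: ('X * s ^+ r.+1) :> {poly K}.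
    by rewrite expr1 sderiv -scalerAr.
  have e2 : 'X * ((s ^+ 1)^`() * s ^+ r.+1) = 1 *: ('X * s ^+ r.+1) :> {poly K}.
    by rewrite expr1 derivB derivX derivC subr0 mul1r scale1r.
  by rewrite Wl_Xl_s // e1 e2 qactD !(killX_reduce _ _ _ _ Z) ?scale1r.
have AB q : A (B q) - B (A q) = r%:R *: C q + 2%:R *: qact (Xl k (d x) (s ^+ r.+1)) q.
  rewrite qact_br_even ?Wl_par //; [|exact: stab_Ws|exact: stab_Xl].
  have e1 : 'X * (s ^+ 2 * (s ^+ r)^`()) = r%:R *: ('X * s ^+ r.+1) :> {poly K}.
    by rewrite exprS expr1 -mulrA sderiv -!scalerAr -exprS.
  have e2 : 'X * ((s ^+ 2)^`() * s ^+ r) = 2%:R *: ('X * s ^+ r.+1) :> {poly K}.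
    by rewrite derivsS expr1 -scalerAl -scalerAr -exprS.
  by rewrite Wl_Xl_s // e1 e2 qactD !(killX_reduce _ _ _ _ Z).
have AC q : A (C q) = C (A q).
  apply/eqP; rewrite -subr_eq0.
  rewrite qact_br_even ?Wl_par //; [|exact: stab_Ws|exact: stab_Xl].
  have e1 : 'X * (s ^+ 2 * (s ^+ r.+1)^`()) = r.+1%:R *: ('X * s ^+ r.+2) :> {poly K}.
    by rewrite exprS expr1 -mulrA sderiv -!scalerAr -exprS.
  have e2 : 'X * ((s ^+ 2)^`() * s ^+ r.+1) = 2%:R *: ('X * s ^+ r.+2) :> {poly K}.
    by rewrite derivsS expr1 -scalerAl -scalerAr -exprS.
  have r3 : (r.+2 <= 2 + r.+1)%N by lia.
  rewrite Wl_Xl_s // e1 e2 qactD !(killX_reduce _ _ _ _ Z r3) //.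
  by rewrite !Z // !scaler0 addr0.
apply: (@commutator_nilpotent _ _ (fibre_fin_dim H) (2%:R * c) C E
  (fun q => - c *: A q) B) => // [a u v|q|q].
- by rewrite Al; vector_ring.
- rewrite (linZ Bl) -scalerBr EC AB.
  transitivity ((c * r.+2%:R) *: C q); first by rewrite mulVf ?pnatr_eq0 ?scale1r.
  by rewrite -!natr1; vector_ring.
- by rewrite (linZ Cl) AC.
Qed.

(** [N] is the common kernel of the operators x s^(r+1) t^a. Restricting to homogeneous x makes them
    commute up to sign and makes [N] a super subspace. *)
Lemma killX_step r : killX r.+2 -> killX r.+1.
Proof.
move=> Z; pose N q := forall k (p : bool) x, x \in eig S k -> x \in lie_par g p ->
  qact (Xl k x (s ^+ r.+1)) q = 0.
have Nx k x q : N q -> x \in eig S k -> qact (Xl k x (s ^+ r.+1)) q = 0.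
  move=> Nq /eig_parity[x0 [x1 [X0 X1 P0 P1 ->]]].
  by rewrite (linD (Xl_linearx _ _)) qactD (Nq _ _ _ X0 P0) (Nq _ _ _ X1 P1) addr0.
suff NT q : N q.
  move=> j k x q; rewrite leq_eqVlt => /predU1P[<- xk|]; last exact: Z.
  exact: Nx (NT q) xk.
move: q; apply: (fibre_graded_simple H).
- have ql k x := qact_linear (@stab_Xl _ _ M k x (s ^+ r.+1)).
  split=> [k p x xk xp|a u v Nu Nv k p x xk xp]; first exact: lin0 (ql k x).
  by rewrite ql (Nu _ _ _ xk xp) (Nv _ _ _ xk xp) scaler0 addr0.
- move=> q Nq; have [q0 [q1 [Q0 Q1 e]]] := (fibre_decomp M).1 q.
  have h k (p : bool) x : x \in eig S k -> x \in lie_par g p ->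
      qact (Xl k x (s ^+ r.+1)) q0 = 0 /\ qact (Xl k x (s ^+ r.+1)) q1 = 0.
    move=> xk xp; have := Nq _ _ _ xk xp.
    have sX := @stab_Xl _ _ M k x (s ^+ r.+1).
    have P0 := qact_par (Xl_par k (s ^+ r.+1) xp) sX Q0.
    have P1 := qact_par (Xl_par k (s ^+ r.+1) xp) sX Q1.
    rewrite e (linD (qact_linear sX)); rewrite -[0 in X in X -> _]addr0.
    have uniq0 := super_decomp_uniq (fibre_decomp M).
    (* For odd x the images of [q0] and [q1] have exchanged parities, so the summands are
       swapped. *)
    case: p xp P0 P1 => /= _ P0 P1 e'; last exact: uniq0 P0 P1 (rpred0 _) (rpred0 _) e'.
    rewrite addrC in e'.
    by have [-> ->] := uniq0 _ _ _ _ P1 P0 (rpred0 _) (rpred0 _) e'.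
  by exists q0, q1; split=> // k p x xk xp; have [] := h k p x xk xp.
- move=> q Nq k p x xk xp; have := twist_Xl H k x (s ^+ r.+1) q.
  rewrite (Nq _ _ _ xk xp) (lin0 (twist_linear H)) => /esym/eqP.
  by rewrite scaler_eq0 expfz_eq0 (negPf (omega_neq0 _ _)) andbF => /eqP.
- move=> i q Nq k p x xk xp; have fs := stab_ellB AL i 0.
  have fe : ell S i - ell S 0 \in lie_par (Ltilde S) false.
    by rewrite -scaleN1r rpredD ?rpredZ ?ell_par.
  have := qact_br_even q fe fs (@stab_Xl _ _ M k x (s ^+ r.+1)).
  set u := qact (ell S i - _) q.
  rewrite (Nq _ _ _ xk xp) (lin0 (qact_linear fs)) sub0r => e.
  apply/eqP; rewrite -oppr_eq0 e {u e}.
  rewrite (linD (lie_linl _)) (linN (lie_linl _)) -!Wl_1 !Wl_Xl // mulr0 add0r.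
  rewrite !mul1r derivC !mul0r mulr0 !addr0 scale0r (lin0 (Xl_linear _ _)) addr0.
  rewrite !(linD (Xl_linear _ _)) !(linZ (Xl_linear _ _)).
  rewrite qactB !qactD !qactZ !(Nx _ _ q Nq) ?eig_nk ?eig_der // !scaler0 !add0r addr0.
  (* Differentiation leaves s^r, one power short, but the terms from l_i and l_0 differ by a
     multiple of s^(r+1), which kills [q]. *)
  rewrite Xl_periodic ?subrr // => j.
  rewrite mulrCA sderiv -scalerAr (linZ (Xl_linear _ _)) qactZ Xl_XM Nx ?scaler0 //.
  by rewrite (_ : _ + n%:Z = n%:Z * (j + 1) + k) ?eig_nk //; lia.
- move=> j y q yj Nq k p x xk xp.
  have [y0 [y1 [Y0 Y1 P0 P1 ->]]] := eig_parity yj.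
  have key p' z : z \in eig S j -> z \in lie_par g p' ->
      qact (Xl k x (s ^+ r.+1)) (qact (XT j z) q) = 0.
    move=> zj zp; have sz : stab M (XT j z) by exact: stab_XT.
    have := qact_br q (Xl_par k (s ^+ r.+1) xp) (XT_par j zp) (@stab_Xl _ _ M k x _) sz.
    rewrite (Nq _ _ _ xk xp) (lin0 (qact_linear sz)) scaler0 subr0 => ->.
    by rewrite -Xl_1 Xl_Xl // mulr1 Nx // eig_br.
  rewrite (linD (XT_linear j)) qactD (linD (qact_linear (@stab_Xl _ _ M k x _))).
  by rewrite (key _ _ Y0 P0) (key _ _ Y1 P1) addr0.
- have [|||q q0 hq] := @common_kernel _ V (fun X => exists k (p : bool) x,
    [/\ x \in eig S k, x \in lie_par g p & X = qact (Xl k x (s ^+ r.+1))])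
    (fibre_fin_dim H) (fibre_neq0 H).
  + by move=> _ [k [p [x [_ _ ->]]]]; exact/qact_linear/stab_Xl.
  + by move=> _ [k [p [x [xk _ ->]]]]; exact: nilpotent_Xs.
  + move=> _ _ [k [p [x [xk xp ->]]]] [j [p' [y [yj yp ->]]]].
    exists ((-1) ^+ (p && p')) => q; apply/eqP; rewrite -subr_eq0.
    rewrite (qact_br q (Xl_par k _ xp) (Xl_par j _ yp)); [|exact: stab_Xl|exact: stab_Xl].
    (* The bracket carries s^(2r+2), and 2r + 2 >= r + 2. *)
    by rewrite Xl_Xl // -exprD Z ?eig_br //; lia.
  exists q => // k p x xk xp; apply: hq; by exists k, p, x.
Qed.

(** As s^(r+3) W acts by 0, all fields s^(r+2) t^a d/dt act as one operator C. It is nilpotent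
    because [s d/dt, C] = (r+1) C with r + 1 nonzero. [killX r.+1] makes its kernel stable under
    g. *)
Lemma killW_step r : killX r.+1 -> killW r.+3 -> killW r.+2.
Proof.
move=> ZX Z; pose N q := forall m, qact (Wl m (s ^+ r.+2)) q = 0.
suff NT q : N q.
  by move=> j m q; rewrite leq_eqVlt => /predU1P[<-|]; [exact: NT | exact: Z].
have all_eq m q' : qact (Wl m (s ^+ r.+2)) q' = qact (Wl (- 1) (s ^+ r.+2)) q'.
  rewrite -(@Wl_periodic (- 1) _ _ _ (m + 1)) ?addrK // => i.
  by rewrite -exprS Z.
have ql m := qact_linear (@stab_Ws m r.+1).
move: q; apply: (fibre_graded_simple H).
- split=> [m|a u v Nu Nv m]; first exact: lin0 (ql m).
  by rewrite ql Nu Nv scaler0 addr0.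
- move=> q Nq; have [q0 [q1 [Q0 Q1 e]]] := (fibre_decomp M).1 q.
  have h m : qact (Wl m (s ^+ r.+2)) q0 = 0 /\ qact (Wl m (s ^+ r.+2)) q1 = 0.
    have := Nq m; have sW := @stab_Ws m r.+1.
    have P0 := qact_par (Wl_par S m (s ^+ r.+2)) sW Q0.
    have P1 := qact_par (Wl_par S m (s ^+ r.+2)) sW Q1.
    rewrite e (linD (qact_linear sW)); rewrite -[0 in X in X -> _]addr0.
    exact: super_decomp_uniq (fibre_decomp M) P0 P1 (rpred0 _) (rpred0 _).
  by exists q0, q1; split=> // m; have [] := h m.
- move=> q Nq m; rewrite -(twist_Wl H) ?root_sX // Nq; exact: lin0 (twist_linear H).
- move=> i q Nq m; have fs := stab_ellB AL i 0; have sW := @stab_Ws m r.+1.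
  have fe : ell S i - ell S 0 \in lie_par (Ltilde S) false.
    by rewrite -scaleN1r rpredD ?rpredZ ?ell_par.
  have := qact_br_even q fe fs sW; set u := qact (ell S i - _) q.
  rewrite Nq (lin0 (qact_linear fs)) sub0r => e.
  apply/eqP; rewrite -oppr_eq0 e {u e}.
  rewrite (linD (lie_linl _)) (linN (lie_linl _)) -!Wl_1 !Wl_Wl add0r.
  rewrite !mul1r derivC !mulr0 !subr0.
  rewrite !(linD (Wl_linear _ _)) !(linZ (Wl_linear _ _)).
  rewrite qactB !qactD !qactZ !Nq !scaler0 !add0r.
  rewrite Wl_periodic ?subrr // => j.
  by rewrite mulrCA sderiv -scalerAr (linZ (Wl_linear _ _)) qactZ Wl_XM Nq scaler0.
- move=> k x q xk Nq m; have sW := @stab_Ws m r.+1.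
  have := qact_br_even q (Wl_par S m (s ^+ r.+2)) sW (@stab_XT _ _ M k x).
  rewrite Nq (lin0 (qact_linear (@stab_XT _ _ M k x))) subr0 => ->.
  rewrite -Xl_1 Wl_Xl // derivC !mulr1 mulr0 mulr0 addr0.
  rewrite derivsS -scalerAr !(linD (Xl_linear _ _)) !(linZ (Xl_linear _ _)).
  rewrite !qactD !qactZ Xl_XM !ZX ?scaler0 ?addr0 ?eig_nk ?eig_der //.
  by rewrite (_ : _ + n%:Z = n%:Z * (m + 1) + k) ?eig_nk ?eig_der //; lia.
- have [|||q q0 hq] := @common_kernel _ V
    (fun X => X = qact (Wl (- 1) (s ^+ r.+2))) (fibre_fin_dim H) (fibre_neq0 H).
  + by move=> _ ->.
  + move=> _ ->; apply: (@commutator_nilpotent _ _ (fibre_fin_dim H) r.+1%:R^-1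
      _ (qact (Wl (- 1) (s ^+ 1))) (fun=> 0) id) => //.
    * exact/qact_linear/stab_Ws.
    * by move=> a u v; rewrite scaler0 addr0.
    * move=> q; rewrite subrr addr0.
      rewrite (qact_br_even q (Wl_par _ _ _) (@stab_Ws _ 0) (@stab_Ws _ r.+1)).
      rewrite expr1 Wl_Ws_m1 qactZ -[r.+2%:R]natr1 addrK scalerA mulVf ?scale1r //.
      by rewrite pnatr_eq0.
    * by move=> q; rewrite (lin0 (ql _)).
  + by move=> _ _ -> ->; exists 1 => q; rewrite scale1r.
  exists q => // m; rewrite all_eq; exact: hq.
Qed.

Lemma killX1 : killX 1.
Proof.
have [k0 hk] := Xs_eventually.
have : killX k0.+1 by move=> j k x q kj; apply: hk; exact: ltnW.
by elim: k0 {hk} => // k0 IH /killX_step.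
Qed.

Lemma killW2 : killW 2.
Proof.
have [k0 hk] := Ws_eventually.
have : killW k0.+2 by move=> j m q kj; apply: hk; lia.
elim: k0 {hk} => // k0 IH Z; apply/IH/killW_step => // j k x q kj.
by apply: killX1; lia.
Qed.

Lemma qact_XT_mod j k x q : (n %| j - k)%Z -> x \in eig S k ->
  qact (XT j x) q = qact (XT k x) q.
Proof.
move=> /dvdzP[i e] xk; rewrite -!Xl_1 (_ : j = n%:Z * i + k); last lia.
apply: Xl_periodic => l; rewrite mulr1 -[s]expr1 killX1 //.
by rewrite addrC eig_nk.
Qed.

(** Each l_(m+1) - l_m is s t^(m+1) d/dt, whose action does not depend on m because s^2 W acts by 0;
    the sum telescopes. *)
Lemma qact_ell i q :
  qact (ell S i - ell S 0) q = i%:~R *: qact (ell S 1 - ell S 0) q.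
Proof.
have step m : qact (ell S (m + 1) - ell S m) q = qact (ell S 1 - ell S 0) q.
  have e j : ell S (j + 1) - ell S j = Wl j s.
    rewrite (linD (Wl_linear S j)) (linN (Wl_linear S j)) Wl_1.
    by rewrite -['X]mulr1 Wl_XM Wl_1.
  rewrite e -[1 in RHS]add0r e -[m]addr0.
  by apply: Wl_periodic => j; rewrite -expr2 killW2.
elim/int_rec: i => [|i IH|i IH].
- by rewrite subrr qact0 scale0r.
- have -> : ell S i.+1 - ell S 0 = (ell S (i%:Z + 1) - ell S i) + (ell S i - ell S 0).
    by rewrite addrA subrK -addn1 PoszD.
  by rewrite qactD IH step -add1n PoszD intrD scalerDl scale1r.
- have -> : ell S (- i.+1%:Z) - ell S 0 =
      - (ell S (- i.+1%:Z + 1) - ell S (- i.+1%:Z)) + (ell S (- i%:Z) - ell S 0).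
    rewrite (_ : - i.+1%:Z + 1 = - i%:Z); last lia.
    by rewrite opprB addrA subrK.
  rewrite [LHS]qactD IH -scaleN1r qactZ step -scalerDl; congr (_ *: _).
  by rewrite (_ : - i.+1%:Z = - 1 - i%:Z) ?intrD //; lia.
Qed.
End Reduction.

(** * Morphisms, quotients and sub-quotients *)

Section Morphisms.
Variables (K : fieldType) (L : lieSuper K).
Implicit Types M : supermod L.

Definition morphism_of M M' (f : M -> M') :=
  [/\ linear f, forall p v, v \in mod_par M p -> f v \in mod_par M' p
    & forall x v, f (act x v) = act x (f v)].

Lemma preim_submodule M M' (f : M -> M') (N' : submodule M') : morphism_of f ->
  exists N : submodule M, forall v, v \in N <-> f v \in N'.
Proof.
move=> [fl fp fa].
have cl : lin_closed (fun v => f v \in N').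
  by split=> [|a u v Nu Nv]; rewrite ?(lin0 fl) ?rpred0 // fl rpredD ?rpredZ.
have sup : is_super_subspace (@mod_par _ _ M) (subspace_of cl).
  move=> v /subspace_ofP /submod_super[w0 [w1 [N0 N1 W0 W1]]].
  have [v0 [v1 [P0 P1 ->]]] := (mod_decomp M).1 v; rewrite (linD fl) => e.
  have [e0 e1] := super_decomp_uniq (mod_decomp M') (fp _ _ P0) (fp _ _ P1) W0 W1 e.
  by exists v0, v1; split=> //; apply/subspace_ofP; rewrite ?e0 ?e1.
have st x v : v \in subspace_of cl -> act x v \in subspace_of cl.
  by move=> /subspace_ofP fv; apply/subspace_ofP; rewrite fa; exact: submod_act.
by exists (Submodule sup st) => v; split=> [/subspace_ofP //|?]; apply/subspace_ofP.
Qed.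

Lemma zero_closed M : lin_closed (fun v : M => v = 0).
Proof. by split=> // a u v -> ->; rewrite scaler0 addr0. Qed.

Lemma zero_super M : is_super_subspace (@mod_par _ _ M) (subspace_of (zero_closed M)).
Proof.
move=> v /subspace_ofP ->; exists 0, 0.
by split; rewrite ?rpred0 ?addr0 //; apply/subspace_ofP.
Qed.

Lemma zero_act M x v :
  v \in subspace_of (zero_closed M) -> act x v \in subspace_of (zero_closed M).
Proof. by move=> /subspace_ofP ->; apply/subspace_ofP; exact: lin0 (act_linr _). Qed.

Definition zero_submodule M := Submodule (@zero_super M) (@zero_act M).

Lemma zero_submoduleP M (v : M) : v \in zero_submodule M <-> v = 0.
Proof. by split=> [/subspace_ofP|?] //; apply/subspace_ofP. Qed.

Lemma simple_inj M M' (f : M -> M') : simple M -> morphism_of f ->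
  (exists v, f v != 0) -> injective f.
Proof.
move=> [_ Ms] fm [v fv]; have [fl _ _] := fm.
have [N NP] := preim_submodule (zero_submodule M') fm.
case: (Ms N) => [N0|NT]; last first.
  by case/eqP: fv; apply/zero_submoduleP/NP.
move=> u u' e; apply/eqP; rewrite -subr_eq0; apply/eqP/N0/NP/zero_submoduleP.
by rewrite (linD fl) (linN fl) e subrr.
Qed.

Lemma proj_morphism M (N : submodule M) :
  morphism_of (Defs.proj N : M -> quot_mod N).
Proof.
split=> [|p v vp|x v]; first exact: proj_linear.
  by apply/subspace_ofP; exists v.
by rewrite [RHS]quot_actE.
Qed.

Lemma simple_iso M M' : simple M -> mod_iso M M' -> simple M'.
Proof.
move=> [[v v0] Ms] [f [fl [h fK hK] fp fa]]; split.
  by exists (f v); apply: contraNneq v0 => fv; rewrite -[v]fK fv -(lin0 fl) fK.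
move=> N'; have [|N NP] := @preim_submodule _ _ f N'; first by [].
case: (Ms N) => [N0|NT]; [left|right] => u; rewrite -[u]hK.
  by move=> /NP/N0 ->; rewrite (lin0 fl).
exact/NP/NT.
Qed.

Lemma inj_surj_bij (A B : Type) (f : A -> B) :
  injective f -> (forall b, exists a, b = f a) -> bijective f.
Proof.
move=> fi /choice[h hf]; exists h => [a|b]; last by rewrite -hf.
by apply: fi; rewrite -hf.
Qed.

(** The sub-quotient is the image of [f] modulo its zero submodule. *)
Lemma iso_simple_subquotient_inj M M' (f : M -> M') : simple M ->
  morphism_of f -> injective f -> iso_simple_subquotient M M'.
Proof.
move=> Ms [fl fp fa] fi.
have cl : lin_closed (fun v' => exists v, v' = f v).
  split=> [|a _ _ [u ->] [v ->]]; first by exists 0; rewrite (lin0 fl).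
  by exists (a *: u + v); rewrite fl.
have sup : is_super_subspace (@mod_par _ _ M') (subspace_of cl).
  move=> _ /subspace_ofP[v ->]; have [v0 [v1 [P0 P1 ->]]] := (mod_decomp M).1 v.
  exists (f v0), (f v1); split; rewrite ?fp ?(linD fl) //; apply/subspace_ofP.
    by exists v0.
  by exists v1.
have st x v : v \in subspace_of cl -> act x v \in subspace_of cl.
  by move=> /subspace_ofP[u ->]; apply/subspace_ofP; exists (act x u); rewrite fa.
pose N := Submodule sup st; pose N' := zero_submodule (sub_mod N).
have fN v : f v \in N by apply/subspace_ofP; exists v.
pose F (v : M) : sub_mod N := SubspaceElt (fN v).
have iso : mod_iso M (quot_mod N').
  exists (fun v => Defs.proj N' (F v)); split.
  - move=> a u v; rewrite -proj_linear; congr (Defs.proj _ _).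
    by apply: val_inj; rewrite /= fl.
  - apply: inj_surj_bij => [u v /proj_eq/zero_submoduleP /eqP|q].
      by rewrite subr_eq0 => /eqP /(congr1 (@sub_val _ _ _)) /= /fi.
    rewrite -[q]proj_repr; set r := repr _.
    have /subspace_ofP[v e] := sub_valP (r : sub_mod N).
    by exists v; congr (Defs.proj _ _); apply: val_inj.
  - move=> p v vp; apply/subspace_ofP; exists (F v) => //.
    by apply/subspace_ofP; exact: fp.
  - move=> x v; rewrite [RHS]quot_actE; congr (Defs.proj _ _).
    by apply: val_inj; rewrite /= fa.
by exists N, N'; split=> //; exact: simple_iso iso.
Qed.

(** The quotient by a maximal proper submodule; the zero submodule shows that proper ones exist. *)
Lemma simple_quotient M : fin_dim M -> (exists v : M, v != 0) ->
  exists N : submodule M, simple (quot_mod N).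
Proof.
move=> Mf [v0 v00].
pose F (P : M -> Prop) := (exists N : submodule M, forall v, P v <-> v \in N) /\
  exists v, ~ P v.
have [||P [[N PN] [v Pv]] Pmax] := max_subspace (F := F) Mf.
- move=> P [[N PN] _]; have [N0 ND] := lin_closed_mem N.
  split=> [|a u v Pu Pv]; first exact/PN.
  by apply/PN/ND; exact/PN.
- exists (fun v => v = 0); split; last by exists v0; exact/eqP.
  by exists (zero_submodule M) => u; rewrite zero_submoduleP.
exists N; split.
  exists (Defs.proj N v); apply: contra_notN Pv => /eqP.
  by rewrite -(proj0 N) => /proj_eq; rewrite subr0 => /PN.
move=> N2; have [N1 N1P] := preim_submodule N2 (proj_morphism N).
have NN1 u : P u -> u \in N1.
  move=> /PN uN; apply/N1P; rewrite (_ : Defs.proj N u = 0) ?rpred0 //.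
  by rewrite -(proj0 N); apply/proj_eq; rewrite subr0.
have [N1T|[u N1u]] : (forall u, u \in N1) \/ exists u, ~ u \in N1.
  by case: (pselect (exists u, ~ u \in N1)) => [|h]; [right | left => u;
    apply: contrapT => hu; apply: h; exists u].
  right=> q; rewrite -[q]proj_repr; exact/N1P/N1T.
left=> q; rewrite -[q]proj_repr; set r := repr _ => /N1P rN1.
have : P r by apply: (Pmax (fun u => u \in N1)) => //; split; [exists N1 | exists u].
by move=> /PN rN; rewrite -(proj0 N); apply/proj_eq; rewrite subr0.
Qed.
End Morphisms.

(** * The fibre as a graded module and its loop module *)

Section FibreModule.
Variables (R : realType) (S : setting R) (M : supermod (Ltilde S)).
Variable lam : R[i].
Hypothesis H : cuspidal_at M lam.
Local Notation K := R[i].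
Local Notation g := (dg S).
Local Notation d := (dder S).
Local Notation n := (ord S).
Local Notation w := (omega R n).
Local Notation V := (fibre M).
Local Notation weight_at := (weight_at M lam).
Implicit Types (q : fibre M) (x y : g).
Let AL : is_AL_module M := gen_AL H.

(** The operator of the derivation: l_1 - l_0 = s t d/dt, which is s d/dt up to s^2 d/dt. *)
Definition dact : V -> V := qact (ell S 1 - ell S 0).
(** [XT k] projects x to [eig k], so each eigencomponent of x acts with the exponent k/n in [0,
    1). *)
Definition xact x q : V := \sum_(k < n) qact (XT k x) q.

Lemma dact_linear : linear dact.
Proof. exact/qact_linear/stab_ellB. Qed.

Lemma xact_linear x : linear (xact x).
Proof.
move=> a q q'; rewrite /xact scaler_sumr -big_split; apply: eq_bigr => k _ /=.
exact/qact_linear/stab_XT.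
Qed.

Lemma xact_linl q : linear (xact^~ q).
Proof.
move=> a x y; rewrite /xact scaler_sumr -big_split; apply: eq_bigr => k _ /=.
by rewrite XT_linear; exact: qact_linl.
Qed.

Lemma xact_eig j x q : x \in eig S j -> xact x q = qact (XT j x) q.
Proof.
move=> xj; have xE : \sum_(k < n) eproj n (sg S) k x = x.
  by apply: sum_eproj; exact: ord_gt0.
rewrite -[in RHS]xE (lin_sum (XT_linear j)) (lin_sum (qact_linl q)).
apply: eq_bigr => k _; have /subspace_ofP xj' := xj.
have := eproj_of_eig (ord_gt0 S) (aut_linear (sg S)) k xj'.
case: ifP => [jk e|_ e]; rewrite e; last first.
  by rewrite -XT_eg e !(lin0 (XT_linear _)).
by rewrite (qact_XT_mod H q _ xj) // -opprB rpredN.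
Qed.

Lemma xact_par p r x q : x \in lie_par g p -> q \in fibre_par M r ->
  xact x q \in fibre_par M (p (+) r).
Proof.
move=> xp qr; apply: rpred_sum => k _.
by apply: qact_par qr; [exact: XT_par | exact: stab_XT].
Qed.

Lemma dact_par r q : q \in fibre_par M r -> dact q \in fibre_par M r.
Proof.
have fe : ell S 1 - ell S 0 \in lie_par (Ltilde S) false.
  by rewrite -scaleN1r rpredD ?rpredZ ?ell_par.
by move=> qr; apply: (qact_par fe _ qr); exact: stab_ellB.
Qed.

(** With the sign [c] fixed, the defect [D] is bilinear, so it is enough that it vanishes on
    eigencomponents, which keep the parities of x and y. *)
Lemma xact_br p r x y q : x \in lie_par g p -> y \in lie_par g r ->
  xact (lie_br x y) q = xact x (xact y q) - (-1) ^+ (p && r) *: xact y (xact x q).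
Proof.
move=> xp yr; set c := _ ^+ _.
pose D x y := xact x (xact y q) - c *: xact y (xact x q) - xact (lie_br x y) q.
have Dl y' : linear (D^~ y').
  move=> a u v; rewrite /D lie_linl !xact_linl xact_linear; vector_ring.
have Dr x' : linear (D x').
  move=> a u v; rewrite /D lie_linr !xact_linl xact_linear; vector_ring.
suff /eqP : D x y = 0 by rewrite subr_eq0 => /eqP.
have xE z : \sum_(k < n) eproj n (sg S) k z = z.
  by apply: sum_eproj; exact: ord_gt0.
rewrite -[x]xE (lin_sum (Dl _)) big1 // => j _.
rewrite -[y]xE (lin_sum (Dr _)) big1 // => k _.
set x' := eproj _ _ _ x; set y' := eproj _ _ _ y.
have [xj yk] : x' \in eig S j /\ y' \in eig S k by split; exact: eg_eig.
have [xp' yp'] : x' \in lie_par g p /\ y' \in lie_par g r by split; exact: eg_par.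
have br := qact_br q (XT_par j xp') (XT_par k yp')
  (@stab_XT _ _ M j x') (@stab_XT _ _ M k y').
rewrite /D (xact_eig _ yk) (xact_eig _ xj) (xact_eig _ yk) (xact_eig _ xj).
by rewrite br XT_XT // (xact_eig _ (eig_br xj yk)) subrr.
Qed.

(** For z in [eig k], the bracket of l_1 - l_0 with z t^(k/n) is ((k/n) z + d z) t^(1+k/n) - (k/n) z
    t^(k/n); modulo integral powers of t only d z remains. *)
Lemma xact_d x q : xact (d x) q = dact (xact x q) - xact x (dact q).
Proof.
pose D x := dact (xact x q) - xact x (dact q) - xact (d x) q.
have Dl : linear D.
  move=> a u v; rewrite /D (der_linear d) !xact_linl dact_linear; vector_ring.
suff /eqP : D x = 0 by rewrite subr_eq0 => /eqP.
have xE z : \sum_(k < n) eproj n (sg S) k z = z.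
  by apply: sum_eproj; exact: ord_gt0.
rewrite -[x]xE (lin_sum Dl) big1 // => k _; set z := eproj _ _ _ _.
have zk : z \in eig S k by exact: eg_eig.
clearbody z.
have fe : ell S 1 - ell S 0 \in lie_par (Ltilde S) false.
  by rewrite -scaleN1r rpredD ?rpredZ ?ell_par.
have := qact_br_even q fe (stab_ellB AL 1 0) (@stab_XT _ _ M k z).
rewrite (linD (lie_linl _)) (linN (lie_linl _)) !ell_XT // mulr0 add0r scale0r addr0.
rewrite scale1r => br; rewrite /D !(xact_eig _ zk) (xact_eig _ (eig_der zk)).
have ak : expo S k *: z + d z \in eig S k by rewrite rpredD ?rpredZ ?eig_der.
have nk : (n %| n%:Z * 1 + k%:Z - k%:Z)%Z by rewrite addrK mulr1 dvdzz.
rewrite /dact br qactB (qact_XT_mod H q nk ak).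
by rewrite -qactB -(linN (XT_linear k)) -(linD (XT_linear k)) addrAC subrr add0r subrr.
Qed.

Definition fact (u : ext_space g) q : V := (u.1 : K) *: dact q + xact u.2 q.

Lemma fact_linl q : linear (fact^~ q).
Proof.
by move=> a u v; rewrite /fact ext_fst_lin ext_snd_lin xact_linl; vector_ring.
Qed.

Lemma fact_linr u : linear (fact u).
Proof. by move=> a q q'; rewrite /fact dact_linear xact_linear; vector_ring. Qed.

Lemma fact_par p r u q : u \in ext_par g p -> q \in fibre_par M r ->
  fact u q \in fibre_par M (p (+) r).
Proof.
move=> /subspace_ofP[up u0] qr; rewrite /fact rpredD ?xact_par //.
case: p up u0 => [_ /(_ isT) ->|_ _]; first by rewrite scale0r rpred0.
by rewrite rpredZ // dact_par.
Qed.

Lemma fact_br p r u v q : u \in ext_par g p -> v \in ext_par g r ->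
  fact (ext_br d u v) q = fact u (fact v q) - (-1) ^+ (p && r) *: fact v (fact u q).
Proof.
move=> /subspace_ofP[up u0] /subspace_ofP[vr v0].
rewrite /fact /= scale0r add0r.
rewrite !(linD (xact_linl q)) (linN (xact_linl q)) !(linZ (xact_linl q)) !xact_d.
rewrite (xact_br q up vr) !dact_linear !(linD (xact_linear _)) !(linZ (xact_linear _)).
case: p r up u0 vr v0 => [] [] _ u0 _ v0;
  try rewrite (u0 isT); try rewrite (v0 isT); rewrite ?expr0 ?expr1; vector_ring.
Qed.

Definition fibre_mod : supermod (ddg S) :=
  @Supermod K (ddg S) (fibre M) (fibre_par M) fact (fibre_decomp M) fact_linl
    fact_linr fact_par fact_br.

Local Notation tw := (twist M lam).

Lemma gr_closed (k : int) : lin_closed (fun q : fibre_mod => twist lam q = w ^ k *: q).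
Proof.
have tl := twist_linear H.
split=> [|a u v eu ev]; first by rewrite (lin0 tl) scaler0.
by rewrite tl eu ev; vector_ring.
Qed.

Definition fgr k := subspace_of (gr_closed k).

Lemma fgr_mod i j q : (i = j %[mod n])%Z -> q \in fgr i -> q \in fgr j.
Proof.
move=> /eqP; rewrite eqz_mod_dvd => ij /subspace_ofP qi; apply/subspace_ofP.
rewrite qi; congr (_ *: _); rewrite -(subrK j i) expfzDr ?omega_neq0 //.
by rewrite [w ^ (_ - _)]omega_dvd ?ord_gt0 ?mul1r.
Qed.

Lemma fgr_super i : is_super_subspace (@mod_par _ _ fibre_mod) (fgr i).
Proof.
move=> v /subspace_ofP vi.
have [v0 [v1 [P0 P1 e0 e1 e]]] := @eigenspace_super _ _ fibre_mod _ _
  (twist_linear H) (twist_par H) _ vi.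
by exists v0, v1; split=> //; apply/subspace_ofP.
Qed.

Lemma eproj_twist_fgr k q : eproj n (twist lam) k q \in fgr k.
Proof.
apply/subspace_ofP; apply: eproj_eig; [exact: ord_gt0 | exact: twist_linear |].
exact: twist_id.
Qed.

Lemma fgr_span (v : fibre_mod) : exists2 u : 'I_n -> fibre_mod,
  (forall i : 'I_n, u i \in fgr i) & v = \sum_i u i.
Proof.
exists (fun i : 'I_n => eproj n (twist lam) i v) => [i|].
  exact: eproj_twist_fgr.
by rewrite sum_eproj //; exact: ord_gt0.
Qed.

Lemma fgr_free (u : 'I_n -> fibre_mod) : (forall i : 'I_n, u i \in fgr i) ->
  \sum_i u i = 0 -> forall i, u i = 0.
Proof.
move=> uk u0 i; have el := eproj_linear n (twist_linear H) i.
have := lin0 el; rewrite -u0 (lin_sum el) (bigD1 i) //= big1 => [|j ji].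
  have /subspace_ofP ui := uk i.
  by rewrite (eproj_of_eig (ord_gt0 S) (twist_linear H) _ ui) subrr dvdz0 addr0.
have /subspace_ofP uj := uk j.
rewrite (eproj_of_eig (ord_gt0 S) (twist_linear H) _ uj) ifF //; apply/negP.
rewrite -eqz_mod_dvd !modz_small ?ltz_nat ?ltn_ord // eqz_nat => /eqP e.
by case/eqP: ji; exact: val_inj.
Qed.

Lemma fgr_act i j (x : ddg S) (v : fibre_mod) :
  x \in ddg_eig S i -> v \in fgr j -> act x v \in fgr (i + j).
Proof.
move=> /subspace_ofP[xi x0] /subspace_ofP vj; apply/subspace_ofP.
rewrite -[act x v]/(fact x v) /fact (xact_eig _ xi) -Xl_1.
rewrite (linD (twist_linear H)) (linZ (twist_linear H)) (twist_Xl H) vj.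
have e1 : ell S 1 - ell S 0 = Wl S 0 ('X - 1).
  by rewrite (linD (Wl_linear S 0)) (linN (Wl_linear S 0)) Wl_1 -['X]mulr1 Wl_XM Wl_1.
have r1 : root ('X - 1 : {poly K}) 1 by rewrite rootE !hornerE subrr.
rewrite /dact e1 (twist_Wl H) // vj -e1 -/dact.
rewrite (linZ dact_linear) (linZ (qact_linear (@stab_Xl _ _ M i _ _))).
rewrite scalerDr expfzDr ?omega_neq0 // !scalerA; congr (_ *: _ + _).
have [ni|/x0 ->] := boolP (n %| i)%Z; last by rewrite mul0r mulr0.
by rewrite [w ^ i]omega_dvd ?ord_gt0 // mul1r mulrC.
Qed.

Definition fibre_grading : zn_grading fibre_mod :=
  @ZnGrading _ _ fibre_mod fgr fgr_mod fgr_super fgr_span fgr_free fgr_act.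

Lemma fibre_zn_graded_simple : zn_graded_simple fibre_grading.
Proof.
split=> [|N Ngr]; first exact: fibre_neq0 H.
have [[q [Nq q0]]|h] := pselect (exists q : fibre_mod, q \in N /\ q != 0); last first.
  left=> v Nv; apply: contrapT => v0; apply: h; exists v; split=> //; exact/eqP.
right; apply: (fibre_graded_simple H).
- exact: lin_closed_mem.
- by move=> v /submod_super[v0 [v1 [? ? ? ? ?]]]; exists v0, v1.
- move=> v /Ngr[u uN ->]; rewrite (lin_sum (twist_linear H)).
  apply: rpred_sum => i _; have [uiN /subspace_ofP ->] := uN i.
  by rewrite rpredZ.
- move=> i v Nv; rewrite (qact_ell H) rpredZ //.
  have : fact (ext_elt d 1 0) v \in submod_space N := submod_act (ext_elt d 1 0) Nv.
  rewrite /fact /= scale1r.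
  by rewrite (lin0 (xact_linl v)) addr0.
- move=> k x v xk Nv; rewrite -(xact_eig _ xk).
  have : fact (ext_elt d 0 x) v \in submod_space N := submod_act (ext_elt d 0 x) Nv.
  by rewrite /fact /= scale0r add0r.
- by exists q.
Qed.

(** * From maps on [M] to morphisms into a loop module *)

Section Realisation.
Variables (V' : supermod (ddg S)) (f : M -> V').
Hypothesis f_linear : linear f.
Hypothesis f_par : forall p v, v \in mod_par M p -> f v \in mod_par V' p.
Hypothesis f_tpow : forall i v, f (act (tpow S i) v) = f v.
Hypothesis f_XT : forall k x v, x \in eig S k ->
  f (act (XT k x) v) = act (ext_elt d 0 x) (f v).
Hypothesis f_ell : forall i k v, v \in weight_at k ->
  f (act (ell S i) v) = (lam + expo S k) *: f v + i%:~R *: act (ext_elt d 1 0) (f v).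

Lemma loop_fin v : (fun k => f (wcomp lam v k)) \in subspace_of (fin_supp_closed V').
Proof.
apply/subspace_ofP; have [N hN] := comp_fin H v; exists N => k /hN ->.
exact: lin0 f_linear.
Qed.

(** [f] plays the part of evaluation at t = 1. It is used for the projection to the fibre and for
    its composite with a simple quotient. *)
Definition loop_map (v : M) : Gamma V' lam := SubspaceElt (loop_fin v).

Lemma loop_mapE v k : sub_val (loop_map v : Gamma_space V') k = f (wcomp lam v k).
Proof. by []. Qed.

Lemma loop_linear : linear loop_map.
Proof.
move=> a u v; apply: val_inj; apply/funext => k /=.
by rewrite (comp_linear H) !fctE f_linear.
Qed.

Lemma loop_map_weight_at k v : v \in weight_at k -> loop_map v = tensor_t lam k (f v).
Proof.
move=> vk; apply: val_inj; apply/funext => j /=.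
rewrite (comp_mono H vk) /mono; case: eqP => _ //; exact: lin0 f_linear.
Qed.

Lemma loop_morphism : morphism_of loop_map.
Proof.
split=> [|p v vp|x v]; first exact: loop_linear.
  by apply/subspace_ofP => k; rewrite loop_mapE f_par // comp_par.
move: v; apply: (M_ind H) => [|k v vk].
  split=> [|a u v eu ev]; first last.
    by rewrite act_linr !loop_linear eu ev act_linr.
  by rewrite (lin0 (act_linr _)) !(lin0 loop_linear) (lin0 (act_linr _)).
rewrite (loop_map_weight_at vk); move: x; apply: Lt_ind => [|i|j x xj|i].
- split=> [|a x y ex ey].
    by rewrite !(lin0 (act_linl _)) (lin0 loop_linear).
  by rewrite !act_linl loop_linear ex ey.
- by rewrite Gamma_ell (loop_map_weight_at (weight_at_ell i vk)) (f_ell i vk).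
- by rewrite (loop_map_weight_at (weight_at_XT j x vk)) f_XT // (XT_xt xj) Gamma_xt.
- by rewrite Gamma_tpow (loop_map_weight_at (weight_at_tpow i vk)) f_tpow.
Qed.

Lemma loop_neq0 : (exists v, f v != 0) -> exists v, loop_map v != 0.
Proof.
move=> fv; apply: contrapT => h; case: fv => v /eqP; apply.
move: v; apply: (M_ind H) => [|k v vk].
  by split=> [|a u v eu ev]; rewrite ?(lin0 f_linear) // f_linear eu ev scaler0 addr0.
have z : loop_map v = 0.
  by apply: contrapT => lv; apply: h; exists v; exact/eqP.
have := loop_mapE v k; rewrite z (comp_mono H vk) /mono eqxx => <-.
by [].
Qed.
End Realisation.

Lemma pr_XT k x v : x \in eig S k ->
  pr (act (XT k x) v) = act (ext_elt d 0 x : ddg S) (pr v : fibre_mod).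
Proof.
move=> xk; rewrite -[RHS]/(fact _ _) /fact /= scale0r add0r (xact_eig _ xk).
by rewrite qactE //; exact: stab_XT.
Qed.

Lemma pr_ell i k v : v \in weight_at k -> pr (act (ell S i) v) =
  (lam + expo S k) *: pr v + i%:~R *: act (ext_elt d 1 0 : ddg S) (pr v : fibre_mod).
Proof.
move=> /weight_atP vk; rewrite -[act _ (_ : fibre_mod)]/(fact _ _) /fact /= scale1r.
rewrite (lin0 (xact_linl _)) addr0 -(qact_ell H) qactE; last exact: stab_ellB.
rewrite (linD (act_linl v)) (linN (act_linl v)) vk prB (linZ (@pr_linear _ _ M)).
by rewrite addrC subrK.
Qed.
End FibreModule.

(** * Choice of a weight and conclusion *)

Lemma cuspidal_at_exists (R : realType) (S : setting R) (M : supermod (Ltilde S)) :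
  is_AL_module M -> simple M -> cuspidal M -> exists lam, cuspidal_at M lam.
Proof.
move=> AL Ms Mc; have [[v v0] _] := Ms; have [wM _] := Mc.
have [m [lam [u [uP e]]]] := wM v.
have [i ui] : exists i, u i != 0.
  apply: contrapT => h; case/eqP: v0; rewrite e big1 // => i _.
  by apply: contrapT => ui; apply: h; exists i; exact/eqP.
exists (lam i); split=> //; exists (u i) => //; apply/weight_atP.
by have /subspace_ofP -> := uP i; rewrite /expo mul0r addr0.
Qed.

Theorem theorem19 (R : realType) (S : setting R) (M : supermod (Ltilde S)) :
  is_AL_module M -> simple M -> cuspidal M ->
  (exists (lambda : complex R) (V : supermod (ddg S)) (G : zn_grading V),
     [/\ fin_dim V, zn_graded_simple G & mod_iso M (F G lambda)]) /\
  (exists (lambda : complex R) (V' : supermod (ddg S)),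
     [/\ fin_dim V', simple V' & iso_simple_subquotient M (Gamma V' lambda)]).
Proof.
move=> AL Ms Mc; have [lam H] := cuspidal_at_exists AL Ms Mc.
have Vfin : fin_dim (fibre_mod H) := fibre_fin_dim H.
have Vneq0 : exists v : fibre_mod H, v != 0 := fibre_neq0 H.
have pr_neq0 : exists v : M, pr v != 0.
  by have [q q0] := fibre_neq0 H; have [v e] := pr_surj q; exists v; rewrite -e.
split; exists lam.
- exists (fibre_mod H), (fibre_grading H); split=> //.
    exact: fibre_zn_graded_simple.
  pose f : M -> fibre_mod H := @pr _ _ M.
  have fl : linear f by exact: pr_linear.
  have [Fl Fp Fa] := loop_morphism H fl (@pr_par _ _ M) (pr_tpow AL) (pr_XT H) (pr_ell H).
  have FF v : loop_map H fl v \in F_space (fibre_grading H) lam.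
    apply/subspace_ofP => k; rewrite loop_mapE; apply/subspace_ofP.
    exact: twist_pr (comp_weight_at H v k).
  exists (fun v => SubspaceElt (FF v)); split=> [a u v||p v vp|x v].
  + by apply: val_inj; rewrite /= Fl.
  + apply: inj_surj_bij => [u v /(congr1 (@sub_val _ _ _)) /= e|y].
      apply: (simple_inj Ms (And3 Fl Fp Fa)) e; exact: loop_neq0.
    have /subspace_ofP yF := sub_valP y; pose z := sub_val (sub_val y : Gamma_space _).
    have [N zN] := Gamma_fin (sub_val y : Gamma_space _).
    have /choice[h hP] k : exists v, v \in weight_at M lam k /\ z k = pr v.
      by have /subspace_ofP/(twist_eig H)[v vk e] := yF k; exists v.
    (* The chosen lift [h k] may be nonzero where [z k] is 0, so it is cut off to the support of
       [z]. *)
    pose h' k := if (`|k| <= N)%N then h k else 0.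
    have hc : is_comp lam (fsum h') h'.
      split=> // [|k]; first by exists N => k; rewrite /h' ltnNge => /negPf ->.
      by rewrite /h'; case: ifP => _; [have [] := hP k | exact: rpred0].
    exists (fsum h'); apply: val_inj; apply: val_inj; apply/funext => k /=.
    rewrite (comp_eq H hc) /h' /f; case: leqP => kN; first by have [] := hP k.
    by rewrite (lin0 (@pr_linear _ _ M)); exact: zN.
  + by apply/subspace_ofP; exact: (Fp p v vp).
  + by apply: val_inj; rewrite /= Fa.
have [N Vs] := simple_quotient Vfin Vneq0; exists (quot_mod N).
have [pl pp pa] := proj_morphism N.
(* [N] need not be a graded subspace, so the target is the full loop module of the quotient. *)
pose f : M -> quot_mod N := fun v => Defs.proj N (pr v : fibre_mod H).
have fl : linear f by move=> a u v; rewrite /f pr_linear pl.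
have fp p v : v \in mod_par M p -> f v \in mod_par (quot_mod N) p.
  by move=> vp; apply: pp; exact: pr_par.
have fT i v : f (act (tpow S i) v) = f v by rewrite /f pr_tpow.
have fX k x v : x \in eig S k -> f (act (XT k x) v) = act (ext_elt (dder S) 0 x) (f v).
  by move=> xk; rewrite /f (pr_XT H _ xk) pa.
have fL i k v : v \in weight_at M lam k -> f (act (ell S i) v) =
    (lam + expo S k) *: f v + i%:~R *: act (ext_elt (dder S) 1 0) (f v).
  by move=> vk; rewrite /f (pr_ell H _ vk) pl (linZ pl) pa.
have f0 : exists v, f v != 0.
  have [[q q0] _] := Vs; move: q0; rewrite -[q]proj_repr.
  by have [v ->] := pr_surj (repr q : fibre M); exists v.
have Fm := loop_morphism H fl fp fT fX fL.
split=> //.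
  have [m [c [e [cl el cK eK]]]] := fin_dim_coord Vfin.
  apply: (@fin_dim_surj _ _ m (fun u => Defs.proj N (e u))) => [a u v|q].
    by rewrite el pl.
  by rewrite -[q]proj_repr; set r := repr _; exists (c r); rewrite cK.
apply: (iso_simple_subquotient_inj Ms Fm).
by apply: (simple_inj Ms Fm); exact: loop_neq0.
Qed.
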